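(* Assume $\omega<-\omega_0$. For each $0<\Omega<\Omega_{\max}$ let $\phi_{\Omega,\omega}\in\mathcal{A}_{\Omega,\omega}$ be an arbitrary action ground state. Then $|\phi_{\Omega,\omega}|\to\phi_\omega$ in $X$ as $\Omega\to0$, where $\phi_\omega$ is the unique nonnegative action ground state associated with $\omega$ when $\Omega=0$ (the unique nonnegative element of $\mathcal{A}_{0,\omega}$).
   Context: Let $d\ge 2$, let $1<p<\infty$ if $d=2$ and $1<p<\frac{d+2}{d-2}$ if $d\ge 3$. Let $V:\mathbb{R}^d\to\mathbb{R}$ satisfy $V\ge 0$ and $\lim_{|\mathbf{x}|\to\infty}V(\mathbf{x})=\infty$. Let $\Omega_{\max}:=\sup\{\gamma\ge 0:\lim_{|\mathbf{x}|\to\infty}(V(\mathbf{x})-\frac{\gamma^2}{2}(x_1^2+x_2^2))=\infty\}$ and assume $\Omega_{\max}>0$. Let $L_z=i(x_2\partial_{x_1}-x_1\partial_{x_2})$. Let $X$ be the space of complex-valued $\phi\in H^1(\mathbb{R}^d)$ with $\int_{\mathbb{R}^d}V|\phi|^2\,d\mathbf{x}<\infty$, with norm $\|\phi\|_X^2=\int_{\mathbb{R}^d}\big(|\nabla\phi|^2+(1+V)|\phi|^2\big)d\mathbf{x}$. For $\phi\in X$ the quantity $\int_{\mathbb{R}^d}\overline{\phi}L_z\phi\,d\mathbf{x}$ is well defined and real. For $0\le\Omega<\Omega_{\max}$ and $\omega\in\mathbb{R}$ define the action $S_{\Omega,\omega}(\phi)=\frac12\|\nabla\phi\|_{L^2}^2+\int_{\mathbb{R}^d}V|\phi|^2\,d\mathbf{x}+\frac{2}{p+1}\|\phi\|_{L^{p+1}}^{p+1}-\Omega\int_{\mathbb{R}^d}\overline{\phi}L_z\phi\,d\mathbf{x}+\omega\|\phi\|_{L^2}^2$,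 and $\lambda_0(\Omega)=\inf_{0\ne\phi\in X}\frac{\int_{\mathbb{R}^d}(\frac12|\nabla\phi|^2+V|\phi|^2-\Omega\overline{\phi}L_z\phi)d\mathbf{x}}{\|\phi\|_{L^2}^2}$, $\omega_0:=\lambda_0(0)>0$. One has $\lambda_0(\Omega)\le\omega_0$. For $\omega<-\lambda_0(\Omega)$, the set of action ground states is $\mathcal{A}_{\Omega,\omega}:=\arg\min_{\phi\in X}S_{\Omega,\omega}(\phi)$, which is known to be nonempty with $\min_X S_{\Omega,\omega}<0$. When $\Omega=0$ and $\omega<-\omega_0$, all elements of $\mathcal{A}_{0,\omega}$ have the same modulus a.e., and this modulus is itself in $\mathcal{A}_{0,\omega}$. *)

(* Defs.v *)
From HB Require Import structures.
From mathcomp Require Import all_boot all_order all_algebra.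
From mathcomp Require Import complex.
From mathcomp Require Import all_classical all_reals all_analysis.

Set Implicit Arguments.
Unset Strict Implicit.
Unset Printing Implicit Defensive.

Import Order.TTheory GRing.Theory Num.Theory.
Import numFieldNormedType.Exports.
Import Normc.

Local Open Scope classical_set_scope.
Local Open Scope ring_scope.

(* The sigma-algebra generated by the coordinate projections; for matrices
   over R it is the Borel sigma-algebra. *)
Definition mx_cylinders (d : measure_display) (T : measurableType d)
    (m n : nat) : set (set 'M[T]_(m, n)) :=
  [set A | exists i j, exists2 B, measurable B &
     A = (fun M : 'M[T]_(m, n) => M i j) @^-1` B].

Definition measure_mx_display : measure_display -> measure_display.
Proof. exact. Qed.

Lemma mx_measurable0 d (T : measurableType d) m n :
  <<s @mx_cylinders d T m n >> set0.
Proof. exact: sigma_algebra0. Qed.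

Lemma mx_measurableC d (T : measurableType d) m n A :
  <<s @mx_cylinders d T m n >> A -> <<s @mx_cylinders d T m n >> (~` A).
Proof. exact: sigma_algebraC. Qed.

Lemma mx_measurable_bigcup d (T : measurableType d) m n (F : _^nat) :
  (forall i, <<s @mx_cylinders d T m n >> (F i)) ->
  <<s @mx_cylinders d T m n >> (\bigcup_i (F i)).
Proof. exact: sigma_algebra_bigcup. Qed.

HB.instance Definition _ d (T : measurableType d) (m n : nat) :=
  @isMeasurable.Build (measure_mx_display d) 'M[T]_(m, n)
    <<s @mx_cylinders d T m n >>
    (@mx_measurable0 d T m n) (@mx_measurableC d T m n)
    (@mx_measurable_bigcup d T m n).

Lemma measurable_mx_coord d (T : measurableType d) m n i j :
  measurable_fun [set: 'M[T]_(m, n)] (fun M => M i j).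
Proof.
move=> _ B mB; rewrite setTI; apply: sub_sigma_algebra.
by exists i, j, B.
Qed.

Lemma measurable_fun_mx d1 (S : measurableType d1) d (T : measurableType d) m n
    (f : S -> 'M[T]_(m, n)) :
  (forall i j, measurable_fun setT (fun x => f x i j)) -> measurable_fun setT f.
Proof.
move=> mf; apply: (@measurability _ _ _ _ _ _ (@mx_cylinders d T m n)) => //.
move=> _ [_ [i [j [B mB ->]]] <-].
by have := mf i j measurableT B mB; rewrite setTI.
Qed.

Definition vcons (R : realType) (n : nat) (p : R * 'rV[R]_n) : 'rV[R]_n.+1 :=
  \row_(i < n.+1) oapp (fun j => p.2 ord0 j) p.1 (unlift ord0 i).

Definition vuncons (R : realType) (n : nat) (v : 'rV[R]_n.+1) : R * 'rV[R]_n :=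
  (v ord0 ord0, \row_(j < n) v ord0 (lift ord0 j)).

Lemma vconsK (R : realType) (n : nat) : cancel (@vcons R n) (@vuncons R n).
Proof.
move=> [x v]; rewrite /vuncons; apply: f_equal2.
  by rewrite /vcons mxE unlift_none.
by apply/rowP => j; rewrite /vcons !mxE liftK.
Qed.

Lemma vunconsK (R : realType) (n : nat) : cancel (@vuncons R n) (@vcons R n).
Proof.
move=> v; apply/rowP => i; rewrite /vcons mxE.
by case: unliftP => [k ->|->] /=; rewrite ?mxE.
Qed.

Lemma measurable_vcons (R : realType) (n : nat) : measurable_fun setT (@vcons R n).
Proof.
apply: measurable_fun_mx => i j; rewrite /vcons.
under eq_fun do rewrite mxE.
case: unliftP => [k _|_] /=; last exact: measurable_fst.
exact: (measurableT_comp (measurable_mx_coord _ _) measurable_snd).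
Qed.

Lemma measurable_vuncons (R : realType) (n : nat) : measurable_fun setT (@vuncons R n).
Proof.
apply: measurable_fun_pair; first exact: measurable_mx_coord.
apply: measurable_fun_mx => i j.
by under eq_fun do rewrite mxE; exact: measurable_mx_coord.
Qed.

Definition vcons_measure (R : realType) n
    (m : {sigma_finite_measure set 'rV[R]_n -> \bar R}) :
    set 'rV[R]_n.+1 -> \bar R :=
  pushforward (lebesgue_measure \x m)%E (@vcons R n).

Lemma vcons_measure0 (R : realType) (n : nat) m :
  @vcons_measure R n m set0 = 0%E.
Proof. by rewrite /vcons_measure /pushforward preimage_set0 measure0. Qed.

Lemma vcons_measure_ge0 (R : realType) (n : nat) m A :
  (0 <= @vcons_measure R n m A)%E.
Proof. by rewrite /vcons_measure /pushforward measure_ge0. Qed.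

Lemma vcons_measure_sigma_additive (R : realType) (n : nat) m :
  semi_sigma_additive (@vcons_measure R n m).
Proof.
have mp A : measurable A -> measurable (@vcons R n @^-1` A).
  by move=> mA; rewrite -[X in measurable X]setTI; exact: measurable_vcons.
move=> F mF tF mUF; rewrite /vcons_measure /pushforward preimage_bigcup.
apply: (@measure_semi_sigma_additive _ _ _ (lebesgue_measure \x m)%E).
- by move=> k; exact: mp.
- apply/trivIsetP => /= i j _ _ ij; rewrite -preimage_setI.
  by move/trivIsetP : tF => /(_ _ _ _ _ ij) ->//; rewrite preimage_set0.
- by rewrite -preimage_bigcup; exact: mp.
Qed.

HB.instance Definition _ (R : realType) (n : nat) m :=
  isMeasure.Build _ _ _ (@vcons_measure R n m) (vcons_measure0 m)
    (vcons_measure_ge0 m) (@vcons_measure_sigma_additive R n m).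

Lemma product_measure1_sigma_finite d1 d2 (T1 : measurableType d1)
    (T2 : measurableType d2) (R : realType)
    (m1 : {sigma_finite_measure set T1 -> \bar R})
    (m2 : {sigma_finite_measure set T2 -> \bar R}) :
  sigma_finite setT (m1 \x m2)%E.
Proof.
have /sigma_finiteP[F [TF ndF Foo]] := sigma_finiteT m1.
have /sigma_finiteP[G [TG ndG Goo]] := sigma_finiteT m2.
exists (fun n => F n `*` G n).
  rewrite -setXTT TF TG predeqE => -[x y]; split.
    move=> [/= [n _ Fnx] [k _ Gky]]; exists (maxn n k) => //; split.
    - by move: x Fnx; exact/subsetPset/ndF/leq_maxl.
    - by move: y Gky; exact/subsetPset/ndG/leq_maxr.
  by move=> [n _ []/= ? ?]; split; exists n.
move=> k; have [? ?] := Foo k; have [? ?] := Goo k.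
split; first exact: measurableX.
by rewrite product_measure1E// lte_mul_pinfty// ge0_fin_numE.
Qed.

Lemma vcons_measure_sigma_finite (R : realType) (n : nat) m :
  sigma_finite setT (@vcons_measure R n m).
Proof.
have [F TF Ffin] := product_measure1_sigma_finite (@lebesgue_measure R) m.
have mp A : measurable A -> measurable (@vuncons R n @^-1` A).
  by move=> mA; rewrite -[X in measurable X]setTI; exact: measurable_vuncons.
exists (fun k => @vuncons R n @^-1` F k).
  by rewrite -preimage_bigcup -TF preimage_setT.
move=> k; have [mFk Fk] := Ffin k; split; first exact: mp.
rewrite /vcons_measure /pushforward -comp_preimage.
by rewrite (_ : @vuncons R n \o _ = id) ?preimage_id//; apply/funext/vconsK.
Qed.

HB.instance Definition _ (R : realType) (n : nat) m :=
  Measure_isSigmaFinite.Build _ _ _ (@vcons_measure R n m)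
    (@vcons_measure_sigma_finite R n m).

(* [lebesgue_rV R d] is the d-fold product of the Lebesgue measure on R. *)
Fixpoint lebesgue_rV (R : realType) (d : nat) :
    {sigma_finite_measure set 'rV[R]_d -> \bar R} :=
  match d with
  | 0%N => [the {sigma_finite_measure set _ -> \bar R} of \d_(0 : 'rV[R]_0)]
  | d'.+1 => [the {sigma_finite_measure set _ -> \bar R} of
              vcons_measure (lebesgue_rV R d')]
  end.

Lemma lebesgue_rV_box (R : realType) (d : nat) (a b : 'rV[R]_d) :
  (forall i, a ord0 i <= b ord0 i) ->
  lebesgue_rV R d [set x | forall i, a ord0 i < x ord0 i <= b ord0 i] =
  (\prod_(i < d) (b ord0 i - a ord0 i))%:E.
Proof.
elim: d a b => [|d IH] a b ab.
  rewrite big_ord0 /= diracE mem_set//.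
  by case.
pose B := [set y : 'rV[R]_d | forall i,
  a ord0 (lift ord0 i) < y ord0 i <= b ord0 (lift ord0 i)].
have mB : measurable B.
  rewrite (_ : B = \bigcap_(i in [set: 'I_d])
    (fun y : 'rV[R]_d => y ord0 i) @^-1`
      `]a ord0 (lift ord0 i), b ord0 (lift ord0 i)]%classic); last first.
    apply/seteqP; split => [y By i _|y By i] /=; rewrite ?in_itv; first exact: By.
    by have := By i I; rewrite /= in_itv.
  apply: fin_bigcap_measurable => // i _.
  by rewrite -[X in measurable X]setTI; exact: measurable_mx_coord.
rewrite /= /vcons_measure /pushforward.
rewrite (_ : _ @^-1` _ = `]a ord0 ord0, b ord0 ord0]%classic `*` B); last first.
  apply/seteqP; split => -[t y] /=.
    move=> h; split.
      by have := h ord0; rewrite /vcons mxE unlift_none /= in_itv.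
    by move=> i; have := h (lift ord0 i); rewrite /vcons mxE liftK.
  rewrite in_itv/= => -[ht hy] i; rewrite /vcons mxE.
  by case: unliftP => [k ->|->] /=; [exact: hy|].
rewrite product_measure1E//= lebesgue_measure_itv/= lte_fin.
have -> : lebesgue_rV R d B = (\prod_(i < d)
    (b ord0 (lift ord0 i) - a ord0 (lift ord0 i)))%:E.
  pose a' : 'rV[R]_d := \row_i a ord0 (lift ord0 i).
  pose b' : 'rV[R]_d := \row_i b ord0 (lift ord0 i).
  have := IH a' b'; rewrite /a' /b'.
  under eq_bigr do rewrite !mxE.
  move=> <-; last by move=> i; rewrite !mxE.
  congr (lebesgue_rV R d _); apply/seteqP; split => y /= h i;
    by have := h i; rewrite !mxE.
rewrite big_ord_recl; case: ifPn => [_|]; first by rewrite -EFinD -EFinM.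
rewrite -leNgt => ba; rewrite mul0e.
have /eqP -> : b ord0 ord0 == a ord0 ord0 by rewrite eq_le ba ab.
by rewrite subrr mul0r.
Qed.

Definition cmeasurable (R : realType) (d : nat) (f : 'rV[R]_d -> R[i]) : Prop :=
  measurable_fun setT (fun x => complex.Re (f x)) /\
  measurable_fun setT (fun x => complex.Im (f x)).

Definition cintegral (R : realType) (d : nat) (f : 'rV[R]_d -> R[i]) : R[i] :=
  Complex (\int[lebesgue_rV R d]_x complex.Re (f x))
          (\int[lebesgue_rV R d]_x complex.Im (f x)).

Definition mass (R : realType) (d : nat) (f : 'rV[R]_d -> R[i]) : \bar R :=
  (\int[lebesgue_rV R d]_x (normc (f x) ^+ 2)%:E)%E.

Definition L2 (R : realType) (d : nat) : set ('rV[R]_d -> R[i]) :=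
  [set f | cmeasurable f /\ (mass f < +oo)%E].

Definition partial (R : realType) (d : nat) (j : 'I_d) (f : 'rV[R]_d -> R) :
    'rV[R]_d -> R :=
  fun x => 'D_(delta_mx ord0 j) f x.

Definition iter_partial (R : realType) (d : nat) (s : seq 'I_d)
    (f : 'rV[R]_d -> R) : 'rV[R]_d -> R :=
  foldr (@partial R d) f s.

(* C_c^oo(R^d): differentiability of the partial derivatives of all orders
   entails their continuity. *)
Definition test_function (R : realType) (d : nat) (eta : 'rV[R]_d -> R) : Prop :=
  (forall s x, differentiable (iter_partial s eta) x) /\
  compact (closure [set x | eta x != 0]).

Definition weak_partials (R : realType) (d : nat) (j : 'I_d)
    (f : 'rV[R]_d -> R[i]) : set ('rV[R]_d -> R[i]) :=
  [set g | L2 g /\ forall eta, test_function eta ->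
     cintegral (fun x => (partial j eta x)%:C%C * f x) =
     - cintegral (fun x => (eta x)%:C%C * g x)].

Definition H1 (R : realType) (d : nat) : set ('rV[R]_d -> R[i]) :=
  [set f | L2 f /\ forall j, weak_partials j f !=set0].

(* The j-th weak partial derivative; it is determined up to a null set when [f]
   is in [H1], and is the junk value 0 if [f] has none in L^2. *)
Definition wpartial (R : realType) (d : nat) (j : 'I_d)
    (f : 'rV[R]_d -> R[i]) : 'rV[R]_d -> R[i] :=
  xget (cst 0) (weak_partials j f).

(* A Lebesgue measurable function, i.e. one that is a.e. equal to a Borel one.
   The library integral of a nonnegative function is a supremum over simple
   functions below it, so it is the Lebesgue integral for such functions. *)
Definition lebesgue_measurable (R : realType) (d : nat) (V : 'rV[R]_d -> R) :
    Prop :=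
  exists2 W : 'rV[R]_d -> R, measurable_fun setT W &
    \forall x \ae lebesgue_rV R d, V x = W x.

Definition enorm (R : realType) (d : nat) (x : 'rV[R]_d) : R :=
  Num.sqrt (\sum_(j < d) x ord0 j ^+ 2).

Definition tends_to_infty (R : realType) (d : nat) (f : 'rV[R]_d -> R) : Prop :=
  forall A : R, exists r : R, forall x, r < enorm x -> A < f x.

Definition ax1 (d : nat) (d_ge2 : (2 <= d)%N) : 'I_d := Ordinal (ltnW d_ge2).
Definition ax2 (d : nat) (d_ge2 : (2 <= d)%N) : 'I_d := Ordinal d_ge2.

Definition Omega_max (R : realType) (d : nat) (d_ge2 : (2 <= d)%N)
    (V : 'rV[R]_d -> R) : \bar R :=
  ereal_sup [set gamma%:E | gamma in [set gamma : R | 0 <= gamma /\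
    tends_to_infty (fun x => V x - gamma ^+ 2 / 2 *
      (x ord0 (ax1 d_ge2) ^+ 2 + x ord0 (ax2 d_ge2) ^+ 2))]].

Definition kinetic (R : realType) (d : nat) (f : 'rV[R]_d -> R[i]) : \bar R :=
  (\int[lebesgue_rV R d]_x (\sum_(j < d) normc (wpartial j f x) ^+ 2)%:E)%E.

Definition potential (R : realType) (d : nat) (V : 'rV[R]_d -> R)
    (f : 'rV[R]_d -> R[i]) : \bar R :=
  (\int[lebesgue_rV R d]_x (V x * normc (f x) ^+ 2)%:E)%E.

Definition Lz (R : realType) (d : nat) (d_ge2 : (2 <= d)%N)
    (f : 'rV[R]_d -> R[i]) : 'rV[R]_d -> R[i] :=
  fun x => Complex 0 1 *
    ((x ord0 (ax2 d_ge2))%:C%C * wpartial (ax1 d_ge2) f x -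
     (x ord0 (ax1 d_ge2))%:C%C * wpartial (ax2 d_ge2) f x).

(* The integral of conj(f) * Lz f is a real number for [f] in the energy
   space; [Re] only serves to view it as an element of R. *)
Definition angular_momentum (R : realType) (d : nat) (d_ge2 : (2 <= d)%N)
    (f : 'rV[R]_d -> R[i]) : R :=
  complex.Re (cintegral (fun x => conjc (f x) * Lz d_ge2 f x)).

Definition energy_space (R : realType) (d : nat) (V : 'rV[R]_d -> R) :
    set ('rV[R]_d -> R[i]) :=
  [set f | H1 f /\ (potential V f < +oo)%E].

Definition normX (R : realType) (d : nat) (V : 'rV[R]_d -> R)
    (f : 'rV[R]_d -> R[i]) : \bar R :=
  ((\int[lebesgue_rV R d]_x (\sum_(j < d) normc (wpartial j f x) ^+ 2 +
      (1 + V x) * normc (f x) ^+ 2)%:E) `^ 2^-1)%E.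

Definition quadratic_energy (R : realType) (d : nat) (d_ge2 : (2 <= d)%N)
    (V : 'rV[R]_d -> R) (Omega : R) (f : 'rV[R]_d -> R[i]) : \bar R :=
  ((2^-1)%:E * kinetic f + potential V f -
   (Omega * angular_momentum d_ge2 f)%:E)%E.

(* All the terms are finite on the energy space (the L^(p+1) norm by the
   Sobolev embedding). *)
Definition action (R : realType) (d : nat) (d_ge2 : (2 <= d)%N) (p : R)
    (V : 'rV[R]_d -> R) (Omega omega : R) (f : 'rV[R]_d -> R[i]) : \bar R :=
  ((2^-1)%:E * kinetic f + potential V f +
   (2 / (p + 1))%:E * (\int[lebesgue_rV R d]_x (normc (f x) `^ (p + 1))%:E) -
   (Omega * angular_momentum d_ge2 f)%:E + omega%:E * mass f)%E.

(* [mass f != 0] says that [f] is not zero a.e. *)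
Definition lambda0 (R : realType) (d : nat) (d_ge2 : (2 <= d)%N)
    (V : 'rV[R]_d -> R) (Omega : R) : \bar R :=
  ereal_inf [set (quadratic_energy d_ge2 V Omega f * (fine (mass f))^-1%:E)%E |
    f in [set f | energy_space V f /\ mass f != 0%E]].

Definition action_ground_states (R : realType) (d : nat) (d_ge2 : (2 <= d)%N)
    (p : R) (V : 'rV[R]_d -> R) (Omega omega : R) :
    set ('rV[R]_d -> R[i]) :=
  [set f | energy_space V f /\ forall g, energy_space V g ->
     (action d_ge2 p V Omega omega f <= action d_ge2 p V Omega omega g)%E].

Definition cmodulus (R : realType) (d : nat) (f : 'rV[R]_d -> R[i]) :
    'rV[R]_d -> R[i] :=
  fun x => `|f x|.

(* In R[i], [0 <= z] means that z is a nonnegative real number. *)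
Definition ae_nonneg (R : realType) (d : nat) (f : 'rV[R]_d -> R[i]) : Prop :=
  \forall x \ae lebesgue_rV R d, 0 <= f x.

Definition ae_equal (R : realType) (d : nat) (f g : 'rV[R]_d -> R[i]) : Prop :=
  \forall x \ae lebesgue_rV R d, f x = g x.

(* Main.v *)
Require Import Defs.
From HB Require Import structures.
From mathcomp Require Import all_boot all_order all_algebra.
From mathcomp Require Import complex ring lra.
From mathcomp Require Import all_classical all_reals all_analysis measurable_realfun.

(** Only the modulus of a function enters the action at zero angular velocity,
except through the kinetic term, and passing to the modulus does not increase
that term (Kato's inequality, [kato_dirichlet]).  So at zero angular velocity
the problem is to minimise, over nonnegative real functions u,
  E(u) = 1/2 int |grad u|^2 + int W u^2 + c int u^q + omega int u^2,
where q = p + 1, c = 2 / q and W is a Borel function equal to V almost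
everywhere ([exists_borel_version]).

The heart of the proof is a stability estimate ([energy_stability]): functions
u, v >= 0 whose energies are close to inf E are close to each other in the norm
of X.  Let w = sqrt ((u^2 + v^2) / 2) = |u + i v| / sqrt 2.  The two quadratic
integrals are affine in the density u^2, the power integral is strictly convex
in it because q > 2, and the Dirichlet integral of w is at most the mean of
those of u and v by Kato's inequality again.  As E(w) >= inf E, the convexity
gap of t^(q/2) between u^2 and v^2 has a small integral.  On a large cube this
bounds int |u^2 - v^2|, and outside it the growth of W does; since
(u - v)^2 <= |u^2 - v^2|, the distance of u and v in L^2 is small ([mass_gap]).
Comparing E at (u + v) / 2 with the parallelogram identity then bounds the
gradient and potential parts of u - v, because the mass term, whose
coefficient may be negative, is already under control.

This one estimate gives everything that compactness arguments usually provide: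
minimising sequences are Cauchy, so a nonnegative minimiser u0 exists
([exists_minimizer]); it is unique; and |phi_Omega| converges to it as soon as
E(|phi_Omega|) tends to inf E.  For that last point, pick gamma > 0 such that
V - gamma^2 / 2 (x_1^2 + x_2^2) tends to infinity.  Young's inequality gives
  gamma |L(f)| <= 1/2 int |grad f|^2 + int W |f|^2 + C int |f|^2
for the angular momentum L ([angular_momentum_bound]).  When Omega <= gamma / 2
half of the energy absorbs the rotation term, so the ground states phi_Omega
stay in a bounded set, on which L is bounded, and
  E(|phi_Omega|) <= S_0(phi_Omega) = S_Omega(phi_Omega) + Omega L(phi_Omega)
                 <= S_Omega(u0) + O(Omega) = E(u0) + O(Omega).

Weak derivatives are handled through difference quotients: u in L^2 has a weak
j-th derivative of squared norm at most C exactly when the squared norm of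
u(. + h e_j) - u is at most C h^2 for small h ([wderiv_tau_le],
[wderiv_of_tau_le]).  This criterion is stable under 1-Lipschitz maps, which is
Kato's inequality.  It rests on the Riesz representation theorem in L^2
([riesz_on_subspace]) and on the fact that a function of L^2 orthogonal to all
test functions vanishes ([test_function_orthogonal_eq0]). *)

Set Implicit Arguments.
Unset Strict Implicit.
Unset Printing Implicit Defensive.

Import Order.TTheory GRing.Theory Num.Theory.
Import numFieldNormedType.Exports.

Local Open Scope classical_set_scope.
Local Open Scope ring_scope.

(** * Square-integrable functions *)

Lemma norm_mul_le_sqr (R : realType) (a b : R) : `|a * b| <= a ^+ 2 + b ^+ 2.
Proof.
have h1 := sqr_ge0 (a - b); have h2 := sqr_ge0 (a + b).
rewrite ler_norml; apply/andP; split; nra.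
Qed.

Section SquareIntegrable.
Context (d : measure_display) (T : measurableType d) (R : realType).
Variable mu : {measure set T -> \bar R}.
Implicit Types (u v w : T -> R).

Lemma le_integral_EFin (f g : T -> R) :
  measurable_fun setT f -> measurable_fun setT g ->
  (forall x, 0 <= f x) -> (forall x, f x <= g x) ->
  (\int[mu]_x (f x)%:E <= \int[mu]_x (g x)%:E)%E.
Proof.
move=> mf mg f0 fg; apply: ge0_le_integral => //.
- by move=> x _; rewrite lee_fin.
- exact/measurable_EFinP.
- exact/measurable_EFinP.
- by move=> x _; rewrite lee_fin.
Qed.

Lemma integralZ_EFin (k : R) (f : T -> R) :
  0 <= k -> measurable_fun setT f -> (forall x, 0 <= f x) ->
  (\int[mu]_x (k * f x)%:E = k%:E * \int[mu]_x (f x)%:E)%E.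
Proof.
move=> k0 mf f0; under eq_integral do rewrite EFinM.
rewrite ge0_integralZl_EFin//; first by move=> x _; rewrite lee_fin.
exact/measurable_EFinP.
Qed.

Lemma integralD_EFin_ge0 (f g : T -> R) :
  measurable_fun setT f -> measurable_fun setT g ->
  (forall x, 0 <= f x) -> (forall x, 0 <= g x) ->
  (\int[mu]_x (f x + g x)%:E = \int[mu]_x (f x)%:E + \int[mu]_x (g x)%:E)%E.
Proof.
move=> mf mg f0 g0; under eq_integral do rewrite EFinD.
rewrite ge0_integralD//.
- by move=> x _; rewrite lee_fin.
- exact/measurable_EFinP.
- by move=> x _; rewrite lee_fin.
- exact/measurable_EFinP.
Qed.

Definition sqint u : Prop :=
  measurable_fun setT u /\ (\int[mu]_x (u x ^+ 2)%:E < +oo)%E.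

Definition ip u v : R := \int[mu]_x (u x * v x).

Lemma sqint_meas u : sqint u -> measurable_fun setT u.
Proof. by case. Qed.

Lemma sqint_sqr_int u : sqint u -> mu.-integrable setT (EFin \o (fun x => u x ^+ 2)).
Proof.
move=> [mu_ iu]; apply/integrableP; split.
  by apply/measurable_EFinP; exact: measurable_funX.
by under eq_integral do rewrite /= ger0_norm ?sqr_ge0//.
Qed.

Lemma sqint_mul u v : sqint u -> sqint v ->
  mu.-integrable setT (EFin \o (fun x => u x * v x)).
Proof.
move=> su sv.
have h : mu.-integrable setT
    (fun x => ((u x ^+ 2)%:E + (v x ^+ 2)%:E)%E).
  by apply: integrableD => //; exact: sqint_sqr_int.
apply: le_integrable h => //.
  by apply/measurable_EFinP; apply: measurable_funM; [case: su|case: sv].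
move=> x _ /=; rewrite lee_fin [leRHS]ger0_norm ?addr_ge0 ?sqr_ge0//.
exact: norm_mul_le_sqr.
Qed.

Lemma sqint_dom u v : measurable_fun setT u -> sqint v ->
  (forall x, u x ^+ 2 <= v x ^+ 2) -> sqint u.
Proof.
move=> mu_ [mv iv] h; split => //; apply: le_lt_trans iv.
by apply: le_integral_EFin => //;
  [exact: measurable_funX|exact: measurable_funX|move=> x; exact: sqr_ge0].
Qed.

Lemma sqintZ k u : sqint u -> sqint (k \*o u).
Proof.
move=> su; split; first by apply: measurable_funM => //; case: su.
have /integrableP[_] := integrableZl measurableT (k ^+ 2) (sqint_sqr_int su).
by under eq_integral do rewrite -EFinM abse_EFin -exprMn ger0_norm ?sqr_ge0//.
Qed.

Lemma sqintD u v : sqint u -> sqint v -> sqint (u \+ v).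
Proof.
move=> su sv; split; first by apply: measurable_funD; [case: su|case: sv].
have h : mu.-integrable setT
  (fun x => ((u x ^+ 2)%:E + (v x ^+ 2)%:E)%E).
  by apply: integrableD => //; exact: sqint_sqr_int.
have muv : measurable_fun setT (fun x => (u x ^+ 2 + v x ^+ 2) *+ 2).
  by apply: measurable_funD; apply: measurable_funD;
    apply: measurable_funX; (case: su + case: sv).
have /integrableP[_ ] := integrableD measurableT h h.
apply: le_lt_trans.
under [leRHS]eq_integral do
  rewrite -!EFinD abse_EFin ger0_norm ?addr_ge0 ?sqr_ge0// -mulr2n.
apply: le_integral_EFin => //.
- by apply: measurable_funX; apply: measurable_funD; [case: su|case: sv].
- by move=> x; exact: sqr_ge0.
- move=> x /=; have h' := sqr_ge0 (u x - v x); rewrite sqrrD; rewrite sqrrB in h'.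
  move: h'; rewrite !mulr2n; lra.
Qed.

Lemma sqintN u : sqint u -> sqint (\- u).
Proof.
move=> su; have -> : \- u = (-1) \*o u by apply/funext => x /=; rewrite mulN1r.
exact: sqintZ.
Qed.

Lemma sqintB u v : sqint u -> sqint v -> sqint (u \- v).
Proof. by move=> su sv; apply: sqintD => //; exact: sqintN. Qed.

Lemma sqint0 : sqint (cst 0).
Proof.
split => //; under eq_integral do rewrite expr0n /=.
by rewrite integral0.
Qed.

Lemma ipC u v : ip u v = ip v u.
Proof. by apply: eq_Rintegral => x _; rewrite mulrC. Qed.

Lemma ipDl u v w : sqint u -> sqint v -> sqint w -> ip (u \+ v) w = ip u w + ip v w.
Proof.
move=> su sv sw; rewrite /ip -RintegralD//; try exact: sqint_mul.
by apply: eq_Rintegral => x _ /=; rewrite mulrDl.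
Qed.

Lemma ipZl k u w : sqint u -> sqint w -> ip (k \*o u) w = k * ip u w.
Proof.
move=> su sw; rewrite /ip -RintegralZl//; last exact: sqint_mul.
by apply: eq_Rintegral => x _ /=; rewrite mulrA.
Qed.

Lemma ipNl u w : sqint u -> sqint w -> ip (\- u) w = - ip u w.
Proof.
move=> su sw; rewrite -mulN1r -ipZl//.
by apply: eq_Rintegral => x _ /=; rewrite mulN1r.
Qed.

Lemma ipBl u v w : sqint u -> sqint v -> sqint w -> ip (u \- v) w = ip u w - ip v w.
Proof. by move=> su sv sw; rewrite -ipNl// -ipDl//; exact: sqintN. Qed.

Lemma ipDr u v w : sqint u -> sqint v -> sqint w -> ip w (u \+ v) = ip w u + ip w v.
Proof. by move=> su sv sw; rewrite ipC ipDl// !(ipC w). Qed.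

Lemma ipZr k u w : sqint u -> sqint w -> ip w (k \*o u) = k * ip w u.
Proof. by move=> su sw; rewrite ipC ipZl// (ipC w). Qed.

Lemma ipBr u v w : sqint u -> sqint v -> sqint w -> ip w (u \- v) = ip w u - ip w v.
Proof. by move=> su sv sw; rewrite ipC ipBl// !(ipC w). Qed.

Lemma ip_ge0 u : 0 <= ip u u.
Proof. by apply: Rintegral_ge0 => x _; rewrite -expr2 sqr_ge0. Qed.

Lemma EFin_ip u : sqint u -> (ip u u)%:E = (\int[mu]_x (u x ^+ 2)%:E)%E.
Proof.
move=> [_ su]; rewrite /ip /Rintegral fineK//.
by rewrite ge0_fin_numE// integral_ge0// => x _; rewrite lee_fin -expr2 sqr_ge0.
Qed.

Lemma ipDD u v : sqint u -> sqint v ->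
  ip (u \+ v) (u \+ v) = ip u u + 2 * ip u v + ip v v.
Proof.
move=> su sv; have suv := sqintD su sv.
rewrite ipDl// !ipDr// (ipC v u); ring.
Qed.

Lemma ipBB u v : sqint u -> sqint v ->
  ip (u \- v) (u \- v) = ip u u - 2 * ip u v + ip v v.
Proof.
move=> su sv; have suv := sqintB su sv.
rewrite ipBl// !ipBr// (ipC v u); ring.
Qed.

(** The discriminant argument; it is reused below, with only an infimum in place
of a minimum, to turn near-minimality into near-orthogonality. *)
Lemma quadratic_ge0_le (a b c : R) : 0 <= a ->
  (forall t, 0 <= a + 2 * (t * b) + t ^+ 2 * c) -> b ^+ 2 <= a * c.
Proof.
move=> a0 h; case: (ltrgtP c 0) => c0.
- exfalso; have c0' : c != 0 by rewrite lt_eqF.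
  have b0 : 0 <= `|b| by [].
  have bb : - `|b| <= b <= `|b| by rewrite -ler_norml.
  have [t t1 tc] : exists2 t, 1 <= t & t * c = - (a + 2 * `|b| + 1 - c).
    exists ((a + 2 * `|b| + 1 - c) / - c); last by field.
    by rewrite ler_pdivlMr ?oppr_gt0// mul1r; lra.
  have := h t; rewrite expr2 -(mulrA t t c) tc.
  move: bb => /andP[bb1 bb2]; nra.
- have := h (- b / c).
  have -> : a + 2 * ((- b / c) * b) + (- b / c) ^+ 2 * c = a - b ^+ 2 / c.
    by field; rewrite gt_eqF.
  by rewrite subr_ge0 ler_pdivrMr.
- rewrite c0 mulr0.
  suff -> : b = 0 by rewrite expr0n.
  apply/eqP/negP => /negP b0.
  have := h (- (a + 1) / b); rewrite c0 mulr0 addr0.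
  have -> : - (a + 1) / b * b = - (a + 1) by field.
  lra.
Qed.

Lemma cauchy_schwarz u v : sqint u -> sqint v -> ip u v ^+ 2 <= ip u u * ip v v.
Proof.
move=> su sv; apply: quadratic_ge0_le; first exact: ip_ge0.
move=> t; have := ip_ge0 (u \+ (t \*o v)).
have stv := sqintZ t sv.
by rewrite ipDD// ipZr// ipZl// ipZr// expr2 -mulrA.
Qed.

Lemma ip_eq0_ae u : sqint u -> ip u u = 0 -> {ae mu, forall x, u x = 0}.
Proof.
move=> su u0; have := EFin_ip su; rewrite u0 => /esym hi.
have mu2 : measurable_fun setT (fun x => (u x ^+ 2)%:E).
  by apply/measurable_EFinP; apply: measurable_funX; case: su.
have := (ae_eq_integral_abs mu measurableT mu2).1.
rewrite (_ : (\int[mu]_x `|(u x ^+ 2)%:E|)%E = 0%E).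
  move=> /(_ erefl); apply: filterS => x /(_ I) /= [] /eqP.
  by rewrite sqrf_eq0 => /eqP.
by rewrite -[RHS]hi; apply: eq_integral => x _; rewrite gee0_abs ?lee_fin ?sqr_ge0.
Qed.

Lemma ae_eq_ip u v w : sqint u -> sqint v -> sqint w ->
  {ae mu, forall x, u x = v x} -> ip u w = ip v w.
Proof.
move=> su sv sw uv; congr fine; apply: ae_eq_integral => //.
- by apply/measurable_EFinP; apply: measurable_funM; [case: su|case: sw].
- by apply/measurable_EFinP; apply: measurable_funM; [case: sv|case: sw].
- by apply: filterS uv => x -> _.
Qed.

End SquareIntegrable.

(** * Completeness of L^2 and the Riesz representation theorem *)

Lemma cvgn_EFin (R : realType) (a : nat -> R) (l : R) :
  a k @[k --> \oo] --> l -> (a k)%:E @[k --> \oo] --> l%:E.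
Proof. by move=> h; apply/fine_cvgP; split; [exact: nearW|exact: h]. Qed.

Section Completeness.
Context (d : measure_display) (T : measurableType d) (R : realType).
Variable mu : {measure set T -> \bar R}.
Implicit Types (u v w : T -> R).

(** The form of Fatou's lemma for limits that exist only almost everywhere: the
bound on the integrals may itself vary with the index, as it does along
minimising sequences. *)
Lemma fatou_ae (f : nat -> T -> R) (g : T -> R) (c : nat -> R) (l : R) :
  (forall k, measurable_fun setT (f k)) -> measurable_fun setT g ->
  (forall k x, 0 <= f k x) -> (forall x, 0 <= g x) ->
  {ae mu, forall x, f k x @[k --> \oo] --> g x} ->
  (forall k, (\int[mu]_x (f k x)%:E <= (c k)%:E)%E) -> c k @[k --> \oo] --> l ->
  (\int[mu]_x (g x)%:E <= l%:E)%E.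
Proof.
move=> mf mg f0 g0 fg fc cl.
have H := @fatou _ _ _ mu setT measurableT (fun k x => (f k x)%:E)
  (fun k => (measurable_EFinP _ _).2 (mf k)) (fun k x _ => f0 k x).
have E : (\int[mu]_x (g x)%:E <= \int[mu]_x limn_einf (fun k => (f k x)%:E))%E.
  apply: ae_ge0_le_integral => //.
  - by move=> x _; rewrite lee_fin.
  - exact/measurable_EFinP.
  - move=> x _; rewrite limn_einf_lim; apply: lime_ge.
      exact: is_cvg_einfs.
    by apply: nearW => n; apply: le_ereal_inf_tmp => _ [m _ <-]; rewrite lee_fin.
  - rewrite (_ : (fun x => limn_einf _) =
        (fun x => - limn_esup (fun k => - (f k x)%:E))%E).
      apply: measurableT_comp => //; apply: measurable_fun_limn_esup => k.
      by apply: measurableT_comp => //; exact/measurable_EFinP.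
    by apply/funext => x; rewrite -[in RHS]limn_einfN; congr limn_einf;
      apply/funext => k /=; rewrite opprK.
  - apply: filterS fg => x fgx _.
    by rewrite (cvg_limn_einf_sup (cvgn_EFin fgx)).1.
apply: (le_trans E); apply: (le_trans H).
have <- : limn_einf (fun k => (c k)%:E) = l%:E.
  exact: (cvg_limn_einf_sup (cvgn_EFin cl)).1.
rewrite !limn_einf_lim; apply: lee_lim.
- exact: is_cvg_einfs.
- exact: is_cvg_einfs.
- apply: nearW => n; apply: le_ereal_inf_tmp => _ [m nm <-].
  by apply: le_trans (fc m); apply: ereal_inf_lbound; exists m.
Qed.

(** By 2 |x| <= 2^k x^2 + 2^-k, which is (2^k |x| - 1)^2 >= 0 up to a factor, the
increments are dominated by a summable series.  Squares suit the L^2 setting: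
no Cauchy-Schwarz step over the whole space is needed, so the measure may be
infinite. *)
Lemma cvgn_of_weighted_sqr (a : nat -> R) (C : R) :
  (forall n, \sum_(0 <= k < n) (2 ^+ k * (a k.+1 - a k) ^+ 2) <= C) -> cvgn a.
Proof.
move=> hC; pose dd k := a k.+1 - a k.
have ha : a = fun n => series dd n + a 0%N.
  apply/funext => n; rewrite /series /= telescope_sumr// subrK//.
suff : cvgn (series dd).
  by move=> h; rewrite ha; apply: is_cvgD => //; exact: is_cvg_cst.
apply: normed_cvg.
have hg : cvgn (series (fun k => 2 ^+ k * dd k ^+ 2)).
  apply: nondecreasing_is_cvgn.
    by apply: nondecreasing_series => n _ _; rewrite mulr_ge0// sqr_ge0.
  by exists C => _ [n _ <-]; exact: hC.
have hh : cvgn (series (geometric 1 (2^-1 : R))).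
  by apply: is_cvg_geometric_series; rewrite ger0_norm ?invr_ge0// invf_lt1// ltr1n.
apply: (@series_le_cvg _ _ (fun k => 2 ^+ k * dd k ^+ 2 + geometric 1 2^-1 k)).
- by move=> n; exact: normr_ge0.
- move=> n; apply: addr_ge0; first by apply: mulr_ge0; rewrite ?sqr_ge0// exprn_ge0.
  by apply: mulr_ge0 => //; rewrite exprn_ge0.
- move=> n; rewrite /geometric /= mul1r exprVn.
  have t0 : 0 < (2 ^+ n : R) by rewrite exprn_gt0.
  have tt : 2 ^+ n * (2 ^+ n)^-1 = 1 :> R by rewrite divff// gt_eqF.
  set t : R := 2 ^+ n in t0 tt *; set s := t^-1 in tt *.
  have s0 : 0 < s by rewrite invr_gt0.
  rewrite -(real_normK (num_real (dd n))); set b := `|dd n|.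
  have b0 : 0 <= b := normr_ge0 _.
  have hb : t * (b - s) ^+ 2 = t * b ^+ 2 + s * (t * s) - 2 * b * (t * s) by ring.
  rewrite tt in hb.
  have : 0 <= t * (b - s) ^+ 2 by rewrite mulr_ge0 ?sqr_ge0// ltW.
  lra.
- rewrite (_ : series _ = series (fun k => 2 ^+ k * dd k ^+ 2) \+ series (geometric 1 2^-1)).
    exact: is_cvgD.
  by apply/funext => n; rewrite /series /= big_split.
Qed.

(** Riesz-Fischer.  The almost everywhere convergent subsequence is part of the
conclusion because the potential and power integrals of a limit are reached
through Fatou's lemma. *)
Theorem sqint_complete (u_ : nat -> T -> R) :
  (forall n, sqint mu (u_ n)) ->
  (forall e, 0 < e -> exists N, forall n m, (N <= n)%N -> (N <= m)%N ->
     ip mu (u_ n \- u_ m) (u_ n \- u_ m) <= e) ->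
  exists u, [/\ sqint mu u,
    forall e, 0 < e -> exists N, forall n, (N <= n)%N ->
      ip mu (u_ n \- u) (u_ n \- u) <= e &
    exists2 s : nat -> nat, (forall k, (k <= s k)%N) &
      {ae mu, forall x, u_ (s k) x @[k --> \oo] --> u x}].
Proof.
move=> su cauchy.
(* Rate 4^-k, so that the increments weighted by 2^k stay summable. *)
have /choice[N HN] : forall k, exists N, forall n m, (N <= n)%N -> (N <= m)%N ->
     ip mu (u_ n \- u_ m) (u_ n \- u_ m) <= (4 ^+ k)^-1.
  by move=> k; apply: cauchy; rewrite invr_gt0 exprn_gt0.
(* Crude but monotone: [s k] exceeds [k] and every [N i] with [i <= k]. *)
pose s k := (k + \sum_(i < k.+1) N i)%N.
have sk k : (k <= s k)%N by rewrite /s leq_addr.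
have sN k : (N k <= s k)%N by rewrite /s big_ord_recr /= addnA leq_addl.
have sSN k : (N k <= s k.+1)%N.
  by rewrite /s !big_ord_recr /= addnA (leq_trans _ (leq_addr _ _))// addnA leq_addl.
pose F k x := (2 ^+ k * (u_ (s k.+1) x - u_ (s k) x) ^+ 2)%:E.
have F0 k x : (0 <= F k x)%E by rewrite lee_fin mulr_ge0 ?sqr_ge0.
have mu_ n : measurable_fun setT (u_ n) by case: (su n).
have mF k : measurable_fun setT (F k).
  apply/measurable_EFinP; apply: measurable_funM => //.
  by apply: measurable_funX; apply: measurable_funB.
have iF k : (\int[mu]_x F k x <= (1 / 2 ^+ k)%:E)%E.
  rewrite /F integralZ_EFin//; last 2 first.
  - by apply: measurable_funX; apply: measurable_funB.
  - by move=> x; exact: sqr_ge0.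
  rewrite -(EFin_ip (sqintB (su _) (su _))) -EFinM lee_fin mul1r.
  apply: (@le_trans _ _ (2 ^+ k * (4 ^+ k)^-1)).
    by rewrite ler_wpM2l// HN.
  have -> : (4 : R) = 2 * 2 by rewrite -natrM.
  by rewrite exprMn invfM mulrA divff ?mul1r// expf_neq0.
have iS : (\int[mu]_x (\sum_(0 <= k <oo) F k x) < +oo)%E.
  rewrite integral_nneseries//.
  apply: (@le_lt_trans _ _ (\sum_(0 <= k <oo) (1 / 2 ^+ k)%:E)%E).
    by apply: lee_nneseries => [k *|k *]; [apply: integral_ge0 => x _|].
  have := @cvg_geometric_eseries_half R 2 0%N.
  rewrite (_ : eseries _ = eseries (fun k => (1 / 2 ^+ k)%:E)).
    by move=> /cvg_lim -> //; rewrite ltry.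
  congr eseries; apply/funext => k; congr EFin.
  by rewrite addn1 natrX exprS invfM mulrA divff.
have mS : measurable_fun setT (fun x => \sum_(0 <= k <oo) F k x)%E.
  by apply: ge0_emeasurable_sum => // k x _; exact: F0.
have S0 x : (0 <= \sum_(0 <= k <oo) F k x)%E by apply: nneseries_ge0 => k _ _; exact: F0.
have iS' : mu.-integrable setT (fun x => \sum_(0 <= k <oo) F k x)%E.
  apply/integrableP; split => //.
  by under eq_integral do rewrite gee0_abs ?S0//.
have cv : {ae mu, forall x, cvgn (fun k => u_ (s k) x)}.
  apply: filterS (integrable_ae measurableT iS') => x /(_ I) hx.
  apply: (@cvgn_of_weighted_sqr _ (fine (\sum_(0 <= k <oo) F k x))%E) => n.
  rewrite -lee_fin fineK// -sumEFin.
  by apply: nneseries_lim_ge => k _ _; exact: F0.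
pose u x := fine (limn_esup (fun k => (u_ (s k) x)%:E)).
have mu' : measurable_fun setT u.
  apply: (measurableT_comp (fine_measurable measurableT)).
  by apply: measurable_fun_limn_esup => k; exact/measurable_EFinP.
have cvu : {ae mu, forall x, u_ (s k) x @[k --> \oo] --> u x}.
  apply: filterS cv => x /cvg_ex[l hl].
  by rewrite /u (cvg_limn_einf_sup (cvgn_EFin hl)).2/=.
have lim e : 0 < e -> exists N, forall n, (N <= n)%N ->
    (\int[mu]_x ((u_ n x - u x) ^+ 2)%:E <= e%:E)%E.
  move=> e0; have [M HM] := cauchy _ e0; exists M => n Mn.
  apply: (@fatou_ae (fun k x => (u_ n x - u_ (s (M + k)%N) x) ^+ 2) _ (fun=> e)).
  - by move=> k; apply: measurable_funX; apply: measurable_funB.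
  - by apply: measurable_funX; apply: measurable_funB.
  - by move=> k x; exact: sqr_ge0.
  - by move=> x; exact: sqr_ge0.
  - apply: filterS cvu => x hx.
    have hx' : u_ (s (M + k)%N) x @[k --> \oo] --> u x.
      have := hx; rewrite -(cvg_shiftn M).
      by under eq_fun do rewrite addnC.
    rewrite expr2; under eq_fun do rewrite expr2.
    by apply: cvgM; apply: cvgB => //; exact: cvg_cst.
  - move=> k; rewrite -(EFin_ip (sqintB (su _) (su _))) lee_fin HM//.
    by rewrite (leq_trans _ (sk _))// leq_addr.
  - exact: cvg_cst.
have sB n e : (\int[mu]_x ((u_ n x - u x) ^+ 2)%:E <= e%:E)%E -> sqint mu (u_ n \- u).
  move=> h; split; first exact: measurable_funB.
  by apply: le_lt_trans h _; rewrite ltry.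
have squ : sqint mu u.
  have [M /(_ M (leqnn _)) /sB h] := lim 1 ltr01.
  have -> : u = u_ M \- (u_ M \- u) by apply/funext => x /=; rewrite opprB addrC subrK.
  exact: sqintB.
exists u; split => //; last by exists s.
move=> e e0; have [M HM] := lim e e0; exists M => n /HM h.
by rewrite -lee_fin (EFin_ip (sqintB (su _) squ)).
Qed.

End Completeness.

Section Riesz.
Context (d : measure_display) (T : measurableType d) (R : realType).
Variable mu : {measure set T -> \bar R}.
Implicit Types (u v w : T -> R).

Lemma le0_sqr_eps (x K : R) : 0 <= K -> (forall e, 0 < e -> x ^+ 2 <= e * K) -> x = 0.
Proof.
move=> K0 h; apply/eqP; rewrite -sqrf_eq0 eq_le sqr_ge0 andbT.
apply/ler_addgt0Pr => e e0; rewrite add0r.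
have K1 : 0 < K + 1 by rewrite ltr_wpDl.
apply: le_trans (h (e / (K + 1)) _) _; first by rewrite divr_gt0.
by rewrite -mulrA ler_piMr ?(ltW e0)// ler_pdivrMl// mulr1 lerDl.
Qed.

(** Minimise J(u) = |u|^2 - 2 l(u) over the subspace D, which
need not be closed.  The parallelogram identity makes a minimising sequence Cauchy, and
its limit g, which lies in the closure of D, represents l on D. *)
Theorem riesz_on_subspace (D : set (T -> R)) (l : (T -> R) -> R) (C : R) :
  (forall u, D u -> sqint mu u) -> D (cst 0) ->
  (forall a u v, D u -> D v -> D (u \+ (a \*o v))) ->
  (forall a u v, D u -> D v -> l (u \+ (a \*o v)) = l u + a * l v) ->
  0 <= C -> (forall u, D u -> l u ^+ 2 <= C * ip mu u u) ->
  exists g, [/\ sqint mu g, forall u, D u -> ip mu g u = l u & ip mu g g <= C].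
Proof.
move=> Dsq D0 Dlin llin C0 lC.
pose J u := ip mu u u - 2 * l u.
have JC u : D u -> - C <= J u.
  move=> Du; have := lC u Du; have := ip_ge0 mu u; rewrite /J.
  set s := ip mu u u; set x := l u => s0 hx.
  (* |l u| <= sqrt (s C) <= (s + C) / 2. *)
  have : (2 * x) ^+ 2 <= (s + C) ^+ 2.
    have := sqr_ge0 (s - C); nra.
  rewrite -ler_sqrt ?sqr_ge0// !sqrtr_sqr => h; have := le_trans (ler_norm _) h.
  by rewrite ger0_norm ?addr_ge0//; lra.
pose E := [set J u | u in D].
have hE : has_inf E.
  by split; [exists (J (cst 0)), (cst 0)|exists (- C) => _ [u Du <-]; exact: JC].
have JI u : D u -> inf E <= J u.
  by move=> Du; apply: (inf_lbound hE.2); exists u.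
have /choice[u_ Hu] : forall n : nat, exists u, D u /\ J u < inf E + n.+1%:R^-1.
  move=> n; have n0 : 0 < n.+1%:R^-1 :> R by rewrite invr_gt0.
  by have [_ [u Du <-] hu] := inf_adherent n0 hE; exists u.
have Du_ n := (Hu n).1; have Ju_ n := (Hu n).2.
have su n := Dsq _ (Du_ n).
have par u v a b : D u -> D v -> J u < inf E + a -> J v < inf E + b ->
    ip mu (u \- v) (u \- v) <= 2 * (a + b).
  move=> Du Dv Ja Jb; have squ := Dsq _ Du; have sqv := Dsq _ Dv.
  pose w := (cst 0 \+ (2^-1 \*o u)) \+ (2^-1 \*o v).
  have Dh : D (cst 0 \+ (2^-1 \*o u)) by exact: Dlin.
  have Dw : D w by exact: Dlin.
  have l0 : l (cst 0) = 0.
    have := llin 1 _ _ D0 D0; rewrite mul1r.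
    have -> : cst 0 \+ (1 \*o cst 0) = cst 0 :> (T -> R).
      by apply/funext => x /=; rewrite mul1r addr0.
    lra.
  have lw : l w = 2^-1 * l u + 2^-1 * l v by rewrite llin// llin// l0 add0r.
  have ew : w = 2^-1 \*o (u \+ v).
    by apply/funext => x; rewrite /w /= add0r mulrDr.
  have suv := sqintD squ sqv.
  have iw : ip mu w w = 4^-1 * ip mu (u \+ v) (u \+ v).
    rewrite ew ipZl// ?ipZr//; last exact: sqintZ.
    by rewrite mulrA; congr (_ * _); field.
  have := JI _ Dw; rewrite /J iw lw ipDD// ipBB//.
  move: Ja Jb; rewrite /J; lra.
have small (e : R) : 0 < e -> exists N, forall n, (N <= n)%N -> n.+1%:R^-1 <= e.
  move=> e0; have [N _ hN] := near_infty_natSinv_lt (PosNum e0).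
  by exists N => n /hN /ltW.
have cauchy e : 0 < e -> exists N, forall n m, (N <= n)%N -> (N <= m)%N ->
    ip mu (u_ n \- u_ m) (u_ n \- u_ m) <= e.
  move=> e0; have e4 : 0 < e / 4 by rewrite divr_gt0.
  have [N HN] := small _ e4; exists N => n m /HN hn /HN hm.
  apply: le_trans (par _ _ _ _ (Du_ n) (Du_ m) (Ju_ n) (Ju_ m)) _.
  have -> : e = 2 * (e / 4 + e / 4) by field.
  by rewrite ler_pM2l// lerD.
have [g [sg gl _]] := sqint_complete su cauchy.
have gE v : D v -> ip mu g v = l v.
  move=> Dv; have sv := Dsq _ Dv; apply/eqP; rewrite -subr_eq0; apply/eqP.
  apply: (@le0_sqr_eps _ (4 * ip mu v v)); first by rewrite mulr_ge0// ip_ge0.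
  move=> e e0; have [N1 h1] := small _ e0; have [N2 h2] := gl _ e0.
  pose n := maxn N1 N2.
  have hn1 := h1 n (leq_maxl _ _); have hn2 := h2 n (leq_maxr _ _).
  (* J(u_n + t v) >= inf J > J(u_n) - 1/(n+1) for all t: a quadratic in t. *)
  have A1 : (ip mu (u_ n) v - l v) ^+ 2 <= n.+1%:R^-1 * ip mu v v.
    apply: quadratic_ge0_le; first by rewrite invr_ge0.
    move=> t; have := JI _ (Dlin t _ _ (Du_ n) Dv); rewrite /J llin//.
    rewrite ipDD//; last exact: sqintZ.
    rewrite !ipZr// ?ipZl//; last exact: sqintZ.
    by move: (Ju_ n); rewrite /J; set s := n.+1%:R^-1; lra.
  have A2 := cauchy_schwarz (sqintB (su n) sg) sv.
  rewrite ipBl// in A2.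
  have v0 := ip_ge0 mu v.
  have B1 : (ip mu (u_ n) v - l v) ^+ 2 <= e * ip mu v v.
    by apply: le_trans A1 _; rewrite ler_wpM2r.
  have B2 : (ip mu (u_ n) v - ip mu g v) ^+ 2 <= e * ip mu v v.
    by apply: le_trans A2 _; rewrite ler_wpM2r.
  move: B1 B2; set a := ip mu (u_ n) v; set b := ip mu g v; set c := l v.
  have := sqr_ge0 (a - c + (a - b)).
  have -> : b - c = (a - c) - (a - b) by ring.
  lra.
exists g; split => //; apply/ler_addgt0Pr => e /gl[N /(_ N (leqnn _))].
rewrite ipBB// (ipC _ (u_ N)) gE// => h.
have := JC _ (Du_ N); rewrite /J; move: h; lra.
Qed.

End Riesz.

(** * Boxes, translation invariance and functions with null integral on boxes *)

Section Boxes.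
Context (R : realType) (d : nat).
Implicit Types (a b v x : 'rV[R]_d).
Local Notation leb := (lebesgue_rV R d).

(** Half-open boxes: they are stable under intersection and cover the space, and
their Lebesgue measure is the product of their side lengths. *)
Definition box a b : set 'rV[R]_d :=
  [set x | forall i, a ord0 i < x ord0 i <= b ord0 i].

Definition boxes : set (set 'rV[R]_d) := [set A | exists a b, A = box a b].

Definition cube (n : nat) : set 'rV[R]_d := box (const_mx (- n%:R)) (const_mx n%:R).

Lemma box_bigcap a b : box a b = \bigcap_(i in [set: 'I_d])
    (fun y : 'rV[R]_d => y ord0 i) @^-1` `]a ord0 i, b ord0 i]%classic.
Proof.
apply/seteqP; split => [y By i _|y By i] /=; rewrite ?in_itv; first exact: By.
by have := By i I; rewrite /= in_itv.
Qed.

Lemma measurable_box a b : measurable (box a b).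
Proof.
rewrite box_bigcap; apply: fin_bigcap_measurable => // i _.
by rewrite -[X in measurable X]setTI; exact: measurable_mx_coord.
Qed.

Lemma box_setI a b a' b' : box a b `&` box a' b' =
  box (\row_i Num.max (a ord0 i) (a' ord0 i)) (\row_i Num.min (b ord0 i) (b' ord0 i)).
Proof.
apply/seteqP; split => x.
  move=> [h1 h2] i; rewrite !mxE gt_max le_min.
  by have /andP[-> ->] := h1 i; have /andP[-> ->] := h2 i.
by move=> h; split => i; have := h i; rewrite !mxE gt_max le_min;
  move=> /andP[/andP[h1 h2] /andP[h3 h4]]; rewrite ?h1 ?h2 ?h3 ?h4.
Qed.

Lemma boxes_setI : setI_closed boxes.
Proof.
by move=> _ _ [a [b ->]] [a' [b' ->]]; rewrite box_setI; do 2 eexists.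
Qed.

Lemma ler_nat_norm_bound x : exists n : nat, forall i, `|x ord0 i| < n%:R.
Proof.
exists (\sum_(i < d) Num.bound (x ord0 i))%N => i.
apply: (lt_le_trans (archi_boundP (normr_ge0 _))).
by rewrite (bigD1 i)//= /Num.bound normr_id natrD lerDl.
Qed.

Lemma cube_cover : \bigcup_n cube n = setT.
Proof.
apply/seteqP; split => // x _; have [n hn] := ler_nat_norm_bound x.
exists n => // i; rewrite !mxE; have := hn i.
by rewrite ltr_norml => /andP[-> /ltW ->].
Qed.

Lemma measurable_boxes : @measurable _ 'rV[R]_d = <<s boxes>>.
Proof.
apply/seteqP; split; last first.
  apply: smallest_sub; first exact: sigma_algebra_measurable.
  by move=> _ [a [b ->]]; exact: measurable_box.
apply: smallest_sub; first exact: smallest_sigma_algebra.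
move=> _ [i [j [B mB ->]]].
have : measurable_fun setT
    ((fun M => M i j) : g_sigma_algebraType boxes -> R).
  apply: (@measurability _ _ _ _ _ _ (@RGenOInfty.G R)).
    exact: RGenOInfty.measurableE.
  move=> _ [_ [x ->] <-]; rewrite setTI.
  have -> : (fun M : 'rV[R]_d => M i j) @^-1` `]x, +oo[ =
    \bigcup_n box (\row_k (if k == j then x else - n%:R)) (const_mx n%:R).
    apply/seteqP; split => [y /= | y [n _ hy] /=].
      rewrite in_itv/= andbT (ord1 i) => xy.
      have [n hn] := ler_nat_norm_bound y; exists n => // k; rewrite !mxE.
      have := hn k; rewrite ltr_norml => /andP[h1 /ltW ->].
      by case: eqP => [->|_]; rewrite ?xy ?h1.
    by have := hy j; rewrite !mxE eqxx in_itv/= andbT (ord1 i) => /andP[].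
  apply: bigcupT_measurable => n; apply: sub_sigma_algebra.
  by do 2 eexists.
by move=> /(_ measurableT B mB); rewrite setTI.
Qed.

(** Boxes form a generating pi-system exhausted by the cubes. *)
Lemma measure_eq_on_boxes (m1 m2 : {measure set 'rV[R]_d -> \bar R}) :
  (forall a b, m1 (box a b) = m2 (box a b)) -> (forall n, (m1 (cube n) < +oo)%E) ->
  forall A, measurable A -> m1 A = m2 A.
Proof.
move=> m12 m1oo A mA; apply: (measure_unique boxes cube) => //.
- exact: measurable_boxes.
- exact: boxes_setI.
- by move=> n; do 2 eexists.
- exact: cube_cover.
- by move=> _ [a [b ->]].
Qed.

(** The sigma-algebra on row vectors is generated by the coordinates, so openness
in the norm topology has to be related to it: an open set is a countable union
of boxes with rational corners. *)
Lemma open_rV_measurable (U : set 'rV[R]_d) : open U -> measurable U.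
Proof.
move=> oU.
pose I := ('rV[rat]_d * 'rV[rat]_d)%type.
pose rbox (q : I) := box (map_mx ratr q.1) (map_mx ratr q.2).
have -> : U = \bigcup_(q in [set q : I | rbox q `<=` U]) rbox q.
  apply/seteqP; split => [x Ux|x [q /= qU]]; last exact: qU.
  have /nbhs_ballP[e /= e0 xeU] : nbhs x U by move: oU; rewrite openE; exact.
  have /choice[q1 h1] : forall i, exists q : rat, x ord0 i - e < ratr q < x ord0 i.
    move=> i; have [|q] := @rat_in_itvoo R (x ord0 i - e) (x ord0 i).
      by rewrite ltrBlDr ltrDl.
    by rewrite in_itv => /= h; exists q.
  have /choice[q2 h2] : forall i, exists q : rat, x ord0 i < ratr q < x ord0 i + e.
    move=> i; have [|q] := @rat_in_itvoo R (x ord0 i) (x ord0 i + e).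
      by rewrite ltrDl.
    by rewrite in_itv => /= h; exists q.
  exists (\row_i q1 i, \row_i q2 i).
    move=> y hy; apply: xeU; split => // i j; rewrite (ord1 i).
    have := hy j; rewrite !mxE /ball /= => /andP[l1 l2].
    have /andP[l3 l4] := h1 j; have /andP[l5 l6] := h2 j.
    by rewrite ltr_distlC; apply/andP; split; lra.
  move=> i; rewrite !mxE; have /andP[_ ->] := h1 i.
  by have /andP[/ltW -> _] := h2 i.
rewrite bigcup_mkcond; apply: countable_bigcupT_measurable => [|q]; first exact: countableP.
by case: ifP => // _; exact: measurable_box.
Qed.

Lemma continuous_rV_measurable (f : 'rV[R]_d -> R) : continuous f -> measurable_fun setT f.
Proof.
move=> cf; apply: (@measurability _ _ _ _ _ _ (@RGenOpens.G R)).
  exact: RGenOpens.measurableE.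
move=> _ [_ [x [y ->]] <-]; rewrite setTI.
by apply: open_rV_measurable; apply: open_comp => // t _; exact: cf.
Qed.

End Boxes.

Section Translation.
Context (R : realType) (d : nat).
Implicit Types (a b v x : 'rV[R]_d).
Local Notation leb := (lebesgue_rV R d).

Definition translate v x : 'rV[R]_d := x + v.

Lemma measurable_translate v : measurable_fun setT (translate v).
Proof.
apply: measurable_fun_mx => i j; rewrite /translate.
under eq_fun do rewrite mxE.
by apply: measurable_funD => //; exact: measurable_mx_coord.
Qed.

HB.instance Definition _ v :=
  isMeasurableFun.Build _ _ _ _ (translate v) (measurable_translate v).

Lemma lebesgue_box_empty a b : ~ (forall i, a ord0 i <= b ord0 i) -> box a b = set0.
Proof.
move=> nab; apply/seteqP; split => // x hx; apply: nab => i.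
by have /andP[h1 h2] := hx i; rewrite (le_trans (ltW h1)).
Qed.

Lemma lebesgue_box_lty a b : (leb (box a b) < +oo)%E.
Proof.
have [ab|nab] := pselect (forall i, a ord0 i <= b ord0 i).
  by rewrite /box lebesgue_rV_box// ltry.
by rewrite lebesgue_box_empty// measure0.
Qed.

Lemma translate_box v a b : translate v @^-1` box a b = box (a - v) (b - v).
Proof.
apply/seteqP; split => x h i; have := h i; rewrite /translate !mxE.
  by rewrite ltrBlDr lerBrDr.
by rewrite ltrBlDr lerBrDr.
Qed.

(** Both sides are measures in A that agree on boxes. *)
Lemma lebesgue_translate v A : measurable A -> leb (translate v @^-1` A) = leb A.
Proof.
move=> mA.
apply: (@measure_eq_on_boxes R d [the measure _ _ of pushforward leb (translate v)] leb) => //.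
  move=> a b; rewrite /= /pushforward translate_box.
  have [ab|nab] := pselect (forall i, a ord0 i <= b ord0 i); last first.
    rewrite !lebesgue_box_empty// => h; apply: nab => i.
    by have := h i; rewrite !mxE lerD2r.
  rewrite /box !lebesgue_rV_box//; last by move=> i; rewrite !mxE lerD2r.
  by congr EFin; apply: eq_bigr => i _; rewrite !mxE; ring.
move=> n; rewrite /= /pushforward translate_box.
exact: lebesgue_box_lty.
Qed.

Lemma ge0_integral_translate v (f : 'rV[R]_d -> \bar R) :
  measurable_fun setT f -> (forall x, 0 <= f x)%E ->
  (\int[leb]_x f (x + v)%R = \int[leb]_x f x)%E.
Proof.
move=> mf f0.
rewrite -[RHS](eq_measure_integral leb (m1 := pushforward leb (translate v))).
  by rewrite ge0_integral_pushforward//; exact: measurable_translate.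
by move=> A mA _; exact: lebesgue_translate.
Qed.

Lemma integral_translate v (f : 'rV[R]_d -> \bar R) : measurable_fun setT f ->
  (\int[leb]_x f (x + v)%R = \int[leb]_x f x)%E.
Proof.
move=> mf; rewrite integralE [RHS]integralE.
have hp := ge0_integral_translate v (measurable_funepos mf) (funepos_ge0 f).
have hn := ge0_integral_translate v (measurable_funeneg mf) (funeneg_ge0 f).
rewrite -hp -hn; congr (_ - _)%E; apply: eq_integral => x _.
  by rewrite !funeposE.
by rewrite !funenegE.
Qed.

Lemma Rintegral_translate v (f : 'rV[R]_d -> R) : measurable_fun setT f ->
  \int[leb]_x f (x + v) = \int[leb]_x f x.
Proof.
move=> mf; congr fine; apply: (@integral_translate v (EFin \o f)).
exact/measurable_EFinP.
Qed.

Lemma measurable_fun_translate v (u : 'rV[R]_d -> R) :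
  measurable_fun setT u -> measurable_fun setT (fun x => u (x + v)).
Proof. by move=> mu; exact: (measurableT_comp mu (measurable_translate v)). Qed.

Lemma sqint_translate v (u : 'rV[R]_d -> R) :
  sqint leb u -> sqint leb (fun x => u (x + v)).
Proof.
move=> [mu iu]; split; first exact: measurable_fun_translate.
rewrite (@integral_translate v (fun x => (u x ^+ 2)%:E))//.
by apply/measurable_EFinP; exact: measurable_funX.
Qed.

Lemma ip_translate v (u w : 'rV[R]_d -> R) :
  measurable_fun setT u -> measurable_fun setT w ->
  ip leb (fun x => u (x + v)) (fun x => w (x + v)) = ip leb u w.
Proof.
move=> mu mw; rewrite /ip (@Rintegral_translate v (fun x => u x * w x))//.
exact: measurable_funM.
Qed.

End Translation.

Section Density.
Context (d : measure_display) (T : measurableType d) (R : realType).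
Variable mu : {measure set T -> \bar R}.

(** The measure with density f.  The proofs that f is measurable and nonnegative
are arguments so that the measure structure can be inferred. *)
Definition density (f : T -> \bar R) (mf : measurable_fun setT f)
    (f0 : forall x, (0 <= f x)%E) (A : set T) : \bar R := (\int[mu]_(x in A) f x)%E.

Variables (f : T -> \bar R) (mf : measurable_fun setT f) (f0 : forall x, (0 <= f x)%E).

Let density0 : density mf f0 set0 = 0%E.
Proof. exact: integral_set0. Qed.

Let density_ge0 A : (0 <= density mf f0 A)%E.
Proof. by apply: integral_ge0 => x _. Qed.

Let density_sigma_additive : semi_sigma_additive (density mf f0).
Proof. exact: semi_sigma_additive_nng_induced. Qed.

HB.instance Definition _ := isMeasure.Build _ _ _ (density mf f0)
  density0 density_ge0 density_sigma_additive.

End Density.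

Section BoxesDetermine.
Context (R : realType) (d : nat).
Local Notation leb := (lebesgue_rV R d).

(** The positive and the negative part of f are densities of two measures that
agree on boxes, hence on all measurable sets. *)
Lemma integrable_box_integral_eq0 (f : 'rV[R]_d -> \bar R) :
  leb.-integrable setT f ->
  (forall a b, (\int[leb]_(x in box a b) f x = 0)%E) ->
  {ae leb, forall x, f x = 0%E}.
Proof.
move=> fi hf; have mf := measurable_int _ fi.
have fip := integrable_funepos measurableT fi.
have fin := integrable_funeneg measurableT fi.
have eqm A : measurable A ->
    (\int[leb]_(x in A) f^\+ x = \int[leb]_(x in A) f^\- x)%E.
  move=> mA.
  apply: (@measure_eq_on_boxes R d
    (density leb (measurable_funepos mf) (funepos_ge0 f))
    (density leb (measurable_funeneg mf) (funeneg_ge0 f))) => //.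
    move=> a b; have mab := measurable_box a b.
    have := hf a b; rewrite integralE => /eqP; rewrite sube_eq ?add0e.
    - by move=> /eqP.
    - by apply: integrable_fin_num => //; exact: integrableS fip.
    - rewrite fin_num_adde_defl//.
      by apply: integrable_fin_num => //; exact: integrableS fin.
  move=> n; rewrite /= /density.
  have : (\int[leb]_(x in cube n) f^\+ x)%E \is a fin_num.
    apply: integrable_fin_num; first exact: measurable_box.
    by apply: integrableS fip => //; exact: measurable_box.
  by rewrite ge0_fin_numE// integral_ge0.
have : ae_eq leb setT f (cst 0%E).
  apply: integral_ae_eq => // E _ mE.
  rewrite integralE eqm// subee; first by rewrite integral0.
  by apply: integrable_fin_num => //; exact: integrableS fin.
by apply: filterS => x /(_ I).
Qed.

Lemma sqint_integrable_box (f : 'rV[R]_d -> R) a b :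
  sqint leb f -> leb.-integrable (box a b) (EFin \o f).
Proof.
move=> sf; have mab := measurable_box a b.
have h : leb.-integrable (box a b) (fun x => ((f x ^+ 2)%:E + 1%:E)%E).
  apply: integrableD => //.
    by apply: integrableS (sqint_sqr_int sf).
  apply/integrableP; split => //.
  under eq_integral do rewrite abse_EFin normr1.
  rewrite integral_cst// mul1e.
  exact: lebesgue_box_lty.
apply: le_integrable h => //.
  by apply/measurable_EFinP; apply: measurable_funTS; case: sf.
move=> x _ /=; rewrite lee_fin [leRHS]ger0_norm ?addr_ge0 ?sqr_ge0//.
have := norm_mul_le_sqr (f x) 1; rewrite mulr1 expr1n; lra.
Qed.

Theorem sqint_box_integral_eq0 (f : 'rV[R]_d -> R) : sqint leb f ->
  (forall a b, (\int[leb]_(x in box a b) (f x)%:E = 0)%E) ->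
  {ae leb, forall x, f x = 0}.
Proof.
move=> sf hf.
have H n : {ae leb, forall x, cube n x -> f x = 0}.
  have mC : measurable (@cube R d n) by exact: measurable_box.
  have : {ae leb, forall x, ((EFin \o f) \_ (cube n)) x = 0%E}.
    apply: integrable_box_integral_eq0.
      by apply: (integrable_mkcond _ mC).1; exact: sqint_integrable_box.
    move=> a b; rewrite -integral_mkcondr /cube box_setI; exact: hf.
  by apply: filterS => x; rewrite patchE => + cx; rewrite mem_set// => -[].
have := ae_foralln H.
apply: filterS => x hx; have : (\bigcup_n @cube R d n) x by rewrite cube_cover.
by move=> [n _ /hx].
Qed.

End BoxesDetermine.

(** * Test functions *)

Section FlatExponential.
Context (R : realType).

(** The function t^-k exp(-1/t) for t > 0, extended by 0.  The index k makes the
family closed under differentiation up to linear combinations, see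
[is_derive_flat_exp]; this replaces a discussion of higher derivatives. *)
Definition flat_exp (k : nat) (t : R) : R :=
  if 0 < t then t^-1 ^+ k * expR (- t^-1) else 0.

Lemma flat_exp_ge0 k t : 0 <= flat_exp k t.
Proof.
rewrite /flat_exp; case: ifPn => // t0.
by rewrite mulr_ge0 ?expR_ge0// exprn_ge0// invr_ge0 ltW.
Qed.

(** With y = 1/t and m = k + 2, exp y = exp (y/m)^m >= (y/m)^m.  A quadratic bound
is all that differentiability at 0 requires. *)
Lemma flat_exp_le_sqr k t : flat_exp k t <= k.+2%:R ^+ k.+2 * t ^+ 2.
Proof.
rewrite /flat_exp; case: ifPn => [t0|_]; last first.
  by rewrite mulr_ge0 ?sqr_ge0// exprn_ge0.
set y := t^-1; have y0 : 0 < y by rewrite invr_gt0.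
have n0 : 0 < k.+2%:R :> R by rewrite ltr0n.
have h : (y / k.+2%:R) ^+ k.+2 <= expR y.
  have -> : expR y = expR (y / k.+2%:R) ^+ k.+2.
    by rewrite -expRM_natl mulrCA divff ?mulr1// gt_eqF.
  apply: lerXn2r; rewrite ?nnegrE ?expR_ge0 ?divr_ge0 ?ltW//.
  by apply: lt_le_trans (expR_ge1Dx _); rewrite ltrDr.
have -> : t = y^-1 by rewrite /y invrK.
rewrite expRN ler_pdivrMr ?expR_gt0//.
have -> : y ^+ k = k.+2%:R ^+ k.+2 * y^-1 ^+ 2 * (y / k.+2%:R) ^+ k.+2.
  have N0 : (k.+2%:R : R) ^+ k.+2 != 0 by rewrite expf_neq0// gt_eqF.
  have Y0 : y ^+ 2 != 0 by rewrite expf_neq0// gt_eqF.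
  rewrite expr_div_n -[in y ^+ k.+2](addn2 k) exprD exprVn.
  by field; rewrite N0 gt_eqF.
by rewrite ler_wpM2l// mulr_ge0 ?sqr_ge0// exprn_ge0.
Qed.

Lemma is_derive_sqr_bound (f : R -> R) (C : R) :
  (forall t, `|f t| <= C * t ^+ 2) -> is_derive (0 : R) 1 f 0.
Proof.
move=> h.
have f0 : f 0 = 0.
  by apply/eqP; rewrite -normr_le0 (le_trans (h 0))// expr0n mulr0.
have C0 : 0 <= C by have := h 1; rewrite expr1n mulr1; exact: le_trans.
have C1 : 0 < C + 1 by rewrite ltr_wpDl.
have cv : (fun t => t^-1 *: ((f \o shift 0) (t *: (1 : R)) - f 0)) @ 0^' --> (0 : R).
  apply/cvgr0Pnorm_le => e e0; near=> t.
  have t0 : t != 0 by near: t; exact: nbhs_dnbhs_neq.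
  rewrite /= f0 subr0 addr0 [_ *: 1]mulr1 normrM normfV ler_pdivrMl ?normr_gt0//.
  apply: (le_trans (h t)); rewrite -[t ^+ 2]real_normK ?num_real// expr2 mulrCA.
  rewrite ler_wpM2l//.
  apply: (@le_trans _ _ ((C + 1) * `|t|)); first by rewrite ler_wpM2r// lerDl.
  rewrite -ler_pdivlMl//; near: t; apply: dnbhs0_le.
  by rewrite mulr_gt0 ?invr_gt0.
by split; [apply/cvg_ex; exists 0|exact/cvg_lim/cv].
Unshelve. all: by end_near. Qed.

Lemma is_derive_flat_exp k (t : R) :
  is_derive t 1 (flat_exp k) (flat_exp k.+2 t - k%:R * flat_exp k.+1 t).
Proof.
have [t0|t0|->] := ltrgtP t 0.
- have -> : flat_exp k.+2 t - k%:R * flat_exp k.+1 t = 0.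
    by rewrite /flat_exp !ltNge (ltW t0)/= mulr0 subr0.
  apply: (@near_eq_is_derive _ _ _ (cst 0)) => //.
  near=> s; rewrite /flat_exp ltNge; case: negP => //= sn.
  exfalso; apply: sn; apply: ltW; near: s; exact: lt_nbhsl.
- have tn0 : t != 0 by rewrite gt_eqF.
  apply: (@near_eq_is_derive _ _ _ (fun s : R => s^-1 ^+ k * expR (- s^-1))).
    near=> s; rewrite /flat_exp ifT//; near: s; exact: lt_nbhsr.
  have dV : is_derive t 1 (fun s : R => s^-1) (- t ^- 2 *: (1 : R)).
    exact: (@is_deriveV R id t 1 1 tn0 (is_derive_id _ _)).
  have dN : is_derive t 1 (fun s : R => - s^-1) (- (- t ^- 2 *: (1 : R))).
    exact: is_deriveN.
  have dE := @is_derive1_comp R expR (fun s : R => - s^-1) t _ _ (is_derive_expR (- t^-1)) dN.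
  have dX := is_deriveX k dV.
  have dM := is_deriveM dX dE.
  have E : (fun s : R => s^-1 ^+ k * expR (- s^-1)) =
      (fun s : R => s^-1) ^+ k * (expR \o (fun s : R => - s^-1)).
    by apply/funext => s; rewrite !fctE.
  rewrite E; apply: (is_derive_eq dM).
  rewrite exprfctE /flat_exp t0 /= /GRing.scale /= !mulr1 expr2 invfM.
  case: k dX dM E => [|k] _ _ _.
    by rewrite !exprS !expr0; ring.
  rewrite /= !exprS; ring.
- have -> : flat_exp k.+2 0 - k%:R * flat_exp k.+1 0 = 0.
    by rewrite /flat_exp ltxx mulr0 subr0.
  apply: (@is_derive_sqr_bound _ (k.+2%:R ^+ k.+2)) => s.
  by rewrite ger0_norm ?flat_exp_ge0// flat_exp_le_sqr.
Unshelve. all: by end_near. Qed.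

End FlatExponential.

Section TestFunctions.
Context (R : realType) (d : nat).
Implicit Types (f g eta : 'rV[R]_d -> R) (x v : 'rV[R]_d).
Local Notation leb := (lebesgue_rV R d).

(** Differentiating along a line reduces to one variable. *)
Lemma is_derive_line f x v (df : R) :
  is_derive (0 : R) (1 : R) (fun h : R => f (h *: v + x)) df -> is_derive x v f df.
Proof.
move=> [h1 h2]; split; first exact/derivable1P.
rewrite -h2 /derive.
suff -> : (fun h => h^-1 *: ((f \o shift x) (h *: v) - f x)) =
  (fun h : R => h^-1 *: (((fun h : R => f (h *: v + x)) \o shift 0) (h *: (1 : R)) -
           (fun h : R => f (h *: v + x)) 0)) by [].
by rewrite funeqE => h /=; rewrite addr0 scale0r add0r [_%:A]mulr1.
Qed.

(** An algebra of functions that contains the bumps below and is closed under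
partial derivatives; its elements are differentiable, hence so are all their
iterated partial derivatives. *)
Inductive bump_algebra : ('rV[R]_d -> R) -> Prop :=
| bump_flat k a b j : bump_algebra (fun x => flat_exp k (a * x ord0 j + b))
| bump_cst c : bump_algebra (cst c)
| bump_add f g : bump_algebra f -> bump_algebra g -> bump_algebra (f + g)
| bump_mul f g : bump_algebra f -> bump_algebra g -> bump_algebra (f * g).

Lemma bump_algebra_differentiable f : bump_algebra f -> forall x, differentiable f x.
Proof.
elim=> [k a b j|c|f1 g1 _ IHf _ IHg|f1 g1 _ IHf _ IHg] x.
- apply: (@differentiable_comp _ _ _ _ (fun x => a * x ord0 j + b) (flat_exp k)).
    apply: differentiableD => //.
    by apply: differentiableZ; exact: differentiable_coord.
  apply/derivable1_diffP; apply: ex_derive; exact: is_derive_flat_exp.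
- exact: differentiable_cst.
- exact: differentiableD.
- exact: differentiableM.
Qed.

Lemma bump_algebra_partial i f : bump_algebra f -> bump_algebra (partial i f).
Proof.
elim=> [k a b j|c|f1 g1 bf IHf bg IHg|f1 g1 bf IHf bg IHg].
- pose c := a * (delta_mx ord0 i : 'rV[R]_d) ord0 j.
  have -> : partial i (fun x => flat_exp k (a * x ord0 j + b)) =
     (cst c) * ((fun x => flat_exp k.+2 (a * x ord0 j + b)) +
        cst (- k%:R) * (fun x => flat_exp k.+1 (a * x ord0 j + b))).
    apply/funext => x; rewrite /partial.
    apply: (@derive_val _ _ _ x (delta_mx ord0 i)).
    apply: is_derive_line.
    have dl : is_derive (0 : R) (1 : R)
        (fun h : R => a * (h *: (delta_mx ord0 i : 'rV[R]_d) + x) ord0 j + b) c.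
      have -> : (fun h : R => a * (h *: (delta_mx ord0 i : 'rV[R]_d) + x) ord0 j + b) =
          (c \*: id) + cst (a * x ord0 j + b).
        apply/funext => h; rewrite !fctE /c !mxE /= -[_ *: h]/(_ * h); ring.
      have := is_deriveD (is_deriveZ c (is_derive_id (0 : R) (1 : R)))
        (is_derive_cst (a * x ord0 j + b) (0 : R) (1 : R)).
      by rewrite addr0 -[c *: 1]/(c * 1) mulr1.
    have := is_derive1_comp (is_derive_flat_exp k _) dl.
    rewrite scale0r add0r => h; refine (@is_derive_eq _ _ _ _ _ _ _ _ h _).
    by rewrite !fctE; ring.
  do ! [apply: bump_mul|apply: bump_add|exact: bump_cst|exact: bump_flat].
- have -> : partial i (cst c) = cst 0 :> ('rV[R]_d -> R).
    by apply/funext => x; rewrite /partial derive_cst.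
  exact: bump_cst.
- have -> : partial i (f1 + g1) = partial i f1 + partial i g1.
    apply/funext => x; rewrite /partial deriveD//;
    by apply: diff_derivable; exact: bump_algebra_differentiable.
  exact: bump_add.
- have -> : partial i (f1 * g1) = f1 * partial i g1 + g1 * partial i f1.
    apply/funext => x; rewrite /partial deriveM//;
    by apply: diff_derivable; exact: bump_algebra_differentiable.
  by apply: bump_add; exact: bump_mul.
Qed.

Lemma bump_algebra_iter_partial s f : bump_algebra f -> bump_algebra (iter_partial s f).
Proof. by move=> bf; elim: s => //= i s IH; exact: bump_algebra_partial. Qed.

Lemma bump_algebra_prod (I : finType) (F : I -> 'rV[R]_d -> R) :
  (forall i, bump_algebra (F i)) -> bump_algebra (fun x => \prod_i F i x).
Proof.
move=> bF.
have -> : (fun x => \prod_i F i x) = \prod_i F i.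
  by apply/funext => x; rewrite fct_prodE.
by apply: big_ind => //; [exact: bump_cst|exact: bump_mul].
Qed.

Lemma coord_le_norm x i : `|x ord0 i| <= `|x|.
Proof.
rewrite [leRHS]/Num.norm /= mx_normrE.
exact: (le_bigmax _ (fun ij : 'I_1 * 'I_d => `|x ij.1 ij.2|) (ord0, i)).
Qed.

Lemma norm_le_coord x (M : R) : 0 <= M -> (forall i, `|x ord0 i| <= M) -> `|x| <= M.
Proof.
move=> M0 h; rewrite [leLHS]/Num.norm /= mx_normrE.
by apply/bigmax_leP; split => // -[i j] _ /=; rewrite (ord1 i).
Qed.

Lemma closed_norm_le (M : R) : closed [set x : 'rV[R]_d | `|x| <= M].
Proof.
apply: (@closed_comp _ _ (fun x : 'rV[R]_d => `|x|) [set t | t <= M]).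
  by move=> x _; exact: norm_continuous.
exact: closed_le.
Qed.

Lemma compact_support eta (M : R) :
  (forall x, eta x != 0 -> forall i, `|x ord0 i| <= M) ->
  compact (closure [set x | eta x != 0]).
Proof.
move=> h; apply: bounded_closed_compact; last exact: closed_closure.
have sub : closure [set x | eta x != 0] `<=` [set x : 'rV[R]_d | `|x| <= Num.max 0 M].
  rewrite [X in _ `<=` X](closure_id _).1; last exact: closed_norm_le.
  apply: closure_subset => x /= /h hx; apply: norm_le_coord; first by rewrite le_max lexx.
  by move=> i; rewrite le_max hx orbT.
exists (Num.max 0 M); split; first exact: num_real.
by move=> y My x /sub /= /le_trans; apply; exact: ltW.
Qed.

Lemma test_function_support eta : test_function eta ->
  exists M, forall x, eta x != 0 -> forall i, `|x ord0 i| <= M.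
Proof.
move=> [_ /compact_bounded [M [_ hM]]].
exists (M + 1) => x ex i; apply: le_trans (coord_le_norm _ _) _.
by apply: (hM (M + 1)); [rewrite ltrDl|exact: subset_closure].
Qed.

End TestFunctions.

Lemma norm_lt_bound (R : realType) (t : R) : `|t| < (Num.bound t)%:R.
Proof. by have := archi_boundP (normr_ge0 t); rewrite /Num.bound normr_id. Qed.

Section TestFunctionSpace.
Context (R : realType) (d : nat).
Implicit Types (f g eta u w : 'rV[R]_d -> R) (x v : 'rV[R]_d).
Local Notation leb := (lebesgue_rV R d).

Lemma iter_partialD s u w (a : R) :
  (forall s x, differentiable (iter_partial s u) x) ->
  (forall s x, differentiable (iter_partial s w) x) ->
  iter_partial s (u \+ (a \*o w)) = iter_partial s u \+ (a \*o iter_partial s w).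
Proof.
move=> du dw; elim: s => //= i s ->; apply/funext => x; rewrite /partial.
have h1 : derivable (iter_partial s u) x (delta_mx ord0 i) by exact: diff_derivable.
have h2 : derivable (iter_partial s w) x (delta_mx ord0 i) by exact: diff_derivable.
have -> : iter_partial s u \+ (a \*o iter_partial s w) =
   iter_partial s u + a *: iter_partial s w by [].
by rewrite deriveD ?deriveZ//; exact: derivableZ.
Qed.

Lemma iter_partial_translate s u v :
  iter_partial s (fun x => u (x + v)) = (fun x => iter_partial s u (x + v)).
Proof.
elim: s => //= i s ->; apply/funext => x; rewrite /partial /derive.
set F := (X in lim (X @ _)); set G := (X in _ = lim (X @ _)).
by have -> : F = G by apply/funext => h; rewrite /F /G /= -addrA.
Qed.

Lemma test_function0 : test_function (cst 0 : 'rV[R]_d -> R).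
Proof.
split; last by apply: (@compact_support _ _ _ 0) => x; rewrite eqxx.
have bs s : iter_partial s (cst 0 : 'rV[R]_d -> R) = cst 0.
  by elim: s => //= i s ->; apply/funext => x; rewrite /partial derive_cst.
by move=> s x; rewrite bs; exact: differentiable_cst.
Qed.

Lemma test_functionD a u w :
  test_function u -> test_function w -> test_function (u \+ (a \*o w)).
Proof.
move=> tu tw; have [M1 h1] := test_function_support tu.
have [M2 h2] := test_function_support tw.
move: tu tw => [du _] [dw _]; split.
  move=> s x; rewrite iter_partialD//.
  by apply: differentiableD => //; exact: differentiableZ.
apply: (@compact_support _ _ _ (Num.max M1 M2)) => x /= nz i.
rewrite le_max; have [ux|ux] := eqVneq (u x) 0; last by rewrite (h1 _ ux).
rewrite (h2 x) ?orbT//; apply: contra_neq nz => wx.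
by rewrite ux wx mulr0 addr0.
Qed.

Lemma test_function_translate v u :
  test_function u -> test_function (fun x => u (x + v)).
Proof.
move=> tu; have [M h] := test_function_support tu; move: tu => [du _]; split.
  move=> s x; rewrite iter_partial_translate.
  apply: (@differentiable_comp _ _ _ _ (fun x => x + v) (iter_partial s u)) => //.
apply: (@compact_support _ _ _ (M + `|v|)) => x /= nz i.
have := h _ nz i; rewrite mxE => hx.
have := coord_le_norm v i.
have := ler_normB (x ord0 i + v ord0 i) (v ord0 i); rewrite addrK; lra.
Qed.

(** The iterated partial derivatives vanish outside a cube that does not depend on
the order of differentiation. *)
Lemma iter_partial_eq0 eta : test_function eta -> exists M, forall s x i,
  M < `|x ord0 i| -> iter_partial s eta x = 0.
Proof.
move=> te; have [M h] := test_function_support te; exists M => s.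
have cl : open [set x : 'rV[R]_d | exists i, M < `|x ord0 i|].
  have -> : [set x : 'rV[R]_d | exists i, M < `|x ord0 i|] =
      \bigcup_(i in [set: 'I_d]) [set x : 'rV[R]_d | M < `|x ord0 i|].
    by apply/seteqP; split => [x [i hi]|x [i _ hi]]; exists i.
  apply: bigcup_open => i _.
  apply: (@open_comp _ _ (fun x : 'rV[R]_d => `|x ord0 i|) [set t | M < t]).
    move=> x _; apply: (@continuous_comp _ _ _ (fun x : 'rV[R]_d => x ord0 i) Num.norm).
      exact: coord_continuous.
    exact: norm_continuous.
  exact: open_gt.
elim: s => [|j s IH] x i Mx /=.
  by apply/eqP/negPn/negP => /h /(_ i); rewrite leNgt Mx.
rewrite /partial (@near_eq_derive _ _ _ _ (cst 0)) ?derive_cst//.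
have : nbhs x [set x : 'rV[R]_d | exists i, M < `|x ord0 i|].
  by apply: open_nbhs_nbhs; split => //; exists i.
by apply: filterS => y [k hk]; rewrite (IH _ _ hk).
Qed.

Lemma test_function_partial j u : test_function u -> test_function (partial j u).
Proof.
move=> tu; have [M hM] := iter_partial_eq0 tu.
split.
  move=> s x; have -> : iter_partial s (partial j u) = iter_partial (rcons s j) u.
    by rewrite /iter_partial foldr_rcons.
  by case: tu.
apply: (@compact_support _ _ _ M) => x nz i; rewrite leNgt; apply/negP => hx.
by move: nz; have /= -> := hM [:: j] x i hx; rewrite eqxx.
Qed.

Lemma test_function_continuous u : test_function u -> continuous u.
Proof. by move=> [du _] x; apply: differentiable_continuous; exact: (du [::]). Qed.

Lemma test_function_bounded u : test_function u ->
  exists B n, [/\ 0 <= B, forall x, `|u x| <= B & forall x, ~ cube n x -> u x = 0].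
Proof.
move=> tu; have cu := test_function_continuous tu.
have [M hM] := iter_partial_eq0 tu.
have cK : compact (u @` closure [set x | u x != 0]).
  by apply: continuous_compact; [exact: continuous_subspaceT|case: tu].
have [B [_ hB]] := compact_bounded cK.
exists (Num.max 0 (B + 1)), (Num.bound M); split.
- by rewrite le_max lexx.
- move=> x; have [->|nz] := eqVneq (u x) 0; first by rewrite normr0 le_max lexx.
  rewrite le_max (hB (B + 1)) ?orbT//; first by rewrite ltrDl.
  by exists x => //; exact: subset_closure.
- move=> x ncx; apply: contrapT => /eqP nz; apply: ncx => i; rewrite !mxE.
  have : `|x ord0 i| < (Num.bound M)%:R.
    apply: (@le_lt_trans _ _ `|M|); last exact: norm_lt_bound.
    apply: le_trans (ler_norm _); rewrite leNgt; apply/negP => /(hM [::]) /eqP.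
    by rewrite (negbTE nz).
  by rewrite ltr_norml => /andP[-> /ltW ->].
Qed.

Lemma sqint_bounded_cube u (B : R) n : measurable_fun setT u ->
  (forall x, `|u x| <= B) -> (forall x, ~ cube n x -> u x = 0) -> sqint leb u.
Proof.
move=> mu hB h0; split => //.
have mC : measurable (@cube R d n) by exact: measurable_box.
apply: (@le_lt_trans _ _ (\int[leb]_x (B ^+ 2 * \1_(cube n) x)%:E)%E).
  apply: le_integral_EFin.
  - exact: measurable_funX.
  - by apply: measurable_funM.
  - by move=> x; exact: sqr_ge0.
  - move=> x; rewrite indicE; case: (pselect (cube n x)) => hx.
      rewrite mem_set// mulr1 -[leLHS]real_normK ?num_real//.
      by rewrite ler_sqr ?nnegrE// (le_trans _ (hB x)).
    by rewrite h0// expr0n /= mulr_ge0// sqr_ge0.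
rewrite integralZ_EFin ?sqr_ge0//.
rewrite integral_indic// setIT.
have : leb (@cube R d n) \is a fin_num by rewrite ge0_fin_numE// lebesgue_box_lty.
by move=> h; rewrite ltey_eq fin_numM.
Qed.

Lemma test_function_sqint u : test_function u -> sqint leb u.
Proof.
move=> tu; have [B [n [B0 hB h0]]] := test_function_bounded tu.
apply: sqint_bounded_cube hB h0.
by apply: continuous_rV_measurable; exact: test_function_continuous.
Qed.

Lemma line_is_derive f x v (t df : R) : is_derive (t *: v + x) v f df ->
  is_derive t (1 : R) (fun h : R => f (h *: v + x)) df.
Proof.
move=> [h1 h2].
have E : (fun h => h^-1 *: ((f \o shift (t *: v + x)) (h *: v) - f (t *: v + x))) =
  (fun h : R => h^-1 *: (((fun h : R => f (h *: v + x)) \o shift t) (h *: (1 : R)) -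
           (fun h : R => f (h *: v + x)) t)).
  rewrite funeqE => h /=; rewrite [h%:A]mulr1.
  by rewrite scalerDl addrA.
by split; [rewrite /derivable -E|rewrite /derive -E].
Qed.

Lemma mean_value0 (phi dphi : R -> R) (t : R) :
  (forall s : R, is_derive s (1 : R) phi (dphi s)) ->
  exists2 c, `|c| <= `|t| & phi t - phi 0 = dphi c * t.
Proof.
move=> h.
have cphi a b : {within `[a, b], continuous phi}.
  by apply: derivable_within_continuous => s _; apply: ex_derive.
have [t0|t0|->] := ltrgtP t 0.
- have [c] := MVT t0 (fun s _ => h s) (cphi _ _).
  rewrite in_itv/= => /andP[tc c0] e; exists c.
    by rewrite !ltr0_norm// lerN2 ltW.
  by rewrite -opprB e sub0r mulrN opprK.
- have [c] := MVT t0 (fun s _ => h s) (cphi _ _).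
  rewrite in_itv/= => /andP[c0 ct] e; exists c.
    by rewrite !gtr0_norm// ltW.
  by rewrite e subr0.
- by exists 0 => //; rewrite subrr mulr0.
Qed.

(** First-order Taylor expansion along a coordinate with a uniform remainder.  The
remainder vanishes outside a fixed cube for |t| <= 1, so it is O(t^2) in L^2 as
well. *)
Lemma test_function_taylor j u : test_function u ->
  exists K n, [/\ 0 <= K, forall (t : R) x,
    `|u (t *: delta_mx ord0 j + x) - u x - t * partial j u x| <= K * t ^+ 2 &
    forall (t : R) x, `|t| <= 1 -> ~ cube n x ->
    u (t *: delta_mx ord0 j + x) - u x - t * partial j u x = 0].
Proof.
move=> tu; pose e : 'rV[R]_d := delta_mx ord0 j.
have tp := test_function_partial j tu; have tpp := test_function_partial j tp.
have [K [_ [K0 hK _]]] := test_function_bounded tpp.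
have [M hM] := iter_partial_eq0 tu.
have der w : test_function w -> forall x (t : R),
    is_derive t (1 : R) (fun h : R => w (h *: e + x)) (partial j w (t *: e + x)).
  move=> [dw _] x t; apply: line_is_derive; apply: derivableP.
  by apply: diff_derivable; exact: (dw [::]).
(* A shift of length at most 1 leaves the support after M + 1. *)
exists K, (Num.bound (M + 1)); split => //.
  move=> t x.
  have [c ct E1] := mean_value0 t (der _ tu x).
  have [c' cc E2] := mean_value0 c (der _ tp x).
  move: E1 E2; rewrite !scale0r !add0r -/e => -> E2.
  have -> : partial j u (c *: e + x) * t - t * partial j u x =
     t * (partial j u (c *: e + x) - partial j u x) by ring.
  rewrite E2 normrM -[t ^+ 2]real_normK ?num_real// expr2 mulrCA.
  rewrite ler_wpM2l// normrM; apply: ler_pM => //; exact: le_trans ct.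
move=> t x t1 ncx.
have [i hi] : exists i, M + 1 < `|x ord0 i|.
  apply: contrapT => nex; apply: ncx => i; rewrite !mxE.
  have : `|x ord0 i| < (Num.bound (M + 1))%:R.
    apply: (@le_lt_trans _ _ `|M + 1|); last exact: norm_lt_bound.
    apply: le_trans (ler_norm _); rewrite leNgt; apply/negP => hi.
    by apply: nex; exists i.
  by rewrite ltr_norml => /andP[-> /ltW ->].
have Mi : M < `|x ord0 i| by apply: lt_trans hi; rewrite ltrDl.
have /= -> := hM [::] x i Mi; have /= -> := hM [:: j] x i Mi.
rewrite mulr0 !subr0; apply: (hM [::] _ i); rewrite !mxE eqxx /=.
have a1 : `|t * (i == j)%:R| <= 1.
  by case: (i == j); rewrite ?mulr1// mulr0 normr0.
have := ler_normB (t * (i == j)%:R + x ord0 i) (t * (i == j)%:R).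
rewrite addrAC subrr add0r; lra.
Qed.

End TestFunctionSpace.

(** * Test functions separate L^2 *)

Section FundamentalLemma.
Context (R : realType) (d : nat).
Implicit Types (f eta : 'rV[R]_d -> R) (a b x : 'rV[R]_d).
Local Notation leb := (lebesgue_rV R d).

Lemma flat_exp0_le1 (t : R) : flat_exp 0 t <= 1.
Proof.
rewrite /flat_exp; case: ifPn => // t0.
by rewrite expr0 mul1r -expR0 ler_expR oppr_le0 invr_ge0 ltW.
Qed.

Lemma flat_exp0_cvg1 (y : nat -> R) (c : R) : 0 < c ->
  (forall n, c * n.+1%:R <= y n) -> flat_exp 0 (y n) @[n --> \oo] --> (1 : R).
Proof.
move=> c0 hy.
have h : 1 - c^-1 * (n.+1%:R)^-1 @[n --> \oo] --> (1 : R).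
  rewrite -[X in _ --> X](subr0 (1 : R)); apply: cvgB; first exact: cvg_cst.
  rewrite -[X in _ --> X](mulr0 c^-1); apply: cvgM; first exact: cvg_cst.
  exact: (@cvg_harmonic R).
apply: (squeeze_cvgr (f := fun n => 1 - c^-1 * (n.+1%:R)^-1) (h := cst 1));
  [|exact: h|exact: cvg_cst].
near=> n; rewrite flat_exp0_le1 andbT.
have cn : 0 < c * n.+1%:R by rewrite mulr_gt0.
have yn : 0 < y n by apply: lt_le_trans (hy n).
rewrite /flat_exp yn expr0 mul1r; apply: le_trans (expR_ge1Dx _).
by rewrite lerD2l lerN2 -invfM lef_pV2 ?posrE.
Unshelve. all: by end_near. Qed.

(** A smooth approximation of the indicator of ]s, t].  With N = n + 1 the factors
are exp(-1/(N(r-s))), which vanishes at s, and exp(-1/(N^2(t-r)+N)), whose support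
ends at t + 1/N although its exponent tends to 0 even at r = t: the scales N and
N^2 must differ for that. *)
Definition edge_bump (n : nat) (s t r : R) : R :=
  flat_exp 0 (n.+1%:R * r + - (n.+1%:R * s)) *
  flat_exp 0 (- n.+1%:R ^+ 2 * r + (n.+1%:R ^+ 2 * t + n.+1%:R)).

Lemma edge_bump_bound n s t r : 0 <= edge_bump n s t r <= 1.
Proof.
rewrite mulr_ge0 ?flat_exp_ge0//=.
by rewrite mulr_ile1 ?flat_exp_ge0 ?flat_exp0_le1.
Qed.

Lemma edge_bump_support n s t r : edge_bump n s t r != 0 -> s < r <= t + 1.
Proof.
have n0 : 0 < n.+1%:R :> R by rewrite ltr0n.
have n1 : 1 <= n.+1%:R :> R by rewrite ler1n.
rewrite mulf_eq0 negb_or /flat_exp => /andP[].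
case: ifPn => [h1 _|_]; last by rewrite eqxx.
case: ifPn => [h2 _|_]; last by rewrite eqxx.
move: h1; rewrite -mulrN -mulrDr pmulr_rgt0// subr_gt0 => -> /=.
have e : - n.+1%:R ^+ 2 * r + (n.+1%:R ^+ 2 * t + n.+1%:R) =
  n.+1%:R * (n.+1%:R * (t - r) + 1) :> R by ring.
move: h2; rewrite e pmulr_rgt0// => h2.
set N : R := n.+1%:R in n0 n1 h2; rewrite leNgt; apply/negP => tr; nra.
Qed.

Lemma edge_bump_cvg s t r :
  edge_bump n s t r @[n --> \oo] --> ((s < r <= t)%R%:R : R).
Proof.
have [sr|rs] := ltP s r => /=; last first.
  rewrite (_ : (fun n => _) = cst 0); first exact: cvg_cst.
  apply/funext => n; apply/eqP/negPn/negP => /edge_bump_support /andP[].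
  by rewrite ltNge rs.
have [rt|tr] := leP r t => /=.
  rewrite -[X in _ --> X](mulr1 (1 : R)); apply: cvgM.
    apply: (@flat_exp0_cvg1 _ (r - s)); first by rewrite subr_gt0.
    by move=> n; rewrite le_eqVlt; apply/orP; left; apply/eqP; ring.
  apply: (@flat_exp0_cvg1 _ 1) => // n.
  have n0 : 0 <= (n.+1%:R : R) ^+ 2 * (t - r) by rewrite mulr_ge0 ?subr_ge0.
  by move: n0; set N : R := n.+1%:R; lra.
apply: cvg_near_cst.
have tr0 : 0 < r - t by rewrite subr_gt0.
near=> n; rewrite /edge_bump [X in _ * X](_ : _ = 0) ?mulr0//.
rewrite /flat_exp ifF//; apply/negbTE; rewrite -leNgt.
have e : - n.+1%:R ^+ 2 * r + (n.+1%:R ^+ 2 * t + n.+1%:R) =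
  n.+1%:R * (1 - n.+1%:R * (r - t)) :> R by ring.
rewrite e pmulr_rle0 ?ltr0n// subr_le0 -ler_pdivrMr// mul1r.
apply: (@le_trans _ _ n%:R); last by rewrite ler_nat.
by near: n; exact: nbhs_infty_ger.
Unshelve. all: by end_near. Qed.

Definition box_bump (n : nat) a b x : R :=
  \prod_i edge_bump n (a ord0 i) (b ord0 i) (x ord0 i).

Lemma box_bump_bound n a b x : 0 <= box_bump n a b x <= 1.
Proof.
rewrite /box_bump; elim/big_rec: _ => [|i y _ /andP[y0 y1]]; first by rewrite ler01 lexx.
have /andP[e0 e1] := edge_bump_bound n (a ord0 i) (b ord0 i) (x ord0 i).
by rewrite mulr_ge0// mulr_ile1.
Qed.

Lemma box_bump_support n a b x : box_bump n a b x != 0 -> box a (b + const_mx 1) x.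
Proof.
move=> /prodf_neq0 h i; rewrite !mxE.
exact: edge_bump_support (h i isT).
Qed.

Lemma box_bump_cvg a b x : box_bump n a b x @[n --> \oo] --> (\1_(box a b) x : R).
Proof.
have -> : \1_(box a b) x = \prod_i (a ord0 i < x ord0 i <= b ord0 i)%R%:R :> R.
  rewrite indicE; case: (pselect (box a b x)) => hx.
    by rewrite mem_set// big1// => i _; rewrite (hx i).
  rewrite memNset//; apply/esym/eqP/prodf_eq0.
  apply: contrapT => nex; apply: hx => i; apply/negPn/negP => /negbTE hi.
  by apply: nex; exists i => //; rewrite hi.
apply: cvg_big => [|i _]; first exact: mul_continuous.
exact: edge_bump_cvg.
Qed.

Lemma box_bump_test n a b : test_function (box_bump n a b).
Proof.
have be : bump_algebra (box_bump n a b).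
  apply: bump_algebra_prod => i; rewrite /edge_bump.
  by apply: bump_mul; exact: bump_flat.
split.
  move=> s x; apply: bump_algebra_differentiable.
  exact: bump_algebra_iter_partial.
apply: (@compact_support _ _ _ (`|a| + (`|b| + 1))) => x /box_bump_support hx i.
have := hx i; rewrite !mxE.
have := coord_le_norm a i; have := coord_le_norm b i; rewrite !ler_norml.
have := normr_ge0 a; have := normr_ge0 b.
move=> ? ? /andP[? ?] /andP[? ?] /andP[? ?]; apply/andP; split; lra.
Qed.

(** Bumps converge to the indicator of a box and are dominated by that of a larger
one, so the integral of f over every box is 0. *)
Theorem test_function_orthogonal_eq0 f : sqint leb f ->
  (forall eta, test_function eta -> ip leb f eta = 0) ->
  {ae leb, forall x, f x = 0}.
Proof.
move=> sf hf; have mf := sqint_meas sf.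
apply: sqint_box_integral_eq0 => // a b.
have mab : measurable (box a b) by exact: measurable_box.
have mab1 : measurable (box a (b + const_mx 1)) by exact: measurable_box.
have ig : leb.-integrable setT ((EFin \o (fun x => `|f x|)) \_ (box a (b + const_mx 1))).
  apply: (integrable_mkcond _ mab1).1.
  by apply: integrable_norm; exact: sqint_integrable_box.
have meta n : measurable_fun setT (box_bump n a b).
  by case: (test_function_sqint (box_bump_test n a b)).
have c1 n : measurable_fun setT (fun x => (f x * box_bump n a b x)%:E).
  by apply/measurable_EFinP; exact: measurable_funM.
have c2 : measurable_fun setT ((EFin \o f) \_ (box a b)).
  apply/(measurable_restrictT _ _).1 => //; apply/measurable_EFinP.
  exact: measurable_funTS.
have c3 : {ae leb, forall x, setT x ->
    (f x * box_bump n a b x)%:E @[n --> \oo] --> ((EFin \o f) \_ (box a b)) x}.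
  apply: nearW => x _; rewrite patchE.
  have -> : (if x \in box a b then (EFin \o f) x else 0%E) = (f x * \1_(box a b) x)%:E.
    by rewrite indicE; case: (x \in _); rewrite /= ?mulr1 ?mulr0.
  apply: cvgn_EFin; apply: cvgM; [exact: cvg_cst|exact: box_bump_cvg].
have c4 : {ae leb, forall x n, setT x -> (`|(f x * box_bump n a b x)%:E| <=
    ((EFin \o (fun x => `|f x|)%R) \_ (box a (b + const_mx 1)%R)) x)%E}.
  apply: nearW => x n _; rewrite patchE.
  have [->|nz] := eqVneq (box_bump n a b x) 0.
    by rewrite mulr0 abse0; case: ifP => //= _; rewrite lee_fin.
  rewrite mem_set /=; last exact: box_bump_support nz.
  have /andP[h0 h1] := box_bump_bound n a b x.
  by rewrite lee_fin normrM (ger0_norm h0) ler_piMr.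
have [_ _] := dominated_convergence measurableT c1 c2 c3 ig c4.
rewrite -integral_mkcond.
rewrite (_ : (fun n => _) = cst 0%E).
  by move=> /cvg_lim <- //; rewrite lim_cst.
apply/funext => n /=.
have := hf _ (box_bump_test n a b); rewrite /ip /Rintegral => h.
rewrite -[LHS]fineK ?h//; apply: integrable_fin_num => //.
by apply: sqint_mul => //; exact/test_function_sqint/box_bump_test.
Qed.

End FundamentalLemma.

(** * Weak derivatives and difference quotients *)

(** Used to let the step of a difference quotient tend to 0 without limits. *)
Lemma ler_small_slope (R : realType) (a b c : R) : 0 <= c ->
  (forall h, 0 < h <= 1 -> a <= b + c * h) -> a <= b.
Proof.
move=> c0 H; apply/ler_addgt0Pr => e e0.
have c1 : 0 < c + 1 by rewrite ltr_wpDl.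
pose h := Num.min 1 (e / (c + 1)).
have h0 : 0 < h <= 1 by rewrite lt_min ltr01 divr_gt0//= ge_min lexx.
apply: le_trans (H _ h0) _; rewrite lerD2l.
apply: (@le_trans _ _ (c * (e / (c + 1)))); first by rewrite ler_wpM2l// ge_min lexx orbT.
by rewrite mulrCA ler_piMr ?(ltW e0)// ler_pdivrMr// mul1r lerDl.
Qed.

Section L2norm.
Context (d : measure_display) (T : measurableType d) (R : realType).
Variable mu : {measure set T -> \bar R}.
Implicit Types (u v w : T -> R).

Definition nrm2 u : R := Num.sqrt (ip mu u u).

Lemma nrm2_ge0 u : 0 <= nrm2 u. Proof. exact: sqrtr_ge0. Qed.

Lemma nrm2_sqr u : nrm2 u ^+ 2 = ip mu u u.
Proof. by rewrite sqr_sqrtr// ip_ge0. Qed.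

Lemma norm_ip_le u v : sqint mu u -> sqint mu v -> `|ip mu u v| <= nrm2 u * nrm2 v.
Proof.
move=> su sv; rewrite -sqrtr_sqr -sqrtrM ?ip_ge0// ler_wsqrtr//.
exact: cauchy_schwarz.
Qed.

Lemma nrm2_le_sqr u (c : R) : 0 <= c -> ip mu u u <= c ^+ 2 -> nrm2 u <= c.
Proof. by move=> c0 h; rewrite -[c]ger0_norm// -sqrtr_sqr ler_wsqrtr. Qed.

Lemma eq0_of_norm_le (x K : R) : 0 <= K -> (forall e, 0 < e -> `|x| <= e * K) -> x = 0.
Proof.
move=> K0 h; apply/normr0_eq0/eqP; rewrite eq_le normr_ge0 andbT.
by apply: (@ler_small_slope _ _ _ K) => // e /andP[/h + _]; rewrite add0r mulrC.
Qed.

Lemma ip_cvg (u_ : nat -> T -> R) u v :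
  (forall n, sqint mu (u_ n)) -> sqint mu u -> sqint mu v ->
  (forall e, 0 < e -> exists N, forall n, (N <= n)%N ->
      ip mu (u_ n \- u) (u_ n \- u) <= e) ->
  forall e, 0 < e -> exists N, forall n, (N <= n)%N ->
    `|ip mu (u_ n) v - ip mu u v| <= e * nrm2 v.
Proof.
move=> su_ su sv h e e0; have [|N HN] := h (e ^+ 2); first by rewrite exprn_gt0.
exists N => n /HN hn; rewrite -ipBl//.
apply: le_trans (norm_ip_le (sqintB (su_ n) su) sv) _.
by rewrite ler_wpM2r ?nrm2_ge0// nrm2_le_sqr// ltW.
Qed.

End L2norm.

Section WeakDerivative.
Context (R : realType) (d : nat) (j : 'I_d).
Implicit Types (u v g eta : 'rV[R]_d -> R) (x : 'rV[R]_d).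
Local Notation leb := (lebesgue_rV R d).
Local Notation ip := (ip leb).
Local Notation sqint := (sqint leb).
Local Notation nrm2 := (nrm2 leb).

Definition tau (h : R) u x : R := u (x + h *: delta_mx ord0 j).

Definition wderiv u g : Prop := [/\ sqint u, sqint g &
  forall eta, test_function eta -> ip (partial j eta) u = - ip eta g].

Lemma tau_comp (h k : R) u : tau h (tau k u) = tau (h + k) u.
Proof. by apply/funext => x; rewrite /tau -addrA -scalerDl. Qed.

Lemma tau0 u : tau 0 u = u.
Proof. by apply/funext => x; rewrite /tau scale0r addr0. Qed.

Lemma sqint_tau h u : sqint u -> sqint (tau h u).
Proof. exact: sqint_translate. Qed.

Lemma ip_tau h u v : sqint u -> sqint v -> ip (tau h u) (tau h v) = ip u v.
Proof. by move=> [mu _] [mv _]; exact: ip_translate. Qed.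

Lemma ip_tau_adj h u v : sqint u -> sqint v -> ip (tau h u) v = ip u (tau (- h) v).
Proof.
move=> su sv; rewrite -(ip_tau h su (sqint_tau (- h) sv)).
by rewrite tau_comp subrr tau0.
Qed.

Lemma nrm2_tau h u : sqint u -> nrm2 (tau h u) = nrm2 u.
Proof. by move=> su; rewrite /nrm2 ip_tau. Qed.

Lemma test_tau h eta : test_function eta -> test_function (tau h eta).
Proof. exact: test_function_translate. Qed.

Lemma partial_tau h eta : partial j (tau h eta) = tau h (partial j eta).
Proof. exact: (iter_partial_translate [:: j]). Qed.

(** The L^2 norm is the supremum over test functions.  The functional (u, .) on
test functions is represented by some g of squared norm at most C, and u = g
because test functions separate L^2. *)
Lemma test_function_orthogonal_le u (C : R) : sqint u -> 0 <= C ->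
  (forall eta, test_function eta -> ip u eta ^+ 2 <= C * ip eta eta) -> ip u u <= C.
Proof.
move=> su C0 h.
have [g [sg gE gC]] := @riesz_on_subspace _ _ _ leb (@test_function R d) (ip u) C
  (@test_function_sqint R d) (test_function0 R d)
  (fun a _ _ => @test_functionD R d a _ _)
  (fun a v w tv tw => etrans (ipDr (test_function_sqint tv)
     (sqintZ a (test_function_sqint tw)) su)
     (congr1 (fun r => ip u v + r) (ipZr a (test_function_sqint tw) su))) C0 h.
have ug : {ae leb, forall x, u x = g x}.
  have := @test_function_orthogonal_eq0 R d (u \- g) (sqintB su sg).
  move=> H; apply: filterS (H _); first by move=> x /= /eqP; rewrite subr_eq0 => /eqP.
  by move=> eta te; rewrite ipBl ?gE ?subrr//; exact: test_function_sqint.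
by rewrite (ae_eq_ip su sg su ug) ipC (ae_eq_ip su sg sg ug).
Qed.

(** The error of the first-order expansion of a test function along the j-th axis. *)
Definition remainder (t : R) eta x : R := tau t eta x - eta x - t * partial j eta x.

Lemma remainder_sqint t eta : test_function eta -> sqint (remainder t eta).
Proof.
move=> te; apply: sqintB; first apply: sqintB.
- exact/sqint_tau/test_function_sqint.
- exact: test_function_sqint.
- exact/sqintZ/test_function_sqint/test_function_partial.
Qed.

Lemma remainder_bound eta : test_function eta ->
  exists2 C, 0 <= C & forall t, `|t| <= 1 -> nrm2 (remainder t eta) <= C * t ^+ 2.
Proof.
move=> te; have [K [n [K0 hK h0]]] := test_function_taylor j te.
have fC : leb (@cube R d n) \is a fin_num by rewrite ge0_fin_numE// lebesgue_box_lty.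
pose c := fine (leb (@cube R d n)).
have c0 : 0 <= c by apply: fine_ge0.
exists (K * Num.sqrt c); first by rewrite mulr_ge0// sqrtr_ge0.
move=> t t1; apply: nrm2_le_sqr.
  by rewrite mulr_ge0 ?sqr_ge0// mulr_ge0 ?sqrtr_ge0.
have sr := remainder_sqint t te.
rewrite -lee_fin EFin_ip//.
apply: (@le_trans _ _ (\int[leb]_x ((K * t ^+ 2) ^+ 2 * \1_(cube n) x)%:E)%E).
  apply: le_integral_EFin.
  - by apply: measurable_funX; case: sr.
  - by apply: measurable_funM => //; apply: measurable_indic; exact: measurable_box.
  - by move=> x; exact: sqr_ge0.
  - move=> x; rewrite indicE /remainder /tau addrC [x + _]addrC addrC.
    case: (pselect (cube n x)) => hx.
      rewrite mem_set// mulr1 -[leLHS]real_normK ?num_real//.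
      by rewrite ler_sqr ?nnegrE// ?hK// mulr_ge0// sqr_ge0.
    by rewrite h0// expr0n /= mulr_ge0// sqr_ge0.
rewrite integralZ_EFin ?sqr_ge0//.
  rewrite integral_indic//; last exact: measurable_box.
  rewrite setIT -[X in (_ * X)%E]fineK// -EFinM lee_fin !exprMn sqr_sqrtr//.
  by rewrite -/c; lra.
by apply: measurable_indic; exact: measurable_box.
Qed.

(** Moving the translation onto the test function. *)
Lemma tau_expand (h : R) u eta : sqint u -> test_function eta ->
  ip (tau h u \- u) eta = - (h * ip u (partial j eta)) + ip u (remainder (- h) eta).
Proof.
move=> su te; have se := test_function_sqint te.
have sp := test_function_sqint (test_function_partial j te).
rewrite ipBl//; last exact: sqint_tau.
rewrite ip_tau_adj//.
have -> : tau (- h) eta = remainder (- h) eta \+ (eta \+ ((- h) \*o partial j eta)).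
  by apply/funext => x /=; rewrite /remainder; ring.
have sr := remainder_sqint (- h) te; have sz := sqintZ (- h) sp.
rewrite (ipDr sr (sqintD se sz) su) (ipDr se sz su) (ipZr _ sp su); ring.
Qed.

Lemma wderiv_tau_step (h : R) u g eta : wderiv u g -> test_function eta ->
  `|ip (tau h u \- u) eta| <=
    `|h| * (nrm2 g * nrm2 eta) + nrm2 u * nrm2 (remainder (- h) eta).
Proof.
move=> [su sg wd] te; rewrite tau_expand// (ipC _ u) wd// mulrN opprK.
apply: le_trans (ler_normD _ _) _; apply: lerD.
  rewrite normrM ler_wpM2l// ipC; apply: norm_ip_le => //.
  exact: test_function_sqint.
by apply: norm_ip_le => //; exact: remainder_sqint.
Qed.

Lemma remainder_tau (t k : R) eta : remainder t (tau k eta) = tau k (remainder t eta).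
Proof.
have E : tau t (tau k eta) = tau k (tau t eta) by rewrite !tau_comp addrC.
by apply/funext => x; rewrite /remainder partial_tau E /tau.
Qed.

(** [wderiv_tau_step] is off by a quadratic term in the step.  Splitting h into n
equal steps divides the sum of these errors by n. *)
Lemma wderiv_tau_test (h : R) u g eta : wderiv u g -> test_function eta ->
  `|ip (tau h u \- u) eta| <= `|h| * (nrm2 g * nrm2 eta).
Proof.
move=> wd te; have [su sg _] := wd; have se := test_function_sqint te.
have [C C0 hC] := remainder_bound te.
have step n (s : R) : `|s| <= 1 -> `|ip (tau (s *+ n) u \- u) eta| <=
    (`|s| * (nrm2 g * nrm2 eta) + nrm2 u * (C * s ^+ 2)) *+ n.
  move=> s1; elim: n => [|n IH].
    rewrite !mulr0n tau0 ipBl// subrr normr0//.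
  have -> : tau (s *+ n.+1) u \- u =
      tau (s *+ n) (tau s u \- u) \+ (tau (s *+ n) u \- u).
    have E : tau (s *+ n.+1) u = tau (s *+ n) (tau s u) by rewrite tau_comp mulrSr.
    by apply/funext => x; rewrite E /= /tau /=; ring.
  have sd := sqintB (sqint_tau s su) su.
  rewrite ipDl//; [|exact: sqint_tau|by apply: sqintB => //; exact: sqint_tau].
  rewrite mulrS; apply: le_trans (ler_normD _ _) _; apply: lerD => //.
  rewrite ip_tau_adj//.
  apply: le_trans (wderiv_tau_step _ wd (test_tau _ te)) _.
  rewrite remainder_tau !nrm2_tau//; last exact: remainder_sqint.
  rewrite lerD2l ler_wpM2l ?nrm2_ge0// -(sqrrN s); apply: hC.
  by rewrite normrN.
apply: (@ler_small_slope _ _ _ (nrm2 u * C * `|h| ^+ 2 + nrm2 u * C * `|h|)).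
  by rewrite addr_ge0// !mulr_ge0// nrm2_ge0.
move=> e /andP[e0 e1].
(* Large enough for both |h / n| <= 1 and 1 / n <= e. *)
pose n := (Num.bound (`|h| + e^-1)).
have hn : `|h| + e^-1 < n%:R.
  by apply: le_lt_trans (ler_norm _) _; exact: norm_lt_bound.
have n0 : 0 < n%:R :> R.
  by apply: le_lt_trans hn; rewrite addr_ge0// invr_ge0 ltW.
have en : n%:R^-1 <= e.
  rewrite -[e]invrK lef_pV2 ?posrE ?invr_gt0//.
  by apply: ltW; apply: le_lt_trans hn; rewrite lerDr.
have hn1 : `|h / n%:R| <= 1.
  rewrite normrM normfV (ger0_norm (ltW n0)) ler_pdivrMr// mul1r.
  by apply: ltW; apply: le_lt_trans hn; rewrite lerDl invr_ge0 ltW.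
have := step n _ hn1.
have -> : h / n%:R *+ n = h by rewrite -mulr_natr divfK// gt_eqF.
move/le_trans; apply; rewrite -mulr_natr normrM normfV (ger0_norm (ltW n0)).
have -> : (`|h| / n%:R * (nrm2 g * nrm2 eta) + nrm2 u * (C * (h / n%:R) ^+ 2)) * n%:R =
   `|h| * (nrm2 g * nrm2 eta) + nrm2 u * C * `|h| ^+ 2 * n%:R^-1.
  by rewrite real_normK ?num_real//; field; rewrite gt_eqF.
rewrite lerD2l.
apply: (@le_trans _ _ (nrm2 u * C * `|h| ^+ 2 * e)).
  by rewrite ler_wpM2l// !mulr_ge0// nrm2_ge0.
by rewrite ler_wpM2r ?(ltW e0)// lerDl !mulr_ge0// nrm2_ge0.
Qed.

(** The L^2 form of the mean value inequality. *)
Theorem wderiv_tau_le (h : R) u g : wderiv u g ->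
  ip (tau h u \- u) (tau h u \- u) <= h ^+ 2 * ip g g.
Proof.
move=> wd; have [su sg _] := wd.
apply: test_function_orthogonal_le.
- by apply: sqintB => //; exact: sqint_tau.
- by rewrite mulr_ge0 ?sqr_ge0 ?ip_ge0.
move=> eta te; have h1 := wderiv_tau_test h wd te.
have : `|ip (tau h u \- u) eta| ^+ 2 <= (`|h| * (nrm2 g * nrm2 eta)) ^+ 2.
  by rewrite lerXn2r ?nnegrE ?mulr_ge0 ?nrm2_ge0.
rewrite real_normK ?num_real// => /le_trans; apply.
by rewrite !exprMn !nrm2_sqr real_normK ?num_real// mulrA.
Qed.

(** A bound on the difference quotients makes eta |-> - (u, d_j eta) continuous for
the L^2 norm, and Riesz's theorem supplies the weak derivative. *)
Theorem wderiv_of_tau_le u (C : R) : sqint u -> 0 <= C ->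
  (forall h, 0 < h <= 1 -> ip (tau h u \- u) (tau h u \- u) <= h ^+ 2 * C) ->
  exists2 g, wderiv u g & ip g g <= C.
Proof.
move=> su C0 hC.
have lb eta : test_function eta ->
    `|- ip u (partial j eta)| <= Num.sqrt C * nrm2 eta.
  move=> te; have [K K0 hK] := remainder_bound te.
  have se := test_function_sqint te.
  apply: (@ler_small_slope _ _ _ (nrm2 u * K)); first by rewrite mulr_ge0// nrm2_ge0.
  move=> h /[dup] h01 /andP[h0 h1].
  have E := tau_expand h su te.
  have s1 := sqintB (sqint_tau h su) su.
  have B1 : `|ip (tau h u \- u) eta| <= h * Num.sqrt C * nrm2 eta.
    apply: le_trans (norm_ip_le s1 se) _; rewrite ler_wpM2r ?nrm2_ge0//.
    apply: nrm2_le_sqr; first by rewrite mulr_ge0 ?sqrtr_ge0// ltW.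
    by rewrite exprMn sqr_sqrtr// hC.
  have B2 : `|ip u (remainder (- h) eta)| <= nrm2 u * (K * h ^+ 2).
    apply: le_trans (norm_ip_le su (remainder_sqint _ te)) _.
    rewrite ler_wpM2l ?nrm2_ge0// -(sqrrN h); apply: hK.
    by rewrite normrN ger0_norm// ltW.
  have : `|h * - ip u (partial j eta)| <=
      h * (Num.sqrt C * nrm2 eta + nrm2 u * K * h).
    have -> : h * - ip u (partial j eta) =
      ip (tau h u \- u) eta - ip u (remainder (- h) eta) by rewrite E; ring.
    apply: le_trans (ler_normB _ _) _.
    have := lerD B1 B2; move/le_trans; apply; rewrite le_eqVlt; apply/orP; left.
    by apply/eqP; ring.
  by rewrite normrM (ger0_norm (ltW h0)) ler_pM2l.
have lbsq eta : test_function eta -> (- ip u (partial j eta)) ^+ 2 <= C * ip eta eta.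
  move=> te; rewrite -(nrm2_sqr leb eta) -[X in X * _]sqr_sqrtr// -exprMn.
  rewrite -[leLHS]real_normK ?num_real// ler_sqr ?nnegrE ?mulr_ge0 ?nrm2_ge0 ?sqrtr_ge0//.
  exact: lb.
have llin a v w : test_function v -> test_function w ->
    - ip u (partial j (v \+ (a \*o w))) = - ip u (partial j v) + a * - ip u (partial j w).
  move=> tv tw.
  have -> : partial j (v \+ (a \*o w)) = partial j v \+ (a \*o partial j w).
    by apply: (@iter_partialD _ _ [:: j]); [case: tv|case: tw].
  have sv := test_function_sqint (test_function_partial j tv).
  have sw := test_function_sqint (test_function_partial j tw).
  by rewrite (ipDr sv (sqintZ a sw) su) (ipZr _ sw su); ring.
have [g [sg gE gC]] := @riesz_on_subspace _ _ _ leb (@test_function R d)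
  (fun eta => - ip u (partial j eta)) C
  (@test_function_sqint R d) (test_function0 R d)
  (fun a _ _ => @test_functionD R d a _ _) llin C0 lbsq.
exists g => //; split => // eta te.
by rewrite (ipC _ eta) gE// opprK ipC.
Qed.

Lemma wderiv_unique u g g' : wderiv u g -> wderiv u g' -> {ae leb, forall x, g x = g' x}.
Proof.
move=> [su sg hg] [_ sg' hg'].
have H := @test_function_orthogonal_eq0 R d (g \- g') (sqintB sg sg').
apply: filterS (H _); first by move=> x /= /eqP; rewrite subr_eq0 => /eqP.
move=> eta te; have se := test_function_sqint te.
rewrite ipBl// ![ip _ eta]ipC; apply/eqP; rewrite subr_eq0 -eqr_opp; apply/eqP.
by rewrite -hg// -hg'.
Qed.

Lemma wderivD (a : R) u v g g' : wderiv u g -> wderiv v g' ->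
  wderiv (u \+ (a \*o v)) (g \+ (a \*o g')).
Proof.
move=> [su sg hu] [sv sg' hv]; split; [exact/sqintD/sqintZ|exact/sqintD/sqintZ|].
move=> eta te; have se := test_function_sqint te.
have sp := test_function_sqint (test_function_partial j te).
rewrite (ipDr su (sqintZ a sv) sp) (ipDr sg (sqintZ a sg') se).
by rewrite (ipZr _ sv sp) (ipZr _ sg' se) hu// hv//; ring.
Qed.

Lemma wderiv_lim (u_ g_ : nat -> 'rV[R]_d -> R) u g :
  (forall n, wderiv (u_ n) (g_ n)) -> sqint u -> sqint g ->
  (forall e, 0 < e -> exists N, forall n, (N <= n)%N -> ip (u_ n \- u) (u_ n \- u) <= e) ->
  (forall e, 0 < e -> exists N, forall n, (N <= n)%N -> ip (g_ n \- g) (g_ n \- g) <= e) ->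
  wderiv u g.
Proof.
move=> wd su sg hu hg; split => // eta te.
have se := test_function_sqint te.
have sp := test_function_sqint (test_function_partial j te).
apply/eqP; rewrite -subr_eq0 opprK; apply/eqP.
apply: (@eq0_of_norm_le R _ (nrm2 (partial j eta) + nrm2 eta)).
  by rewrite addr_ge0 ?nrm2_ge0.
move=> e e0.
have su_ n : sqint (u_ n) by case: (wd n).
have sg_ n : sqint (g_ n) by case: (wd n).
have [N1 h1] := ip_cvg su_ su sp hu e0; have [N2 h2] := ip_cvg sg_ sg se hg e0.
pose n := maxn N1 N2.
have b1 := h1 n (leq_maxl _ _); have b2 := h2 n (leq_maxr _ _).
have E : ip (u_ n) (partial j eta) + ip (g_ n) eta = 0.
  by case: (wd n) => _ _ /(_ _ te); rewrite ipC => ->; rewrite ipC addrC subrr.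
rewrite (ipC _ (partial j eta)) (ipC _ eta).
have -> : ip u (partial j eta) + ip g eta =
  - (ip (u_ n) (partial j eta) - ip u (partial j eta)) - (ip (g_ n) eta - ip g eta).
  by rewrite -[LHS]subr0 -E; ring.
apply: le_trans (ler_normB _ _) _; rewrite normrN mulrDr; exact: lerD.
Qed.

End WeakDerivative.

(** * Real Sobolev functions and Kato's inequality *)

Section InnerProductZero.
Context (d : measure_display) (T : measurableType d) (R : realType).
Variable mu : {measure set T -> \bar R}.

Lemma ip0r (f : T -> R) : ip mu f (cst 0) = 0.
Proof.
by rewrite /ip /Rintegral; under eq_integral do rewrite mulr0; rewrite integral0.
Qed.

Lemma ip0l (f : T -> R) : ip mu (cst 0) f = 0.
Proof. by rewrite ipC ip0r. Qed.

End InnerProductZero.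

Opaque ip.

Section RealSobolev.
Context (R : realType) (d : nat).
Implicit Types (u v g : 'rV[R]_d -> R) (x : 'rV[R]_d).
Local Notation leb := (lebesgue_rV R d).
Local Notation ip := (ip leb).
Local Notation sqint := (sqint leb).

Definition rH1 u : Prop := sqint u /\ forall j, exists g, wderiv j u g.

Definition rpartial (j : 'I_d) u : 'rV[R]_d -> R := xget (cst 0) (wderiv j u).

Lemma rpartialP j u : rH1 u -> wderiv j u (rpartial j u).
Proof. by move=> [_ /(_ j) [g hg]]; exact: (xgetPex _ (ex_intro _ g hg)). Qed.

Opaque rpartial.

Definition dirichlet u : R := \sum_(j < d) ip (rpartial j u) (rpartial j u).

Lemma rH1_sqint u : rH1 u -> sqint u. Proof. by case. Qed.

Lemma dirichlet_ge0 u : 0 <= dirichlet u.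
Proof. by apply: sumr_ge0 => j _; exact: ip_ge0. Qed.

(** [rpartial] picks one of the weak derivatives, which are equal almost
everywhere. *)
Lemma dirichletE u (g : 'I_d -> 'rV[R]_d -> R) : rH1 u ->
  (forall j, wderiv j u (g j)) -> dirichlet u = \sum_(j < d) ip (g j) (g j).
Proof.
move=> hu hg; apply: eq_bigr => j _.
have h := rpartialP j hu; have ae := wderiv_unique h (hg j).
have s1 : sqint (rpartial j u) by case: h.
have s2 : sqint (g j) by case: (hg j).
by rewrite (ae_eq_ip s1 s2 s1 ae) ipC (ae_eq_ip s1 s2 s2 ae).
Qed.

Lemma rH1_0 : rH1 (cst 0) /\ dirichlet (cst 0) = 0.
Proof.
have h j : wderiv j (cst 0 : 'rV[R]_d -> R) (cst 0).
  split; [exact: sqint0|exact: sqint0|] => eta _.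
  by rewrite !ip0r oppr0.
have H : rH1 (cst 0) by split; [exact: sqint0|move=> j; exists (cst 0)].
split => //; rewrite (dirichletE H h) big1// => j _.
exact: ip0r.
Qed.

Lemma wderiv_rpartialD (a : R) u v j : rH1 u -> rH1 v ->
  wderiv j (u \+ (a \*o v)) (rpartial j u \+ (a \*o rpartial j v)).
Proof. by move=> hu hv; apply: wderivD; exact: rpartialP. Qed.

Lemma rH1D (a : R) u v : rH1 u -> rH1 v -> rH1 (u \+ (a \*o v)).
Proof.
move=> hu hv; split; first by apply: sqintD; [|apply: sqintZ]; exact: rH1_sqint.
by move=> j; eexists; exact: wderiv_rpartialD.
Qed.

Lemma dirichletD (a : R) u v : rH1 u -> rH1 v ->
  dirichlet (u \+ (a \*o v)) = dirichlet u + a ^+ 2 * dirichlet v +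
    2 * a * \sum_(j < d) ip (rpartial j u) (rpartial j v).
Proof.
move=> hu hv.
rewrite (dirichletE (rH1D a hu hv) (fun j => wderiv_rpartialD a j hu hv)).
rewrite /dirichlet !mulr_sumr -!big_split /=; apply: eq_bigr => j _.
have [_ s1 _] := rpartialP j hu; have [_ s2 _] := rpartialP j hv.
rewrite ipDD//; last exact: sqintZ.
rewrite !(ipZr, ipZl)//; last exact: sqintZ.
move: (ip (rpartial j u) (rpartial j u)) (ip (rpartial j v) (rpartial j v)) => A B.
move: (ip _ _) => C; ring.
Qed.

Lemma rH1Z (a : R) u : rH1 u -> rH1 (a \*o u) /\ dirichlet (a \*o u) = a ^+ 2 * dirichlet u.
Proof.
move=> hu; have [h0 d0] := rH1_0.
have -> : a \*o u = cst 0 \+ (a \*o u) by apply/funext => x /=; rewrite add0r.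
split; first exact: rH1D.
rewrite dirichletD// d0 add0r big1 ?mulr0 ?addr0// => j _.
have [_ s1 _] := rpartialP j h0; have [_ s2 _] := rpartialP j hu.
have w0 : wderiv j (cst 0 : 'rV[R]_d -> R) (cst 0).
  have := wderivD (-1) (rpartialP j h0) (rpartialP j h0).
  have -> : rpartial j (cst 0) \+ (-1 \*o rpartial j (cst 0)) = cst 0.
    by apply/funext => x /=; rewrite mulN1r subrr.
  have -> : cst 0 \+ (-1 \*o cst 0) = cst 0 :> ('rV[R]_d -> R).
    by apply/funext => x /=; rewrite mulr0 addr0.
  by [].
rewrite (ae_eq_ip s1 (sqint0 leb) s2 (wderiv_unique (rpartialP j h0) w0)).
exact: ip0l.
Qed.

Lemma rH1B u v : rH1 u -> rH1 v -> rH1 (u \- v).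
Proof.
move=> hu hv; have -> : u \- v = u \+ (-1 \*o v).
  by apply/funext => x /=; rewrite mulN1r.
exact: rH1D.
Qed.

Lemma dirichlet_parallelogram u v : rH1 u -> rH1 v ->
  dirichlet (2^-1 \*o (u \+ v)) + 4^-1 * dirichlet (u \- v) =
  2^-1 * (dirichlet u + dirichlet v).
Proof.
move=> hu hv.
have e1 : u \- v = u \+ (-1 \*o v) by apply/funext => x /=; rewrite mulN1r.
have e2 : u \+ v = u \+ (1 \*o v) by apply/funext => x /=; rewrite mul1r.
rewrite (rH1Z _ _).2; last by rewrite e2; exact: rH1D.
rewrite e1 e2 !dirichletD//.
by move: (dirichlet u) (dirichlet v) (\sum_(j < d) _) => A B C; field.
Qed.

(** The Euclidean norm of the plane is 1-Lipschitz. *)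
Lemma sqrt_dist_le (a b a' b' : R) :
  (Num.sqrt (a ^+ 2 + b ^+ 2) - Num.sqrt (a' ^+ 2 + b' ^+ 2)) ^+ 2 <=
  (a - a') ^+ 2 + (b - b') ^+ 2.
Proof.
have p0 : 0 <= a ^+ 2 + b ^+ 2 by rewrite addr_ge0 ?sqr_ge0.
have q0 : 0 <= a' ^+ 2 + b' ^+ 2 by rewrite addr_ge0 ?sqr_ge0.
have e1 := sqr_sqrtr p0; have e2 := sqr_sqrtr q0.
have k : a * a' + b * b' <= Num.sqrt (a ^+ 2 + b ^+ 2) * Num.sqrt (a' ^+ 2 + b' ^+ 2).
  rewrite -sqrtrM//; apply: le_trans (ler_norm _) _; rewrite -sqrtr_sqr ler_wsqrtr//.
  have := sqr_ge0 (a * b' - b * a'); nra.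
by rewrite sqrrB e1 e2; lra.
Qed.

Lemma measurable_modulus u v : measurable_fun setT u -> measurable_fun setT v ->
  measurable_fun setT (fun x => Num.sqrt (u x ^+ 2 + v x ^+ 2)).
Proof.
move=> mu mv; apply: (@measurableT_comp _ _ _ _ _ _ (@Num.sqrt R)).
  by apply: continuous_measurable_fun; exact: sqrt_continuous.
by apply: measurable_funD; exact: measurable_funX.
Qed.

Lemma ip_modulus u v : sqint u -> sqint v ->
  sqint (fun x => Num.sqrt (u x ^+ 2 + v x ^+ 2)) /\
  ip (fun x => Num.sqrt (u x ^+ 2 + v x ^+ 2)) (fun x => Num.sqrt (u x ^+ 2 + v x ^+ 2))
    = ip u u + ip v v.
Proof.
move=> su sv.
have e : (\int[leb]_x (Num.sqrt (u x ^+ 2 + v x ^+ 2) ^+ 2)%:E = (ip u u + ip v v)%:E)%E.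
  rewrite EFinD !EFin_ip// -integralD_EFin_ge0.
  - by apply: eq_integral => x _; rewrite sqr_sqrtr// addr_ge0 ?sqr_ge0.
  - by apply: measurable_funX; case: su.
  - by apply: measurable_funX; case: sv.
  - by move=> x; exact: sqr_ge0.
  - by move=> x; exact: sqr_ge0.
have s : sqint (fun x => Num.sqrt (u x ^+ 2 + v x ^+ 2)).
  split; first by apply: measurable_modulus; [case: su|case: sv].
  by rewrite e ltry.
by split => //; apply: EFin_inj; rewrite EFin_ip// e.
Qed.

(** Difference quotients of the modulus are bounded by those of u + i v, direction
by direction, and this property characterises weak derivatives. *)
Theorem kato_dirichlet u v : rH1 u -> rH1 v ->
  rH1 (fun x => Num.sqrt (u x ^+ 2 + v x ^+ 2)) /\
  dirichlet (fun x => Num.sqrt (u x ^+ 2 + v x ^+ 2)) <= dirichlet u + dirichlet v.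
Proof.
move=> hu hv; set w := fun x => _.
have su := rH1_sqint hu; have sv := rH1_sqint hv.
have [sw _] := ip_modulus su sv.
have H j : exists2 g, wderiv j w g & ip g g <=
    ip (rpartial j u) (rpartial j u) + ip (rpartial j v) (rpartial j v).
  apply: wderiv_of_tau_le => //; first by rewrite addr_ge0// ip_ge0.
  move=> h _.
  have sdu := sqintB (sqint_tau j h su) su; have sdv := sqintB (sqint_tau j h sv) sv.
  have sdw := sqintB (sqint_tau j h sw) sw.
  apply: (@le_trans _ _ (ip (tau j h u \- u) (tau j h u \- u) +
                        ip (tau j h v \- v) (tau j h v \- v))).
    rewrite -(ip_modulus sdu sdv).2 -lee_fin !EFin_ip//; last exact: (ip_modulus sdu sdv).1.
    apply: le_integral_EFin.
    - by apply: measurable_funX; case: sdw.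
    - by apply: measurable_funX; case: (ip_modulus sdu sdv).1.
    - by move=> x; exact: sqr_ge0.
    - move=> x; rewrite sqr_sqrtr ?addr_ge0 ?sqr_ge0//.
      exact: sqrt_dist_le.
  by rewrite mulrDr; apply: lerD; apply: wderiv_tau_le; exact: rpartialP.
have hw : rH1 w by split => // j; have [g hg _] := H j; exists g.
split => //; rewrite /dirichlet -big_split /=; apply: ler_sum => j _.
have [g hg gle] := H j; apply: le_trans gle.
have h := rpartialP j hw; have ae := wderiv_unique h hg.
have s1 : sqint (rpartial j w) by case: h.
have s2 : sqint g by case: hg.
by rewrite (ae_eq_ip s1 s2 s1 ae) ipC (ae_eq_ip s1 s2 s2 ae).
Qed.

End RealSobolev.

(** * Complex Sobolev functions through their real and imaginary parts *)

Section ComplexSobolev.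
Context (R : realType) (d : nat).
Implicit Types (f g : 'rV[R]_d -> R[i]) (x : 'rV[R]_d).
Local Notation leb := (lebesgue_rV R d).
Local Notation ip := (ip leb).
Local Notation sqint := (sqint leb).

Definition rpart f x : R := complex.Re (f x).
Definition ipart f x : R := complex.Im (f x).
Definition cplx (u v : 'rV[R]_d -> R) x : R[i] := Complex (u x) (v x).
Definition modulus f x : R := Num.sqrt (rpart f x ^+ 2 + ipart f x ^+ 2).

Lemma normc_modulus f x : Normc.normc (f x) = modulus f x.
Proof. by rewrite /modulus /rpart /ipart; case: (f x). Qed.

Lemma modulus_sqr f x : modulus f x ^+ 2 = rpart f x ^+ 2 + ipart f x ^+ 2.
Proof. by rewrite sqr_sqrtr// addr_ge0 ?sqr_ge0. Qed.

Lemma modulus_ge0 f x : 0 <= modulus f x. Proof. exact: sqrtr_ge0. Qed.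

Lemma cmodulusE f : cmodulus f = cplx (modulus f) (cst 0).
Proof. by apply/funext => x; rewrite /cmodulus /cplx -normc_modulus. Qed.

Lemma modulus_real (u : 'rV[R]_d -> R) : modulus (cplx u (cst 0)) = (fun x => `|u x|).
Proof.
by apply/funext => x; rewrite /modulus /rpart /ipart /= expr0n addr0 sqrtr_sqr.
Qed.

Lemma massE f : mass f = (\int[leb]_x (modulus f x ^+ 2)%:E)%E.
Proof. by apply: eq_integral => x _; rewrite normc_modulus. Qed.

Lemma L2P f : L2 f <-> sqint (rpart f) /\ sqint (ipart f).
Proof.
split => [[[mr mi] m]|[sr si]].
  rewrite massE in m.
  have sm : sqint (modulus f) by split => //; exact: measurable_modulus.
  split; apply: (sqint_dom _ sm) => // x; rewrite modulus_sqr ?lerDl ?lerDr sqr_ge0//.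
split; first by split; [case: sr|case: si].
by rewrite massE; case: (ip_modulus sr si) => -[_].
Qed.

Lemma cintegral_realM (a : 'rV[R]_d -> R) f :
  cintegral (fun x => (a x)%:C%C * f x) = Complex (ip a (rpart f)) (ip a (ipart f)).
Proof.
rewrite /cintegral; congr Complex; apply: eq_Rintegral => x _; rewrite /rpart /ipart.
  by case: (f x) => r i /=; rewrite mul0r subr0.
by case: (f x) => r i /=; rewrite mul0r addr0.
Qed.

(** Test functions are real, so the real and the imaginary part of the defining
identity decouple. *)
Lemma weak_partialsP j f g : L2 f ->
  weak_partials j f g <-> wderiv j (rpart f) (rpart g) /\ wderiv j (ipart f) (ipart g).
Proof.
move=> /L2P[sr si]; split.
  move=> [/L2P[sgr sgi] h]; split; split => // eta te;
    by have := h _ te; rewrite !cintegral_realM => -[].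
move=> [[_ sgr hr] [_ sgi hi]]; split; first exact/L2P.
by move=> eta te; rewrite !cintegral_realM hr// hi.
Qed.

Lemma H1P f : H1 f <-> rH1 (rpart f) /\ rH1 (ipart f).
Proof.
split => [[lf h]|[[sr hr] [si hi]]].
  have /L2P[sr si] := lf.
  split; split => // j; have [g /(weak_partialsP _ _ lf)[]] := h j; first by exists (rpart g).
  by exists (ipart g).
have lf : L2 f by exact/L2P.
split => // j; have [g hg] := hr j; have [g' hg'] := hi j.
by exists (cplx g g'); apply/weak_partialsP.
Qed.

Lemma wpartialP j f : H1 f -> wderiv j (rpart f) (rpart (wpartial j f)) /\
  wderiv j (ipart f) (ipart (wpartial j f)).
Proof.
move=> [lf /(_ j)[g hg]]; apply/weak_partialsP => //.
exact: (xgetPex _ (ex_intro _ g hg)).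
Qed.

Lemma integral_grad f : H1 f ->
  [/\ measurable_fun setT (fun x => \sum_(j < d) Normc.normc (wpartial j f x) ^+ 2),
   forall x, 0 <= \sum_(j < d) Normc.normc (wpartial j f x) ^+ 2 &
   kinetic f = (dirichlet (rpart f) + dirichlet (ipart f))%:E].
Proof.
move=> hf; have /H1P[hr hi] := hf.
have hw j := wpartialP j hf.
have mw j : measurable_fun setT (fun x => Normc.normc (wpartial j f x) ^+ 2).
  apply: measurable_funX; under eq_fun do rewrite normc_modulus.
  by have [[_ [mr _] _] [_ [mi _] _]] := hw j; exact: measurable_modulus.
split.
- exact: measurable_sum.
- by move=> x; apply: sumr_ge0 => j _; exact: sqr_ge0.
rewrite /kinetic; under eq_integral do rewrite -sumEFin.
rewrite ge0_integral_sum//; last 2 first.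
- by move=> j; exact/measurable_EFinP.
- by move=> j x _; rewrite lee_fin sqr_ge0.
rewrite (dirichletE hr (fun j => (hw j).1)) (dirichletE hi (fun j => (hw j).2)).
rewrite -big_split /= -sumEFin; apply: eq_bigr => j _.
have [[_ sr _] [_ si _]] := hw j.
under eq_integral do rewrite normc_modulus.
by have [sm <-] := ip_modulus sr si; rewrite EFin_ip.
Qed.

Lemma rpart_cplx u v : rpart (cplx u v) = u. Proof. by []. Qed.
Lemma ipart_cplx u v : ipart (cplx u v) = v. Proof. by []. Qed.

Lemma H1_real u : H1 (cplx u (cst 0)) <-> rH1 u.
Proof.
rewrite H1P rpart_cplx ipart_cplx; split => [[]//|].
by split=> //; exact: (rH1_0 R d).1.
Qed.

Lemma H1_modulus f : H1 f -> rH1 (modulus f) /\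
  dirichlet (modulus f) <= dirichlet (rpart f) + dirichlet (ipart f).
Proof. by move=> /H1P[hr hi]; exact: kato_dirichlet. Qed.

End ComplexSobolev.

(** * Quantitative convexity of real powers *)

Section PowerInequalities.
Context (R : realType).
Implicit Types (a b c q t x y th eta : R).

Lemma powR_factor n q c : 0 < c -> c `^ q = c ^+ n * c `^ (q - n%:R).
Proof.
move=> c0; rewrite -powR_mulrn ?(ltW c0)// -powRD; last by rewrite (gt_eqF c0) implybT.
by rewrite addrC subrK.
Qed.

(** Tangent line inequality, obtained from Young's inequality
x y <= x^q / q + y^q' / q' at y = c^(q-1). *)
Lemma powR_tangent q x c : 1 < q -> 0 <= x -> 0 < c ->
  c `^ q + q * c `^ (q - 1) * (x - c) <= x `^ q.
Proof.
move=> q1 x0 c0.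
have q0 : 0 < q by apply: lt_trans q1.
have q10 : 0 < q - 1 by rewrite subr_gt0.
have conj : q^-1 + (q / (q - 1))^-1 = 1 by field; rewrite !gt_eqF.
have qq0 : 0 < q / (q - 1) by rewrite divr_gt0.
have := @conjugate_powR R x (c `^ (q - 1)) q (q / (q - 1)) x0 (powR_ge0 _ _) q0 qq0 conj.
rewrite -powRrM (_ : (q - 1) * (q / (q - 1)) = q); last by field; rewrite gt_eqF.
have e : c `^ q = c * c `^ (q - 1).
  exact: (powR_factor 1).
rewrite e; set y := c `^ (q - 1); set z := x `^ q => h.
have h' : q * (x * y) <= q * (z / q + c * y / (q / (q - 1))) by rewrite ler_pM2l.
have E : q * (z / q + c * y / (q / (q - 1))) = z + (q - 1) * (c * y).
  by field; rewrite !gt_eqF.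
by rewrite E in h'; lra.
Qed.

Lemma powR_midpoint q a b : 1 < q -> 0 <= a -> 0 <= b ->
  ((a + b) / 2) `^ q <= (a `^ q + b `^ q) / 2.
Proof.
move=> q1 a0 b0.
have [e|m0] := eqVneq ((a + b) / 2) 0.
  by rewrite e powR0 ?gt_eqF ?(lt_trans _ q1)// divr_ge0// addr_ge0// powR_ge0.
have m1 : 0 < (a + b) / 2 by rewrite lt_neqAle eq_sym m0 divr_ge0// addr_ge0.
have := powR_tangent q1 a0 m1; have := powR_tangent q1 b0 m1.
set m := (a + b) / 2; have hm : m = (a + b) / 2 by [].
set k := q * _.
have : k * (a - m) + k * (b - m) = 0 by rewrite hm; field.
lra.
Qed.

(** Tangents at m + h/2 and at m.  Using two tangent points yields a gap without
any second derivative: for 1 < q < 2 that derivative is unbounded at 0. *)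
Lemma powR_strict_midpoint q th : 1 < q -> 0 < th ->
  exists2 k, 0 < k & forall m h, 0 < m -> 0 <= h -> h <= m -> th * m <= h ->
    k * m `^ q <= ((m + h) `^ q + (m - h) `^ q) / 2 - m `^ q.
Proof.
move=> q1 th0.
have q0 : 0 < q by apply: lt_trans q1.
have q10 : 0 < q - 1 by rewrite subr_gt0.
pose s := (1 + th / 2) `^ (q - 1) - 1.
have s0 : 0 < s.
  have h : 1 `^ (q - 1) < (1 + th / 2) `^ (q - 1).
    apply: gt0_ltr_powR; rewrite ?nnegrE//; first by rewrite addr_ge0// divr_ge0// ltW.
    by rewrite ltrDl divr_gt0.
  by rewrite powR1 in h; rewrite subr_gt0.
exists (q * th / 4 * s); first by rewrite mulr_gt0// divr_gt0// mulr_gt0.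
move=> m h m0 h0 hm thm.
pose c := m + h / 2.
have c0 : 0 < c by rewrite ltr_pwDl// divr_ge0.
have t1 := @powR_tangent q (m + h) c q1 (addr_ge0 (ltW m0) h0) c0.
have t2 := @powR_tangent q c m q1 (ltW c0) m0.
have mh0 : 0 <= m - h by rewrite subr_ge0.
have t3 := @powR_tangent q (m - h) m q1 mh0 m0.
have cm : m `^ (q - 1) * (1 + s) <= c `^ (q - 1).
  have -> : 1 + s = (1 + th / 2) `^ (q - 1) by rewrite /s; ring.
  rewrite -powRM ?(ltW m0)//; last by rewrite addr_ge0// divr_ge0// ltW.
  rewrite ge0_ler_powR ?(ltW q10)// ?nnegrE ?(ltW c0)//.
    by rewrite mulr_ge0 ?(ltW m0)// addr_ge0// divr_ge0// ltW.
  by rewrite /c mulrDr mulr1 lerD2l mulrA ler_pM2r ?invr_gt0// mulrC.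
have mq : m `^ q = m * m `^ (q - 1).
  exact: (powR_factor 1).
have e1 : m + h - c = h / 2 by rewrite /c; field.
have e2 : c - m = h / 2 by rewrite /c; ring.
rewrite e1 in t1; rewrite e2 in t2.
have e3 : m - h - m = - h by ring.
rewrite e3 in t3.
set y := m `^ (q - 1) in cm mq t2 t3 *; set z := c `^ (q - 1) in cm t1.
have y0 : 0 <= y by exact: powR_ge0.
have key : q * (h / 2) * (y * s) <= q * (h / 2) * (z - y).
  by rewrite ler_wpM2l ?mulr_ge0 ?divr_ge0 ?(ltW q0)//; lra.
have key2 : q * (th * m / 2) * (y * s) <= q * (h / 2) * (y * s).
  by rewrite ler_wpM2r ?mulr_ge0 ?(ltW s0)// ler_pM2l// ler_pM2r ?invr_gt0.
have -> : q * th / 4 * s * m `^ q = q * (th * m / 2) * (y * s) / 2.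
  by rewrite mq; field.
lra.
Qed.

(** A modulus of uniform convexity in additive form.  Values with |a - b| small
compared with a + b, or with a + b small, are absorbed by the first two terms;
for the rest the gap is at least a multiple of m^q >= (eta/2)^(q-1) m with
m = (a + b) / 2. *)
Lemma dist_le_convexity_gap q th eta : 1 < q -> 0 < th -> 0 < eta ->
  exists2 C, 0 <= C & forall a b, 0 <= a -> 0 <= b ->
    `|a - b| <= th * (a + b) + eta + C * ((a `^ q + b `^ q) / 2 - ((a + b) / 2) `^ q).
Proof.
move=> q1 th0 eta0.
have q10 : 0 < q - 1 by rewrite subr_gt0.
have [k k0 hk] := powR_strict_midpoint q1 th0.
have e20 : 0 < eta / 2 by rewrite divr_gt0.
pose C := 2 / (k * (eta / 2) `^ (q - 1)).
have C0 : 0 < C by rewrite divr_gt0// mulr_gt0// powR_gt0.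
exists C; first exact: ltW.
suff H a b : 0 <= b -> b <= a ->
    `|a - b| <= th * (a + b) + eta + C * ((a `^ q + b `^ q) / 2 - ((a + b) / 2) `^ q).
  move=> a b a0 b0; have [ba|ab] := leP b a; first exact: H.
  by rewrite distrC (addrC a) (addrC (a `^ q)); apply: H => //; exact: ltW.
move=> b0 ba; have a0 := le_trans b0 ba.
have g0 : 0 <= (a `^ q + b `^ q) / 2 - ((a + b) / 2) `^ q.
  by rewrite subr_ge0 powR_midpoint.
rewrite ger0_norm ?subr_ge0//.
pose m := (a + b) / 2; pose h := (a - b) / 2.
have m0 : 0 <= m by rewrite divr_ge0// addr_ge0.
have h0 : 0 <= h by rewrite divr_ge0// subr_ge0.
have ea : a = m + h by rewrite /m /h; field.
have eb : b = m - h by rewrite /m /h; field.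
have hm : h <= m by rewrite ler_pM2r ?invr_gt0//; lra.
have [hth|hth] := leP h (th * m).
  have : 0 <= C * ((a `^ q + b `^ q) / 2 - ((a + b) / 2) `^ q) by rewrite mulr_ge0// ltW.
  have : a - b = 2 * h by rewrite ea eb; ring.
  have : a + b = 2 * m by rewrite ea eb; ring.
  move=> -> ->; nra.
have m1 : 0 < m.
  by apply: lt_le_trans hm; apply: le_lt_trans hth; rewrite mulr_ge0// ltW.
have := hk m h m1 h0 hm (ltW hth).
rewrite -ea -eb -/m; set g := _ - m `^ q => hg.
have [me|me] := leP m (eta / 2).
  have : 0 <= C * g by rewrite mulr_ge0// ltW.
  have : 0 <= th * (a + b) by rewrite mulr_ge0 ?addr_ge0// ltW.
  have : a - b = 2 * h by rewrite ea eb; ring.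
  lra.
have mq : m `^ q = m * m `^ (q - 1).
  exact: (powR_factor 1).
have mm : (eta / 2) `^ (q - 1) <= m `^ (q - 1).
  by rewrite ge0_ler_powR ?nnegrE ?(ltW q10) ?(ltW e20)// ltW.
have Cg : 2 * m <= C * g.
  apply: (@le_trans _ _ (C * (k * m `^ q))); last by rewrite ler_pM2l.
  rewrite /C mq; set y := m `^ (q - 1) in mm *; set z := (eta / 2) `^ (q - 1) in mm *.
  have z0 : 0 < z by rewrite powR_gt0.
  rewrite (_ : _ * (k * _) = 2 * m * (y / z)); last by field; rewrite !gt_eqF.
  by apply: ler_peMr; [rewrite mulr_ge0|rewrite ler_pdivlMr// mul1r].
have : 0 <= th * (a + b) by rewrite mulr_ge0 ?addr_ge0// ltW.
have : a - b = 2 * h by rewrite ea eb; ring.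
lra.
Qed.

Lemma powR_sqr q t : 0 <= t -> (t ^+ 2) `^ (q / 2) = t `^ q.
Proof.
by move=> t0; rewrite -powR_mulrn// -powRrM mulrCA divff ?mulr1.
Qed.

(** Beyond S = eta^(-1/(q-2)) the power eta t^q dominates t^2. *)
Lemma sqr_le_powR q eta : 2 < q -> 0 < eta ->
  exists2 C, 0 <= C & forall t, 0 <= t -> t ^+ 2 <= eta * t `^ q + C.
Proof.
move=> q2 eta0.
have q20 : 0 < q - 2 by rewrite subr_gt0.
pose S := (eta^-1) `^ ((q - 2)^-1).
have S0 : 0 < S by rewrite powR_gt0// invr_gt0.
exists (S ^+ 2); first exact: sqr_ge0.
move=> t t0; have [tS|St] := leP t S.
  apply: (@le_trans _ _ (S ^+ 2)); first by rewrite lerXn2r ?nnegrE// ltW.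
  by rewrite lerDr mulr_ge0 ?powR_ge0// ltW.
have t1 : 0 < t by apply: lt_trans St.
have -> : t `^ q = t ^+ 2 * t `^ (q - 2).
  exact: (powR_factor 2).
have h : eta^-1 <= t `^ (q - 2).
  have -> : eta^-1 = S `^ (q - 2).
    by rewrite /S -powRrM mulVf ?gt_eqF// powRr1// invr_ge0 ltW.
  by rewrite ge0_ler_powR ?nnegrE ?(ltW q20) ?(ltW S0)// ltW.
apply: (@le_trans _ _ (eta * (t ^+ 2 * t `^ (q - 2)))); last by rewrite lerDl sqr_ge0.
rewrite mulrCA; apply: ler_peMr; first exact: sqr_ge0.
by have := ler_wpM2l (ltW eta0) h; rewrite mulfV ?gt_eqF.
Qed.

Lemma powR_abs_cvg q (a_ : nat -> R) a : 1 <= q ->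
  a_ n @[n --> \oo] --> a -> `|a_ n| `^ q @[n --> \oo] --> `|a| `^ q.
Proof.
move=> q1 ha; have [a00|a0] := eqVneq a 0.
  rewrite a00 in ha *; rewrite normr0 powR0 ?gt_eqF ?(lt_le_trans ltr01)//.
  apply/cvgr0Pnorm_le => e e0.
  have m0 : 0 < Num.min 1 e by rewrite lt_min ltr01.
  move/cvgr0Pnorm_le : ha => /(_ _ m0)[N _ hN]; exists N => // n /hN /=.
  rewrite le_min => /andP[h1 he]; rewrite ger0_norm ?powR_ge0//.
  have [->|an] := eqVneq (a_ n) 0.
    by rewrite normr0 powR0 ?gt_eqF ?(lt_le_trans ltr01)// ltW.
  by apply: le_trans he; apply: ge1r_powR => //; rewrite normr_gt0 an.
have cont : {for `|a|, continuous (fun t : R => t `^ q)}.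
  apply: differentiable_continuous; apply/derivable1_diffP.
  by apply: derivable_powR; rewrite in_itv/= andbT normr_gt0.
exact: (cvg_comp _ _ (cvg_norm ha) cont).
Qed.

End PowerInequalities.

(** * The energy of a real function and its coercivity *)

Section RealIntegrable.
Context (d : measure_display) (T : measurableType d) (R : realType).
Variable mu : {measure set T -> \bar R}.
Implicit Types (f g : T -> R).

Definition Iint f : Prop := mu.-integrable setT (EFin \o f).

Lemma IintD f g : Iint f -> Iint g -> Iint (fun x => f x + g x).
Proof. by move=> hf hg; exact: (integrableD measurableT hf hg). Qed.

Lemma IintZ k f : Iint f -> Iint (fun x => k * f x).
Proof. by move=> hf; exact: (integrableZl measurableT k hf). Qed.

Lemma Iint_le f g : measurable_fun setT f -> (forall x, 0 <= f x) ->
  (forall x, f x <= g x) -> Iint g -> Iint f.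
Proof.
move=> mf f0 fg; apply: le_integrable => //; first exact/measurable_EFinP.
move=> x _ /=; rewrite lee_fin !ger0_norm//; exact: le_trans (fg x).
Qed.

Lemma Iint_lty f : measurable_fun setT f -> (forall x, 0 <= f x) ->
  (\int[mu]_x (f x)%:E < +oo)%E -> Iint f.
Proof.
move=> mf f0 h; apply/integrableP; split; first exact/measurable_EFinP.
by under eq_integral do rewrite /= ger0_norm//.
Qed.

Lemma Iint_EFin f : Iint f -> (\int[mu]_x f x)%:E = (\int[mu]_x (f x)%:E)%E.
Proof. by move=> h; rewrite /Rintegral fineK//; exact: integrable_fin_num. Qed.

Lemma RintD f g : Iint f -> Iint g ->
  \int[mu]_x (f x + g x) = \int[mu]_x f x + \int[mu]_x g x.
Proof. by move=> hf hg; exact: RintegralD. Qed.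

Lemma RintZ k f : Iint f -> \int[mu]_x (k * f x) = k * \int[mu]_x f x.
Proof. by move=> hf; exact: RintegralZl. Qed.

Lemma le_Rint f g : Iint f -> Iint g -> (forall x, f x <= g x) ->
  \int[mu]_x f x <= \int[mu]_x g x.
Proof. by move=> hf hg fg; apply: le_Rintegral => // x _; exact: fg. Qed.

Lemma sqint_Iint u : sqint mu u -> Iint (fun x => u x ^+ 2).
Proof. exact: sqint_sqr_int. Qed.

Lemma ipE u : ip mu u u = \int[mu]_x (u x ^+ 2).
Proof. by apply: eq_Rintegral => x _; rewrite expr2. Qed.

End RealIntegrable.

Section Energy.
Context (R : realType) (d : nat).
Variables (q c omega : R) (W : 'rV[R]_d -> R).
Hypotheses (q_gt2 : 2 < q) (c_gt0 : 0 < c).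
Hypotheses (mW : measurable_fun setT W) (W_ge0 : forall x, 0 <= W x).
Hypothesis W_confining : forall A : R, exists n, forall x, ~ cube n x -> A <= W x.
Implicit Types (u v w : 'rV[R]_d -> R) (x : 'rV[R]_d).
Local Notation leb := (lebesgue_rV R d).
Local Notation ip := (ip leb).
Local Notation Iint := (Iint leb).

Definition potential_energy u : R := \int[leb]_x (W x * u x ^+ 2).
Definition power_integral u : R := \int[leb]_x (`|u x| `^ q).
Local Notation pot := potential_energy.
Local Notation pow := power_integral.

Definition admissible u : Prop :=
  [/\ rH1 u, Iint (fun x => W x * u x ^+ 2) & Iint (fun x => `|u x| `^ q)].

Definition total_energy u : R := dirichlet u / 2 + pot u + c * pow u + omega * ip u u.

(** sqrt ((u^2 + v^2) / 2), written as the modulus of a pair so that Kato's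
inequality applies to it as it stands. *)
Definition mid u v x : R :=
  Num.sqrt ((Num.sqrt 2^-1 * u x) ^+ 2 + (Num.sqrt 2^-1 * v x) ^+ 2).

Lemma pot_ge0 u : 0 <= pot u.
Proof. by apply: Rintegral_ge0 => x _; rewrite mulr_ge0// sqr_ge0. Qed.

Lemma pow_ge0 u : 0 <= pow u.
Proof. by apply: Rintegral_ge0 => x _; exact: powR_ge0. Qed.

Lemma measurable_pow u : measurable_fun setT u -> measurable_fun setT (fun x => `|u x| `^ q).
Proof.
move=> mu; apply: (@measurableT_comp _ _ _ _ _ _ (fun t : R => t `^ q)).
  exact: measurable_powR.
exact: measurableT_comp.
Qed.

Lemma measurable_pot u : measurable_fun setT u -> measurable_fun setT (fun x => W x * u x ^+ 2).
Proof. by move=> mu; apply: measurable_funM => //; exact: measurable_funX. Qed.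

Lemma admissible_sqint u : admissible u -> sqint leb u. Proof. by case=> -[]. Qed.

Lemma Iint_cube n : Iint (fun x => \1_(@cube R d n) x) /\
  \int[leb]_x (\1_(@cube R d n) x) = fine (leb (@cube R d n)).
Proof.
have mC : measurable (@cube R d n) by exact: measurable_box.
have e : (\int[leb]_x (\1_(@cube R d n) x)%:E)%E = leb (@cube R d n).
  by rewrite integral_indic// setIT.
split; last by rewrite /Rintegral e.
apply: Iint_lty => //; first exact: measurable_indic.
by rewrite e; exact: lebesgue_box_lty.
Qed.

Lemma indic_cube_ge0 n x : 0 <= \1_(@cube R d n) x :> R.
Proof. by rewrite indicE. Qed.

(** Outside a large cube W >= A, and inside it the power controls the square up to
a constant.  A large A and a small eta make the mass negligible against the
other terms; this is where q > 2 and the growth of W enter. *)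
Lemma mass_bound (A eta : R) : 0 < A -> 0 < eta -> exists2 C, 0 <= C &
  forall u, admissible u -> ip u u <= A^-1 * pot u + eta * pow u + C.
Proof.
move=> A0 eta0; have [C C0 hC] := sqr_le_powR q_gt2 eta0.
have [n hn] := W_confining A.
have [Ic ec] := Iint_cube n.
exists (C * fine (leb (@cube R d n))); first by rewrite mulr_ge0// fine_ge0.
move=> u [[su _] iW iN].
have I1 := IintZ A^-1 iW; have I2 := IintZ eta iN; have I3 := IintZ C Ic.
rewrite /potential_energy /power_integral ipE -ec -(RintZ _ iW) -(RintZ _ iN) -(RintZ _ Ic).
rewrite -(RintD I1 I2) -(RintD (IintD I1 I2) I3); apply: le_Rint.
- exact: sqint_Iint.
- exact: IintD (IintD I1 I2) I3.
move=> x; case: (pselect (cube n x)) => hx.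
  rewrite indicE mem_set// mulr1 -[u x ^+ 2]real_normK ?num_real//.
  apply: (@le_trans _ _ (eta * `|u x| `^ q + C)); first exact: hC.
  by rewrite lerD2r lerDr !mulr_ge0 ?sqr_ge0// invr_ge0 ltW.
apply: (@le_trans _ _ (A^-1 * (W x * u x ^+ 2))).
  by rewrite mulrA ler_peMl ?sqr_ge0// ler_pdivlMl// mulr1 hn.
rewrite -addrA lerDl addr_ge0//; first by rewrite mulr_ge0 ?powR_ge0// ltW.
by rewrite mulr_ge0// indic_cube_ge0.
Qed.

(** Stated with a free number D for the kinetic part and with only half of the
kinetic and potential energies, since the rotation term is to absorb the other
half and since the kinetic energy of a complex function exceeds the Dirichlet
integral of its modulus. *)
Lemma coercive (K0 C' : R) : 0 <= K0 -> 0 <= C' -> exists2 K, 0 <= K &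
  forall u (D : R), admissible u -> 0 <= D ->
    2^-1 * (2^-1 * D + pot u) + c * pow u <= K0 + C' * ip u u ->
    [/\ D <= K, pot u <= K & ip u u <= K].
Proof.
move=> K00 C0; pose A := 4 * C' + 1.
have A0 : 0 < A by rewrite ltr_wpDl// mulr_ge0.
have A1 : 1 <= A by rewrite lerDr mulr_ge0.
pose eta := c / (2 * (C' + 1)).
have C1 : 0 < C' + 1 by rewrite ltr_wpDl.
have eta0 : 0 < eta by rewrite divr_gt0// mulr_gt0.
have [C2 C20 hM] := mass_bound A0 eta0.
exists (5 * (K0 + C' * C2) + C2).
  by rewrite addr_ge0// mulr_ge0// addr_ge0// mulr_ge0.
move=> u D au D0 h.
have hm := hM u au; have P0 := pot_ge0 u; have N0 := pow_ge0 u.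
have hA : C' * A^-1 <= 4^-1 by rewrite ler_pdivrMr// /A; lra.
have hA1 : A^-1 <= 1 by rewrite invf_le1.
have he : C' * eta <= 2^-1 * c.
  have -> : C' * eta = 2^-1 * c * (C' / (C' + 1)) by rewrite /eta; field; rewrite gt_eqF.
  by rewrite ler_piMr ?mulr_ge0 ?(ltW c_gt0)// ler_pdivrMr// mul1r lerDl.
have he2 : eta <= 2^-1 * c.
  have -> : eta = 2^-1 * c * (C' + 1)^-1 by rewrite /eta; field; rewrite gt_eqF.
  by rewrite ler_piMr ?mulr_ge0 ?(ltW c_gt0)// invf_le1// lerDr.
have m1 : C' * ip u u <= C' * (A^-1 * pot u + eta * pow u + C2) by rewrite ler_wpM2l.
have m2 : C' * A^-1 * pot u <= 4^-1 * pot u by rewrite ler_wpM2r.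
have m3 : C' * eta * pow u <= 2^-1 * c * pow u by rewrite ler_wpM2r.
have m4 : A^-1 * pot u <= 1 * pot u by rewrite ler_wpM2r.
have m5 : eta * pow u <= 2^-1 * c * pow u by rewrite ler_wpM2r.
have X0 : 0 <= C' * C2 by rewrite mulr_ge0.
have cN0 : 0 <= c * pow u by rewrite mulr_ge0// ltW.
split; lra.
Qed.

End Energy.

(** * Stability of near-minimisers *)

Section Stability.
Context (R : realType) (d : nat).
Variables (q c omega : R) (W : 'rV[R]_d -> R).
Hypotheses (q_gt2 : 2 < q) (c_gt0 : 0 < c).
Hypotheses (mW : measurable_fun setT W) (W_ge0 : forall x, 0 <= W x).
Hypothesis W_confining : forall A : R, exists n, forall x, ~ cube n x -> A <= W x.
Implicit Types (u v w : 'rV[R]_d -> R) (x : 'rV[R]_d).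
Local Notation leb := (lebesgue_rV R d).
Local Notation ip := (ip leb).
Local Notation Iint := (Iint leb).
Local Notation pot := (potential_energy W).
Local Notation pow := (power_integral q).
Local Notation admissible := (admissible q W).
Local Notation energy := (total_energy q c omega W).

Let q_gt0 : 0 < q. Proof. exact: lt_trans q_gt2. Qed.
Let q2_gt1 : 1 < q / 2. Proof. by rewrite ltr_pdivlMr// mul1r. Qed.

Local Ltac keep_section := clear - omega q_gt2 c_gt0 mW W_ge0 W_confining q_gt0 q2_gt1.

Lemma mid_sqr u v x : mid u v x ^+ 2 = (u x ^+ 2 + v x ^+ 2) / 2.
Proof.
rewrite sqr_sqrtr ?addr_ge0 ?sqr_ge0// !exprMn sqr_sqrtr ?invr_ge0//.
by rewrite -mulrDr mulrC.
Qed.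

Lemma powR_abs_sqr (t : R) : `|t| `^ q = (t ^+ 2) `^ (q / 2).
Proof. by rewrite -(powR_sqr _ (normr_ge0 t)) real_normK ?num_real. Qed.

Lemma pow_mid_le u v x : `|mid u v x| `^ q <= (`|u x| `^ q + `|v x| `^ q) / 2.
Proof.
by rewrite !powR_abs_sqr mid_sqr; apply: powR_midpoint => //; exact: sqr_ge0.
Qed.

Lemma admissible_pow_le u v w : rH1 w -> Iint (fun x => W x * w x ^+ 2) ->
  admissible u -> admissible v ->
  (forall x, `|w x| `^ q <= (`|u x| `^ q + `|v x| `^ q) / 2) ->
  admissible w /\ pow w <= (pow u + pow v) / 2.
Proof.
move=> hw iw [_ _ iu] [_ _ iv] h.
have mw : measurable_fun setT w by case: hw => -[].
have I := IintZ 2^-1 (IintD iu iv).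
have h' x : `|w x| `^ q <= 2^-1 * (`|u x| `^ q + `|v x| `^ q) by rewrite mulrC.
have J : Iint (fun x => `|w x| `^ q).
  apply: (Iint_le _ _ h' I); first exact: measurable_pow.
  by move=> x; exact: powR_ge0.
split; first by split.
by rewrite /pow mulrC -(RintD iu iv) -(RintZ _ (IintD iu iv)); exact: le_Rint.
Qed.

Lemma admissible_mid u v : admissible u -> admissible v ->
  [/\ admissible (mid u v), dirichlet (mid u v) <= (dirichlet u + dirichlet v) / 2,
      pot (mid u v) = (pot u + pot v) / 2,
      ip (mid u v) (mid u v) = (ip u u + ip v v) / 2 &
      pow (mid u v) <= (pow u + pow v) / 2].
Proof.
move=> au av; have [hu iu _] := au; have [hv iv _] := av.
have [hu1 du] := rH1Z (Num.sqrt 2^-1) hu; have [hv1 dv] := rH1Z (Num.sqrt 2^-1) hv.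
have [hw dw] := kato_dirichlet hu1 hv1.
rewrite du dv sqr_sqrtr ?invr_ge0// -mulrDr mulrC in dw.
have e x : W x * mid u v x ^+ 2 = 2^-1 * (W x * u x ^+ 2 + W x * v x ^+ 2).
  by rewrite mid_sqr; field.
have ef : (fun x => W x * mid u v x ^+ 2) =
    (fun x => 2^-1 * (W x * u x ^+ 2 + W x * v x ^+ 2)).
  by apply/funext => x; exact: e.
have I := IintZ 2^-1 (IintD iu iv).
have Iw : Iint (fun x => W x * mid u v x ^+ 2) by rewrite ef.
have [aw pw] := admissible_pow_le hw Iw au av (pow_mid_le u v).
split => //.
  rewrite /potential_energy mulrC -(RintD iu iv) -(RintZ _ (IintD iu iv)).
  by apply: eq_Rintegral => x _; exact: e.
have su := sqint_Iint (admissible_sqint au); have sv := sqint_Iint (admissible_sqint av).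
rewrite !ipE mulrC -(RintD su sv) -(RintZ _ (IintD su sv)).
by apply: eq_Rintegral => x _; rewrite mid_sqr mulrC.
Qed.

Lemma admissible_sub u v : admissible u -> admissible v ->
  rH1 (u \- v) /\ Iint (fun x => W x * (u \- v) x ^+ 2).
Proof.
move=> au av; have [hu iu _] := au; have [hv iv _] := av.
split; first exact: rH1B.
apply: Iint_le (IintZ 2 (IintD iu iv)) => [||x].
- apply: measurable_pot => //; apply: measurable_funB.
    exact: sqint_meas (admissible_sqint au).
  exact: sqint_meas (admissible_sqint av).
- by move=> x; rewrite mulr_ge0 ?sqr_ge0.
rewrite (_ : 2 * _ = W x * (2 * (u x ^+ 2 + v x ^+ 2))); last by ring.
apply: ler_wpM2l => //=.
have := sqr_ge0 (u x - v x); have := sqr_ge0 (u x + v x); nra.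
Qed.

Lemma admissible_half_sum u v : admissible u -> admissible v ->
  [/\ admissible (2^-1 \*o (u \+ v)),
      pot (2^-1 \*o (u \+ v)) + 4^-1 * pot (u \- v) = (pot u + pot v) / 2,
      ip (2^-1 \*o (u \+ v)) (2^-1 \*o (u \+ v)) + 4^-1 * ip (u \- v) (u \- v) =
        (ip u u + ip v v) / 2 &
      pow (2^-1 \*o (u \+ v)) <= (pow u + pow v) / 2].
Proof.
move=> au av; have [hu iu _] := au; have [hv iv _] := av.
have mu := sqint_meas (admissible_sqint au); have mv := sqint_meas (admissible_sqint av).
have I := IintZ 2 (IintD iu iv).
have hs : rH1 (2^-1 \*o (u \+ v)).
  have [|] := @rH1Z R d 2^-1 (u \+ v); last by [].
  have -> : u \+ v = u \+ (1 \*o v) by apply/funext => x /=; rewrite mul1r.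
  exact: rH1D.
have Wp x (t : R) : 0 <= W x * t ^+ 2 by rewrite mulr_ge0 ?sqr_ge0.
have Is : Iint (fun x => W x * (2^-1 \*o (u \+ v)) x ^+ 2).
  apply: Iint_le I => //.
    by apply: measurable_pot => //; apply: measurable_funM => //; exact: measurable_funD.
  move=> x; rewrite (_ : 2 * _ = W x * (2 * (u x ^+ 2 + v x ^+ 2))); last by ring.
  apply: ler_wpM2l => //=.
  have := sqr_ge0 (u x - v x); have := sqr_ge0 (u x + v x); nra.
have [_ Id] := admissible_sub au av.
have hp x : `|(2^-1 \*o (u \+ v)) x| `^ q <= (`|u x| `^ q + `|v x| `^ q) / 2.
  apply: (@le_trans _ _ (((`|u x| + `|v x|) / 2) `^ q)).
    have B : 0 <= (`|u x| + `|v x|) / 2 by rewrite divr_ge0// addr_ge0.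
    have B' : `|(2^-1 \*o (u \+ v)) x| <= (`|u x| + `|v x|) / 2.
      rewrite /= normrM (@ger0_norm _ 2^-1) ?invr_ge0// mulrC ler_pM2r ?invr_gt0//.
      exact: ler_normD.
    by rewrite ge0_ler_powR ?nnegrE ?(ltW q_gt0).
  by apply: powR_midpoint => //; apply: lt_trans q_gt2; rewrite ltr1n.
have [as_ ps] := admissible_pow_le hs Is au av hp.
split => //.
  rewrite /potential_energy -(RintZ _ Id) -(RintD Is (IintZ _ Id)) mulrC.
  rewrite -(RintD iu iv) -(RintZ _ (IintD iu iv)); apply: eq_Rintegral => x _ /=.
  by field.
have su := admissible_sqint au; have sv := admissible_sqint av.
have -> : ip (2^-1 \*o (u \+ v)) (2^-1 \*o (u \+ v)) = 4^-1 * ip (u \+ v) (u \+ v).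
  have ss := sqintD su sv; rewrite (ipZl _ ss (sqintZ _ ss)) (ipZr _ ss ss).
  by rewrite mulrA; congr (_ * _); field.
rewrite ipDD// ipBB//; move: (ip u u) (ip v v) (ip u v) => a b e; by field.
Qed.

(** Pointwise, (u - v)^2 <= |u^2 - v^2|.  Inside a cube this is bounded by the
uniform convexity of t^(q/2) between u^2 and v^2, outside it by
A^-1 (W u^2 + W v^2).  The four constants are chosen so that each contribution
is at most e / 4. *)
Lemma mass_gap (K e : R) : 0 <= K -> 0 < e -> exists2 del, 0 < del &
  forall u v, admissible u -> admissible v ->
    (forall x, 0 <= u x) -> (forall x, 0 <= v x) ->
    ip u u <= K -> ip v v <= K -> pot u <= K -> pot v <= K ->
    (pow u + pow v) / 2 - pow (mid u v) <= del ->
    ip (u \- v) (u \- v) <= e.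
Proof.
move=> K0 e0.
have K1 : 0 < 8 * K + 1 by rewrite ltr_wpDl// mulr_ge0.
pose th := e / (8 * K + 1); pose A := (8 * K + 1) / e.
have th0 : 0 < th by rewrite divr_gt0.
have A0 : 0 < A by rewrite divr_gt0.
have [n hn] := W_confining A.
have [Ic ec] := Iint_cube R d n.
pose vol := fine (leb (@cube R d n)).
have vol0 : 0 <= vol by apply: fine_ge0.
have vol1 : 0 < vol + 1 by rewrite ltr_wpDl.
pose eta := e / (4 * (vol + 1)).
have eta0 : 0 < eta by rewrite divr_gt0// mulr_gt0.
have [C C0 hC] := dist_le_convexity_gap q2_gt1 th0 eta0.
have C1 : 0 < C + 1 by rewrite ltr_wpDl.
exists (e / (4 * (C + 1))); first by rewrite divr_gt0// mulr_gt0.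
move=> u v au av u0 v0 mu mv pu pv gap.
have su := admissible_sqint au; have sv := admissible_sqint av.
have [aw _ _ _ _] := admissible_mid au av.
have [_ _ Iw] := aw; have [_ iu Iu] := au; have [_ iv Iv] := av.
have J1 := IintD (sqint_Iint su) (sqint_Iint sv).
have J2 := IintD (IintZ 2^-1 (IintD Iu Iv)) (IintZ (-1) Iw).
have J3 := IintD iu iv.
have L1 := IintZ th J1; have L2 := IintZ eta Ic; have L3 := IintZ C J2.
have L4 := IintZ A^-1 J3.
have L := IintD (IintD (IintD L1 L2) L3) L4.
have H : ip (u \- v) (u \- v) <= th * (ip u u + ip v v) + eta * vol +
    C * (2^-1 * (pow u + pow v) + -1 * pow (mid u v)) + A^-1 * (pot u + pot v).
  rewrite !ipE /power_integral /potential_energy /vol -ec.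
  rewrite -(RintD (sqint_Iint su) (sqint_Iint sv)) -(RintZ _ J1) -(RintZ _ Ic).
  rewrite -(RintD L1 L2) -(RintD Iu Iv) -(RintZ _ (IintD Iu Iv)) -(RintZ _ Iw).
  rewrite -(RintD (IintZ 2^-1 (IintD Iu Iv)) (IintZ (-1) Iw)) -(RintZ _ J2).
  rewrite -(RintD (IintD L1 L2) L3) -(RintD iu iv) -(RintZ _ J3).
  rewrite -(RintD (IintD (IintD L1 L2) L3) L4).
  apply: le_Rint => //; first exact/sqint_Iint/sqintB.
  move=> x /=.
  have a0 := sqr_ge0 (u x); have b0 := sqr_ge0 (v x).
  have uv : (u x - v x) ^+ 2 <= `|u x ^+ 2 - v x ^+ 2|.
    have s0 : 0 <= u x + v x by rewrite addr_ge0.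
    have h : `|u x - v x| <= u x + v x.
      rewrite ler_norml; move: (u x) (v x) (u0 x) (v0 x) => s t; keep_section => s0 t0.
      by apply/andP; split; lra.
    rewrite -[leLHS]real_normK ?num_real// expr2 subr_sqr normrM (ger0_norm s0).
    exact: ler_wpM2l.
  have W0 : 0 <= W x * u x ^+ 2 + W x * v x ^+ 2 by rewrite addr_ge0// mulr_ge0.
  have g0 : 0 <= 2^-1 * (`|u x| `^ q + `|v x| `^ q) + -1 * `|mid u v x| `^ q.
    by move: (pow_mid_le u v x); move: (`|u x| `^ q) (_ `^ q) (_ `^ q); keep_section => s t r; lra.
  have Cg0 := mulr_ge0 C0 g0.
  have ai0 : 0 <= A^-1 by rewrite invr_ge0 ltW.
  have AW0 := mulr_ge0 ai0 W0.
  have t0 : 0 <= th * (u x ^+ 2 + v x ^+ 2) by rewrite mulr_ge0 ?(ltW th0)// addr_ge0.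
  case: (pselect (cube n x)) => hx.
    rewrite indicE mem_set// mulr1; apply: le_trans uv _.
    apply: le_trans (hC _ _ a0 b0) _.
    rewrite -!powR_abs_sqr -mid_sqr -powR_abs_sqr [X in X - _]mulrC -(mulN1r (_ `^ q)).
    by rewrite lerDl.
  rewrite indicE memNset// mulr0 addr0.
  have h1 : u x ^+ 2 <= A^-1 * (W x * u x ^+ 2).
    by rewrite mulrA ler_peMl// ler_pdivlMl// mulr1 hn.
  have h2 : v x ^+ 2 <= A^-1 * (W x * v x ^+ 2).
    by rewrite mulrA ler_peMl// ler_pdivlMl// mulr1 hn.
  have h3 : `|u x ^+ 2 - v x ^+ 2| <= u x ^+ 2 + v x ^+ 2.
    rewrite ler_norml; move: (u x ^+ 2) (v x ^+ 2) a0 b0; keep_section => s t s0 t0.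
    by apply/andP; split; lra.
  apply: le_trans uv _; apply: le_trans h3 _.
  apply: le_trans (lerD h1 h2) _; rewrite -mulrDr lerDr.
  by rewrite addr_ge0.
apply: le_trans H _.
have hK : K / (8 * K + 1) <= 8^-1.
  rewrite ler_pdivrMr// (_ : 8^-1 * (8 * K + 1) = K + 8^-1); last by field.
  by rewrite lerDl invr_ge0.
have b1 : th * (ip u u + ip v v) <= e / 4.
  apply: (@le_trans _ _ (th * (2 * K))).
    by rewrite ler_pM2l// mulr2n mulrDl mul1r lerD.
  rewrite /th (_ : _ * (2 * K) = e * 2 * (K / (8 * K + 1))); last by field; rewrite gt_eqF.
  rewrite (_ : e / 4 = e * 2 * 8^-1); last by field.
  by rewrite ler_pM2l// mulr_gt0.
have b2 : eta * vol <= e / 4.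
  rewrite /eta (_ : _ * vol = e / 4 * (vol / (vol + 1))); last by field; rewrite gt_eqF.
  by rewrite ler_piMr ?divr_ge0 ?(ltW e0)// ler_pdivrMr// mul1r lerDl.
have b3 : C * (2^-1 * (pow u + pow v) + -1 * pow (mid u v)) <= e / 4.
  apply: (@le_trans _ _ (C * (e / (4 * (C + 1))))).
    by rewrite ler_wpM2l// mulrC mulN1r.
  rewrite (_ : C * _ = e / 4 * (C / (C + 1))); last by field; rewrite gt_eqF.
  by rewrite ler_piMr ?divr_ge0 ?(ltW e0)// ler_pdivrMr// mul1r lerDl.
have b4 : A^-1 * (pot u + pot v) <= e / 4.
  apply: (@le_trans _ _ (A^-1 * (2 * K))).
    by rewrite ler_pM2l ?invr_gt0// mulr2n mulrDl mul1r lerD.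
  rewrite /A invf_div (_ : _ * (2 * K) = e * 2 * (K / (8 * K + 1))); last by field; rewrite gt_eqF.
  rewrite (_ : e / 4 = e * 2 * 8^-1); last by field.
  by rewrite ler_pM2l// mulr_gt0.
have -> : e = e / 4 + e / 4 + e / 4 + e / 4 by field.
by rewrite !lerD.
Qed.

Lemma energy_coercive (K0 : R) : 0 <= K0 -> exists2 K, 0 <= K &
  forall u, admissible u -> energy u <= K0 ->
    [/\ dirichlet u <= K, pot u <= K & ip u u <= K].
Proof.
move=> K00.
have [K K1 hK] := coercive q_gt2 c_gt0 W_ge0 W_confining K00 (normr_ge0 omega).
exists K => // u au hu; apply: hK => //; first exact: dirichlet_ge0.
have D0 := dirichlet_ge0 u; have P0 := pot_ge0 W_ge0 u; have M0 := ip_ge0 leb u.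
have h : - (omega * ip u u) <= `|omega| * ip u u.
  by rewrite -mulNr ler_wpM2r// -normrN ler_norm.
move: hu; rewrite /total_energy; move: D0 P0 M0 h; keep_section.
move: (dirichlet u) (pot u) (c * pow u) (omega * ip u u) (`|omega| * ip u u).
move=> D P N M1 M2; lra.
Qed.

(** Two comparisons with the infimum m: at [mid u v], which bounds the convexity
gap and thereby the mass of u - v, and at (u + v) / 2, where the parallelogram
identity leaves a quarter of the quadratic part of the energy of u - v; its mass
term, of either sign, is controlled by the first comparison. *)
Theorem energy_stability (m e : R) :
  (forall w, admissible w -> m <= energy w) -> 0 < e ->
  exists2 del, 0 < del & forall u v, admissible u -> admissible v ->
    (forall x, 0 <= u x) -> (forall x, 0 <= v x) ->
    energy u <= m + del -> energy v <= m + del ->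
    dirichlet (u \- v) + pot (u \- v) + ip (u \- v) (u \- v) <= e.
Proof.
move=> hm e0.
have [K K0 hK] := energy_coercive (normr_ge0 (m + 1)).
(* The mass of u - v enters the final bound with the factor 2 |omega| + 1. *)
pose e1 := e / (2 * (2 * `|omega| + 1)).
have o1 : 0 < 2 * `|omega| + 1 by rewrite ltr_wpDl// mulr_ge0.
have e10 : 0 < e1 by rewrite divr_gt0// mulr_gt0.
have [d1 d10 hd1] := mass_gap K0 e10.
pose del := Num.min (Num.min 1 (e / 16)) (c * d1).
have del0 : 0 < del by rewrite !lt_min ltr01 divr_gt0//= mulr_gt0.
have del1 : del <= 1 by rewrite !ge_min lexx.
have del2 : del <= e / 16 by rewrite !ge_min lexx orbT.
have del3 : del <= c * d1 by rewrite !ge_min lexx orbT.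
exists del => // u v au av u0 v0 eu ev.
have [Ku Pu Mu] : [/\ dirichlet u <= K, pot u <= K & ip u u <= K].
  by apply: hK => //; apply: le_trans (ler_norm _); rewrite (le_trans eu)// lerD2l.
have [Kv Pv Mv] : [/\ dirichlet v <= K, pot v <= K & ip v v <= K].
  by apply: hK => //; apply: le_trans (ler_norm _); rewrite (le_trans ev)// lerD2l.
have [aw dw pw mw nw] := admissible_mid au av.
have ew := hm _ aw.
have gap : (pow u + pow v) / 2 - pow (mid u v) <= d1.
  rewrite -(ler_pM2l c_gt0); apply: le_trans del3.
  move: eu ev ew dw; rewrite /total_energy pw mw; keep_section.
  move: (dirichlet u) (dirichlet v) (dirichlet _) (pot u) (pot v) (ip u u) (ip v v).
  move: (pow u) (pow v) (pow _) => Nu Nv Nw Du Dv Dw Pu Pv Mu Mv.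
  lra.
have M := hd1 _ _ au av u0 v0 Mu Mv Pu Pv gap.
have [az pz mz nz] := admissible_half_sum au av.
have ez := hm _ az.
have [[hu _ _] [hv _ _]] := (au, av).
have dz := dirichlet_parallelogram hu hv.
have o2 : - (omega * ip (u \- v) (u \- v)) <= `|omega| * ip (u \- v) (u \- v).
  rewrite -mulNr; apply: ler_wpM2r; first exact: ip_ge0.
  by rewrite -normrN ler_norm.
have P0 : 0 <= pot (u \- v) by exact: pot_ge0.
have D0 := dirichlet_ge0 (u \- v).
have M0 := ip_ge0 leb (u \- v).
move: eu ev ez; rewrite /total_energy => eu ev ez.
have cn : c * pow (2^-1 \*o (u \+ v)) <= c * ((pow u + pow v) / 2) by rewrite ler_pM2l.
have mz' : omega * ip (2^-1 \*o (u \+ v)) (2^-1 \*o (u \+ v)) =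
  omega * ((ip u u + ip v v) / 2) - 4^-1 * (omega * ip (u \- v) (u \- v)).
  by rewrite -mz; field.
have key : dirichlet (u \- v) / 2 + pot (u \- v) <=
    4 * del + `|omega| * ip (u \- v) (u \- v).
  move: eu ev ez dz pz cn mz' o2; keep_section.
  move: (dirichlet u) (dirichlet v) (dirichlet (2^-1 \*o _)) (dirichlet _).
  move: (pot u) (pot v) (pot (2^-1 \*o _)) (pot _) (c * pow (2^-1 \*o _)).
  move: (ip u u) (ip v v) (omega * ip (2^-1 \*o _) _) (omega * ip (u \- v) _).
  move: (`|omega| * _) (pow u) (pow v) => b1 b2 b3 b4 b5 b6 b7 b8 b9 b10 b11 b12 b13 b14 b15 b16.
  lra.
have om : (2 * `|omega| + 1) * ip (u \- v) (u \- v) <= e / 2.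
  apply: (@le_trans _ _ ((2 * `|omega| + 1) * e1)); first by rewrite ler_pM2l.
  by rewrite /e1 le_eqVlt; apply/orP; left; apply/eqP; field; rewrite gt_eqF.
move: key om del2 D0 P0 M0; keep_section.
move: (dirichlet _) (pot _) (ip _ _) (`|omega|) => D P M o; lra.
Qed.

End Stability.

(** * Existence of a minimiser *)

Section Existence.
Context (R : realType) (d : nat).
Variables (q c omega : R) (W : 'rV[R]_d -> R).
Hypotheses (q_gt2 : 2 < q) (c_gt0 : 0 < c).
Hypotheses (mW : measurable_fun setT W) (W_ge0 : forall x, 0 <= W x).
Hypothesis W_confining : forall A : R, exists n, forall x, ~ cube n x -> A <= W x.
Implicit Types (u v w : 'rV[R]_d -> R) (x : 'rV[R]_d).
Local Notation leb := (lebesgue_rV R d).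
Local Notation ip := (ip leb).
Local Notation Iint := (Iint leb).
Local Notation pot := (potential_energy W).
Local Notation pow := (power_integral q).
Local Notation admissible := (admissible q W).
Local Notation energy := (total_energy q c omega W).

Let q_gt0 : 0 < q. Proof. exact: lt_trans q_gt2. Qed.

Lemma admissible0 : admissible (cst 0).
Proof.
have i0 : Iint (cst 0) by exact: integrable0.
split; first exact: (rH1_0 R d).1.
  by rewrite (_ : (fun x => _) = cst 0)//; apply/funext => x; rewrite /= expr0n mulr0.
rewrite (_ : (fun x => _) = cst 0)//.
by apply/funext => x; rewrite /= normr0 powR0// gt_eqF.
Qed.

Lemma energy_bounded_below : exists B, forall u, admissible u -> B <= energy u.
Proof.
have o1 : 0 < `|omega| + 1 by rewrite ltr_wpDl.
have eta0 : 0 < c / (`|omega| + 1) by rewrite divr_gt0.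
have [C C0 hC] := mass_bound q_gt2 W_ge0 W_confining o1 eta0.
exists (- (`|omega| * C)) => u au; have := hC u au; rewrite /total_energy.
have D0 := dirichlet_ge0 u; have P0 := pot_ge0 W_ge0 u; have N0 := pow_ge0 q u.
have M0 := ip_ge0 leb u => hm.
have h1 : - (omega * ip u u) <= `|omega| * ip u u.
  by rewrite -mulNr; apply: ler_wpM2r => //; rewrite -normrN ler_norm.
have h2 := ler_wpM2l (normr_ge0 omega) hm.
have r1 : `|omega| / (`|omega| + 1) <= 1 by rewrite ler_pdivrMr// mul1r lerDl.
have h3 : `|omega| / (`|omega| + 1) * pot u <= 1 * pot u by rewrite ler_wpM2r.
have h4 : `|omega| / (`|omega| + 1) * (c * pow u) <= 1 * (c * pow u).
  by rewrite ler_wpM2r// mulr_ge0// ltW.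
have e : `|omega| * ((`|omega| + 1)^-1 * pot u + c / (`|omega| + 1) * pow u + C) =
    `|omega| / (`|omega| + 1) * pot u + `|omega| / (`|omega| + 1) * (c * pow u) +
    `|omega| * C.
  by field; rewrite gt_eqF.
rewrite e in h2; move: D0 h1 h2 h3 h4; clear - omega.
move: (dirichlet u) (pot u) (c * pow u) (omega * ip u u) (`|omega| * ip u u).
move: (`|omega| * C) (_ / _) => K t D P N a b; lra.
Qed.

Lemma admissible_abs u : admissible u ->
  admissible (fun x => `|u x|) /\ energy (fun x => `|u x|) <= energy u.
Proof.
move=> [hu iu Iu].
have [h0 d0] := rH1_0 R d.
have [hw dw] := kato_dirichlet hu h0.
have E : (fun x => Num.sqrt (u x ^+ 2 + (cst 0 : 'rV[R]_d -> R) x ^+ 2)) = (fun x => `|u x|).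
  by apply/funext => x; rewrite /= expr0n addr0 sqrtr_sqr.
rewrite E in hw dw.
have e1 : (fun x => W x * `|u x| ^+ 2) = (fun x => W x * u x ^+ 2).
  by apply/funext => x; rewrite real_normK ?num_real.
have e2 : (fun x => `| `|u x| | `^ q) = (fun x => `|u x| `^ q).
  by apply/funext => x; rewrite normr_id.
split; first by split; [exact: hw|rewrite e1|rewrite e2].
rewrite /total_energy /potential_energy /power_integral e1 e2 !ipE.
rewrite (_ : (fun x => `|u x| ^+ 2) = (fun x => u x ^+ 2)); last first.
  by apply/funext => x; rewrite real_normK ?num_real.
have D : dirichlet (fun x => `|u x|) <= dirichlet u by move: dw; rewrite d0 addr0.
by rewrite lerD2r lerD2r lerD2r ler_pM2r; [exact: D|rewrite invr_gt0].
Qed.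

Lemma ip_self_cvg (u_ : nat -> 'rV[R]_d -> R) u :
  (forall n, sqint leb (u_ n)) -> sqint leb u ->
  (forall e, 0 < e -> exists N, forall n, (N <= n)%N -> ip (u_ n \- u) (u_ n \- u) <= e) ->
  ip (u_ n) (u_ n) @[n --> \oo] --> ip u u.
Proof.
move=> su_ su h.
have c1 : ip (u_ n \- u) (u_ n \- u) @[n --> \oo] --> (0 : R).
  apply/cvgr0Pnorm_le => e e0; have [N hN] := h e e0.
  by exists N => // n /= Nn; rewrite ger0_norm ?ip_ge0// hN.
have c2 : ip (u_ n) u @[n --> \oo] --> ip u u.
  apply/cvgrPdist_le => e e0.
  have n1 : 0 < nrm2 leb u + 1 by rewrite ltr_wpDl ?nrm2_ge0.
  have [N hN] := ip_cvg su_ su su h (divr_gt0 e0 n1).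
  exists N => // n /= Nn; rewrite distrC; apply: le_trans (hN n Nn) _.
  by rewrite mulrAC ler_pdivrMr// ler_pM2l// lerDl.
have -> : (fun n => ip (u_ n) (u_ n)) =
    (fun n => ip (u_ n \- u) (u_ n \- u) + 2 * ip (u_ n) u - ip u u).
  apply/funext => n; rewrite ipBB//.
  by move: (ip (u_ n) (u_ n)) (ip (u_ n) u) (ip u u) => a b e; ring.
rewrite [X in _ --> X](_ : _ = 0 + 2 * ip u u - ip u u); last first.
  by move: (ip u u) => a; ring.
apply: cvgB; last exact: cvg_cst.
by apply: cvgD => //; apply: cvgM => //; exact: cvg_cst.
Qed.

Lemma ip_rpartial_le u v j : rH1 u -> rH1 v ->
  ip (rpartial j u \- rpartial j v) (rpartial j u \- rpartial j v) <= dirichlet (u \- v).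
Proof.
move=> hu hv.
have wd k : wderiv k (u \- v) (rpartial k u \- rpartial k v).
  have := wderiv_rpartialD (-1) k hu hv.
  have -> : u \+ (-1 \*o v) = u \- v by apply/funext => x /=; rewrite mulN1r.
  have -> // : rpartial k u \+ (-1 \*o rpartial k v) = rpartial k u \- rpartial k v.
  by apply/funext => x /=; rewrite mulN1r.
rewrite (dirichletE (rH1B hu hv) wd) (bigD1 j)//= lerDl.
by apply: sumr_ge0 => k _; exact: ip_ge0.
Qed.

(** The Dirichlet and mass terms converge; for the potential and power terms
Fatou's lemma along an almost everywhere convergent subsequence is enough. *)
Theorem energy_minimizer_of_cauchy (u_ : nat -> 'rV[R]_d -> R) (m : R) (e_ : nat -> R) :
  (forall n, admissible (u_ n)) -> (forall n, energy (u_ n) <= m + e_ n) ->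
  e_ n @[n --> \oo] --> (0 : R) ->
  (forall e, 0 < e -> exists N, forall n k, (N <= n)%N -> (N <= k)%N ->
     dirichlet (u_ n \- u_ k) + ip (u_ n \- u_ k) (u_ n \- u_ k) <= e) ->
  exists2 u, admissible u & energy u <= m.
Proof.
move=> au em e0 cau.
have su n := admissible_sqint (au n).
have hu n : rH1 (u_ n) by case: (au n).
have sg j n : sqint leb (rpartial j (u_ n)) by have [] := rpartialP j (hu n).
have cu e : 0 < e -> exists N, forall n k, (N <= n)%N -> (N <= k)%N ->
    ip (u_ n \- u_ k) (u_ n \- u_ k) <= e.
  move=> /cau[N hN]; exists N => n k Nn Nk; apply: le_trans (hN n k Nn Nk).
  by rewrite lerDr dirichlet_ge0.
have cg j e : 0 < e -> exists N, forall n k, (N <= n)%N -> (N <= k)%N ->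
    ip (rpartial j (u_ n) \- rpartial j (u_ k)) (rpartial j (u_ n) \- rpartial j (u_ k)) <= e.
  move=> /cau[N hN]; exists N => n k Nn Nk; apply: le_trans (hN n k Nn Nk).
  by apply: le_trans (ip_rpartial_le j (hu n) (hu k)) _; rewrite lerDl ip_ge0.
have [u [squ limu [s sk ae]]] := sqint_complete su cu.
have /choice[g Hg] : forall j, exists g, sqint leb g /\ forall e, 0 < e ->
    exists N, forall n, (N <= n)%N ->
      ip (rpartial j (u_ n) \- g) (rpartial j (u_ n) \- g) <= e.
  by move=> j; have [g [sg' lg _]] := sqint_complete (sg j) (cg j); exists g.
have wd j : wderiv j u (g j).
  apply: (wderiv_lim (fun n => rpartialP j (hu n)) squ (Hg j).1 limu (Hg j).2).
have hU : rH1 u by split => // j; exists (g j).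
have subseq (v_ : nat -> 'rV[R]_d -> R) v :
    (forall e, 0 < e -> exists N, forall n, (N <= n)%N -> ip (v_ n \- v) (v_ n \- v) <= e) ->
    forall e, 0 < e -> exists N, forall n, (N <= n)%N ->
      ip (v_ (s n) \- v) (v_ (s n) \- v) <= e.
  move=> h e /h[N hN]; exists N => n Nn; apply: hN; exact: leq_trans (sk n).
have cM := ip_self_cvg (fun n => su (s n)) squ (subseq _ _ limu).
have cD : dirichlet (u_ (s n)) @[n --> \oo] --> dirichlet u.
  rewrite (dirichletE hU wd) /dirichlet.
  apply: cvg_big => [|j _]; first exact: add_continuous.
  exact: (ip_self_cvg (fun n => sg j (s n)) (Hg j).1 (subseq _ _ (Hg j).2)).
have ce : e_ (s n) @[n --> \oo] --> (0 : R).
  have := e0 => /cvgrPdist_le H; apply/cvgrPdist_le => e ep.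
  have [N _ hN] := H e ep; exists N => // n Nn; apply: hN.
  exact: leq_trans (sk n).
pose l := m - dirichlet u / 2 - omega * ip u u.
have cl : m + e_ (s n) - dirichlet (u_ (s n)) / 2 - omega * ip (u_ (s n)) (u_ (s n))
    @[n --> \oo] --> l.
  rewrite /l -[in X in _ --> X](addr0 m).
  apply: cvgB; last by apply: cvgM => //; exact: cvg_cst.
  apply: cvgB; last by apply: cvgM => //; exact: cvg_cst.
  by apply: cvgD => //; exact: cvg_cst.
have mu n : measurable_fun setT (u_ n) by case: (su n).
have muu : measurable_fun setT u by case: squ.
have m1 v : measurable_fun setT v ->
    measurable_fun setT (fun x => W x * v x ^+ 2 + c * `|v x| `^ q).
  move=> mv; apply: measurable_funD; first exact: measurable_pot.
  by apply: measurable_funM => //; exact: measurable_pow.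
have p1 v x : 0 <= W x * v x ^+ 2 by rewrite mulr_ge0// sqr_ge0.
have p2 v x : 0 <= c * `|v x| `^ q by rewrite mulr_ge0 ?powR_ge0// ltW.
have F : (\int[leb]_x (W x * u x ^+ 2 + c * `|u x| `^ q)%:E <= l%:E)%E.
  apply: (@fatou_ae _ _ _ leb (fun k x => W x * u_ (s k) x ^+ 2 + c * `|u_ (s k) x| `^ q)
    _ _ _ _ _ _ _ _ _ cl).
  - by move=> k; exact: m1.
  - exact: m1.
  - by move=> k x; rewrite addr_ge0.
  - by move=> x; rewrite addr_ge0.
  - apply: filterS ae => x hx; apply: cvgD.
      by apply: cvgM; [exact: cvg_cst|rewrite expr2; under eq_fun do rewrite expr2; exact: cvgM].
    apply: cvgM; first exact: cvg_cst.
    by apply: powR_abs_cvg hx; apply: ltW; apply: lt_trans q_gt2; rewrite ltr1n.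
  - move=> k; have [_ I1 I2] := au (s k).
    have mf := measurable_pow q (mu (s k)).
    rewrite (integralD_EFin_ge0 leb (measurable_pot mW (mu (s k)))
      (measurable_funM (measurable_cst c) mf) (p1 _) (p2 _)).
    rewrite (integralZ_EFin leb (ltW c_gt0) mf (fun x => powR_ge0 _ _)).
    rewrite -(Iint_EFin I1) -(Iint_EFin I2) -EFinM -EFinD lee_fin.
    have := em (s k); rewrite /total_energy -/(pot (u_ (s k))) -/(pow (u_ (s k))); lra.
have iW : Iint (fun x => W x * u x ^+ 2).
  apply: Iint_lty => //; first exact: measurable_pot.
  apply: le_lt_trans (ltry l); apply: le_trans F; apply: le_integral_EFin => //.
  - exact: measurable_pot.
  - exact: m1.
  - by move=> x; rewrite lerDl.
have iN : Iint (fun x => `|u x| `^ q).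
  have : Iint (fun x => c * `|u x| `^ q).
    apply: Iint_lty => //; first by apply: measurable_funM => //; exact: measurable_pow.
    apply: le_lt_trans (ltry l); apply: le_trans F; apply: le_integral_EFin => //.
    - by apply: measurable_funM => //; exact: measurable_pow.
    - exact: m1.
    - by move=> x; rewrite lerDr.
  move=> /(IintZ c^-1); apply: eq_integrable => // x _ /=.
  by rewrite mulrA mulVf ?mul1r// gt_eqF.
exists u => //.
have : pot u + c * pow u <= l.
  rewrite -lee_fin /potential_energy /power_integral -(RintZ _ iN) -(RintD iW (IintZ c iN)).
  by rewrite (Iint_EFin (IintD iW (IintZ c iN))).
rewrite /l /total_energy; lra.
Qed.

(** The minimising sequence can be taken nonnegative by [admissible_abs]; it is then
Cauchy by stability. *)
Theorem exists_minimizer : exists u, [/\ admissible u, forall x, 0 <= u x &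
  forall w, admissible w -> energy u <= energy w].
Proof.
have [B hB] := energy_bounded_below.
pose E := [set energy u | u in admissible].
have hE : has_inf E.
  split; first by exists (energy (cst 0)), (cst 0) => //; exact: admissible0.
  by exists B => _ [u au <-]; exact: hB.
have Em w : admissible w -> inf E <= energy w.
  by move=> aw; apply: (inf_lbound hE.2); exists w.
have /choice[u_ Hu] : forall n : nat, exists u,
    [/\ admissible u, forall x, 0 <= u x & energy u <= inf E + n.+1%:R^-1].
  move=> n; have n0 : 0 < n.+1%:R^-1 :> R by rewrite invr_gt0.
  have [_ [u au <-] hu] := inf_adherent n0 hE.
  have [aa ea] := admissible_abs au; exists (fun x => `|u x|); split => //.
  by apply: le_trans ea _; exact: ltW.
have au n : admissible (u_ n) by case: (Hu n).
have eu n : energy (u_ n) <= inf E + n.+1%:R^-1 by case: (Hu n).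
have cau e : 0 < e -> exists N, forall n k, (N <= n)%N -> (N <= k)%N ->
    dirichlet (u_ n \- u_ k) + ip (u_ n \- u_ k) (u_ n \- u_ k) <= e.
  move=> e0.
  have [del del0 hdel] := energy_stability q_gt2 c_gt0 mW W_ge0 W_confining Em e0.
  have [N _ hN] := @near_infty_natSinv_lt R (PosNum del0).
  exists N => n k Nn Nk.
  have [_ un _] := Hu n; have [_ uk _] := Hu k.
  apply: le_trans (hdel _ _ (au n) (au k) un uk _ _).
  - by rewrite lerD2r lerDl pot_ge0.
  - by apply: le_trans (eu n) _; rewrite lerD2l; apply: ltW; exact: hN.
  - by apply: le_trans (eu k) _; rewrite lerD2l; apply: ltW; exact: hN.
have [u au' eu'] := energy_minimizer_of_cauchy au eu (@cvg_harmonic R) cau.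
have [aa ea] := admissible_abs au'.
exists (fun x => `|u x|); split => // w aw.
by apply: le_trans ea _; apply: le_trans eu' _; exact: Em.
Qed.

End Existence.

(** * A Borel version of the potential *)

Section BorelVersion.
Context (d : measure_display) (T : measurableType d) (R : realType).
Variable mu : {measure set T -> \bar R}.
Import HBNNSimple.

(** The integral of a nonnegative function is a supremum over simple functions
below it, which is monotone without any measurability. *)
Lemma ge0_integral_mono (f g : T -> \bar R) :
  (forall x, 0 <= f x)%E -> (forall x, f x <= g x)%E ->
  (\int[mu]_x f x <= \int[mu]_x g x)%E.
Proof.
move=> f0 fg; have g0 x : (0 <= g x)%E by apply: le_trans (fg x).
rewrite !ge0_integralTE//; apply: ge_ereal_sup => _ [h hf <-].
apply: ereal_sup_ubound; exists h => // x; exact: le_trans (fg x).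
Qed.

(** Only g is measurable: f stands for an expression in V, which is Lebesgue but
perhaps not Borel measurable, and g for the same expression in W.  Every simple
function below f is below g almost everywhere, and conversely g restricted to
the complement of N is below f. *)
Lemma ge0_integral_eq_off_null (N : set T) (f g : T -> \bar R) :
  measurable N -> mu N = 0%E -> measurable_fun setT g ->
  (forall x, 0 <= f x)%E -> (forall x, 0 <= g x)%E -> (forall x, ~ N x -> f x = g x) ->
  (\int[mu]_x f x = \int[mu]_x g x)%E.
Proof.
move=> mN N0 mg f0 g0 fg; apply/eqP; rewrite eq_le; apply/andP; split.
  rewrite [leLHS]ge0_integralTE//; apply: ge_ereal_sup => _ [h hf <-].
  rewrite -integralT_nnsfun; apply: ae_ge0_le_integral => //.
  - by move=> x _; rewrite lee_fin.
  - exact/measurable_EFinP.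
  - exists N; split => // x /= /not_implyP[_] nle; apply: contrapT => nN.
    by apply: nle; rewrite -fg.
have mg' : measurable_fun setT (g \_ (~` N)).
  by apply/(measurable_restrictT _ _).1; [exact: measurableC|exact: measurable_funTS].
have g0' x : (0 <= (g \_ (~` N)) x)%E by rewrite patchE; case: ifP.
apply: (@le_trans _ _ (\int[mu]_x (g \_ (~` N)) x)%E).
  apply: ae_ge0_le_integral => //.
  exists N; split => // x /= /not_implyP[_] nle; apply: contrapT => nN.
  by apply: nle; rewrite patchE mem_set.
apply: ge0_integral_mono => // x; rewrite patchE; case: ifPn => [|_]; last exact: f0.
by rewrite inE => nN; rewrite fg.
Qed.

End BorelVersion.

Section ConfiningPotential.
Context (R : realType) (d : nat).
Implicit Types (V W : 'rV[R]_d -> R) (x : 'rV[R]_d).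
Local Notation leb := (lebesgue_rV R d).

Lemma enorm_sqr x : enorm x ^+ 2 = \sum_(j < d) x ord0 j ^+ 2.
Proof. by rewrite sqr_sqrtr//; apply: sumr_ge0 => j _; exact: sqr_ge0. Qed.

Lemma coord_le_enorm x i : `|x ord0 i| <= enorm x.
Proof.
rewrite -sqrtr_sqr ler_wsqrtr// (bigD1 i)//= lerDl.
by apply: sumr_ge0 => j _; exact: sqr_ge0.
Qed.

Lemma enorm_off_cube x n : ~ cube n x -> n%:R <= enorm x.
Proof.
move=> ncx; rewrite leNgt; apply/negP => h; apply: ncx => i; rewrite !mxE.
have := le_lt_trans (coord_le_enorm x i) h.
by rewrite ltr_norml => /andP[-> /ltW ->].
Qed.

Lemma two_terms_le_sum (F : 'I_d -> R) (i1 i2 : 'I_d) : i1 != i2 ->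
  (forall j, 0 <= F j) -> F i1 + F i2 <= \sum_(j < d) F j.
Proof.
move=> i12 F0; rewrite (bigD1 i1)//= (bigD1 i2)//=; last by rewrite eq_sym.
by rewrite addrA lerDl; apply: sumr_ge0.
Qed.

(** On the exceptional null set the Borel representative is replaced by a multiple
of |x|^2 that is large enough for W to inherit both growth conditions everywhere,
not merely almost everywhere. *)
Lemma exists_borel_version V (gamma : R) (i1 i2 : 'I_d) : i1 != i2 ->
  lebesgue_measurable V -> (forall x, 0 <= V x) -> tends_to_infty V ->
  tends_to_infty (fun x => V x - gamma ^+ 2 / 2 * (x ord0 i1 ^+ 2 + x ord0 i2 ^+ 2)) ->
  exists W, [/\ measurable_fun setT W, forall x, 0 <= W x,
    forall A : R, exists n, forall x, ~ cube n x -> A <= W x,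
    exists2 N, measurable N & leb N = 0%E /\ forall x, ~ N x -> V x = W x &
    exists2 C, 0 <= C & forall x,
      gamma ^+ 2 / 2 * (x ord0 i1 ^+ 2 + x ord0 i2 ^+ 2) <= W x + C].
Proof.
move=> i12 [W0 mW0 [N [mN N0 NW]]] V0 Vinf gVinf.
have VW0 x : ~ N x -> V x = W0 x.
  by move=> nN; apply: contrapT => ne; apply: nN; exact: NW.
have g0 : 0 <= gamma ^+ 2 / 2 by rewrite divr_ge0 ?sqr_ge0.
pose b x := (1 + gamma ^+ 2 / 2) * \sum_(j < d) x ord0 j ^+ 2.
have s0 x : 0 <= \sum_(j < d) x ord0 j ^+ 2 by apply: sumr_ge0 => j _; exact: sqr_ge0.
have b0 x : 0 <= b x by rewrite mulr_ge0// addr_ge0.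
have two x : x ord0 i1 ^+ 2 + x ord0 i2 ^+ 2 <= \sum_(j < d) x ord0 j ^+ 2.
  by apply: (two_terms_le_sum (F := fun j => x ord0 j ^+ 2)) => // j; exact: sqr_ge0.
have mb : measurable_fun setT b.
  apply: measurable_funM => //; apply: measurable_sum => j.
  by apply: measurable_funX; exact: measurable_mx_coord.
pose W x := if x \in N then b x else W0 x.
have WN x : N x -> W x = b x by move=> Nx; rewrite /W mem_set.
have WnN x : ~ N x -> W x = V x by move=> Nx; rewrite /W memNset// VW0.
exists W; split.
- apply: measurable_fun_ifT => //.
  apply: (measurable_fun_bool true); rewrite setTI (_ : _ @^-1` _ = N)//.
  by apply/seteqP; split => x; [exact: set_mem|exact: mem_set].
- by move=> x; have [Nx|Nx] := pselect (N x); [rewrite WN|rewrite WnN].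
- move=> A; have [r hr] := Vinf A; exists (Num.bound (`|r| + `|A| + 1)) => x /enorm_off_cube h.
  have h1 : `|r| + `|A| + 1 < enorm x.
    by apply: lt_le_trans h; apply: le_lt_trans (ler_norm _) _; exact: norm_lt_bound.
  have r0 := normr_ge0 r; have A0 := normr_ge0 A; have rl := ler_norm r; have Al := ler_norm A.
  have [Nx|Nx] := pselect (N x); last by rewrite WnN//; apply: ltW; apply: hr; lra.
  rewrite WN// /b -enorm_sqr; apply: (@le_trans _ _ (enorm x ^+ 2)); last first.
    by rewrite ler_peMl ?sqr_ge0// lerDl.
  have e1 : 1 <= enorm x by lra.
  have : enorm x <= enorm x ^+ 2 by rewrite expr2 ler_peMl//; lra.
  lra.
- by exists N => //; split => // x Nx; rewrite WnN.
have [r hr] := gVinf 0.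
exists (gamma ^+ 2 / 2 * r ^+ 2); first by rewrite mulr_ge0 ?sqr_ge0.
move=> x; have [Nx|Nx] := pselect (N x).
  rewrite WN//; apply: (@le_trans _ _ (b x)); last by rewrite lerDl mulr_ge0 ?sqr_ge0.
  by rewrite /b mulrDl mul1r; have := ler_wpM2l g0 (two x); have := s0 x; lra.
rewrite WnN//; have [h|h] := ltP r (enorm x).
  have := hr x h; rewrite subr_gt0 => /ltW /le_trans; apply.
  by rewrite lerDl mulr_ge0 ?sqr_ge0.
apply: (@le_trans _ _ (gamma ^+ 2 / 2 * r ^+ 2)); last by rewrite lerDr.
rewrite ler_wpM2l//; apply: le_trans (two x) _; rewrite -enorm_sqr.
have e0 : 0 <= enorm x := sqrtr_ge0 _.
by rewrite lerXn2r ?nnegrE ?(le_trans e0 h).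
Qed.

End ConfiningPotential.

(** * The action, the angular momentum and the ground states *)

Opaque wpartial.

(** The linear arithmetic behind the absorption of the rotation term.  D, P, S are
the kinetic, potential and power parts, x the rotation term, z the left-hand
side of the angular momentum bound, and E', oM', a', l and y bound the other letters. *)
Lemma rotation_absorbed (R : realFieldType) (D P S E E' oM oM' CM a a' l x y z : R) :
  D / 2 + P + S - x + oM <= E - a -> z <= 2^-1 * D + P + CM -> - a <= a' -> x <= y ->
  a' <= l -> y <= 2^-1 * z -> - oM <= oM' -> E <= E' -> 0 <= CM ->
  2^-1 * (2^-1 * D + P) + S <= E' + l + (oM' + CM).
Proof. lra. Qed.

Section ActionFunctional.
Context (R : realType) (d : nat) (d_ge2 : (2 <= d)%N).
Variables (p omega : R) (V W : 'rV[R]_d -> R) (N : set 'rV[R]_d).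
Hypotheses (p_gt1 : 1 < p).
Hypotheses (V_ge0 : forall x, 0 <= V x).
Hypotheses (mW : measurable_fun setT W) (W_ge0 : forall x, 0 <= W x).
Hypotheses (mN : measurable N) (N_null : lebesgue_rV R d N = 0%E).
Hypothesis VW : forall x, ~ N x -> V x = W x.
Implicit Types (f : 'rV[R]_d -> R[i]) (u v w : 'rV[R]_d -> R) (x : 'rV[R]_d).
Local Notation leb := (lebesgue_rV R d).
Local Notation ip := (ip leb).
Local Notation Iint := (Iint leb).
Local Notation q := (p + 1).
Local Notation c := (2 / (p + 1)).
Local Notation pot := (potential_energy W).
Local Notation pow := (power_integral q).
Local Notation admissible := (admissible q W).
Local Notation energy := (total_energy q c omega W).

Definition kin f : R := dirichlet (rpart f) + dirichlet (ipart f).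

Definition real_action (Omega : R) f : R :=
  kin f / 2 + pot (modulus f) + c * pow (modulus f) - Omega * angular_momentum d_ge2 f +
  omega * ip (modulus f) (modulus f).

Lemma p1_gt0 : 0 < q. Proof. by rewrite addr_gt0// (lt_trans _ p_gt1). Qed.

Lemma modulus_meas f : H1 f -> measurable_fun setT (modulus f).
Proof. by move=> /H1_modulus[[[]]]. Qed.

Lemma potentialE f : H1 f -> potential V f = (\int[leb]_x (W x * modulus f x ^+ 2)%:E)%E.
Proof.
move=> hf; have mf := modulus_meas hf.
apply: (ge0_integral_eq_off_null mN N_null).
- by apply/measurable_EFinP; exact: measurable_pot.
- by move=> x; rewrite lee_fin mulr_ge0// sqr_ge0.
- by move=> x; rewrite lee_fin mulr_ge0// sqr_ge0.
- by move=> x Nx; rewrite normc_modulus VW.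
Qed.

Lemma energy_spaceP f : energy_space V f <-> H1 f /\ Iint (fun x => W x * modulus f x ^+ 2).
Proof.
split=> [[hf pf]|[hf If]]; split => //.
  rewrite potentialE// in pf; apply: Iint_lty => //.
    by apply: measurable_pot => //; exact: modulus_meas.
  by move=> x; rewrite mulr_ge0// sqr_ge0.
by rewrite potentialE// -(Iint_EFin If) ltry.
Qed.

Lemma mass_modulus f : H1 f -> mass f = (ip (modulus f) (modulus f))%:E.
Proof. by move=> /H1_modulus[[sm _] _]; rewrite massE EFin_ip. Qed.

Lemma power_modulus f :
  (\int[leb]_x (Normc.normc (f x) `^ q)%:E = \int[leb]_x (`|modulus f x| `^ q)%:E)%E.
Proof. by apply: eq_integral => x _; rewrite normc_modulus ger0_norm// modulus_ge0. Qed.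

Lemma actionE (Omega : R) f : energy_space V f -> Iint (fun x => `|modulus f x| `^ q) ->
  action d_ge2 p V Omega omega f = (real_action Omega f)%:E.
Proof.
move=> /energy_spaceP[hf If] Ip; rewrite /action power_modulus -(Iint_EFin Ip).
have [_ _ ->] := integral_grad hf.
rewrite potentialE// -(Iint_EFin If) mass_modulus//.
by rewrite -!EFinM -!EFinD /real_action [kin f / 2]mulrC.
Qed.

(** Conversely to [actionE], a function of finite action has a finite power
integral; this avoids the Sobolev embedding. *)
Lemma action_lty (Omega : R) f : energy_space V f ->
  (action d_ge2 p V Omega omega f < +oo)%E -> Iint (fun x => `|modulus f x| `^ q).
Proof.
move=> /energy_spaceP[hf If] h; have mf := modulus_meas hf.
apply: Iint_lty; [exact: measurable_pow|by move=> x; exact: powR_ge0|].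
rewrite ltey; apply/eqP => e; move: h; rewrite /action power_modulus e.
have [_ _ ->] := integral_grad hf.
rewrite potentialE// -(Iint_EFin If) mass_modulus//.
rewrite gt0_muley ?lte_fin ?divr_gt0 ?p1_gt0//.
Qed.

(** Equality holds for every term but the kinetic one, where Kato's inequality
acts. *)
Lemma admissible_modulus f : energy_space V f -> Iint (fun x => `|modulus f x| `^ q) ->
  admissible (modulus f) /\ energy (modulus f) <= real_action 0 f.
Proof.
move=> /energy_spaceP[hf If] Ip; have [hm dm] := H1_modulus hf.
split; first by split.
rewrite /real_action mul0r subr0 /total_energy.
rewrite lerD2r lerD2r lerD2r ler_pM2r; [exact: dm|by rewrite invr_gt0].
Qed.

Lemma modulus_nonneg_real u : (forall x, 0 <= u x) -> modulus (cplx u (cst 0)) = u.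
Proof. by move=> u0; rewrite modulus_real; apply/funext => x; rewrite ger0_norm. Qed.

Lemma energy_space_real u : (forall x, 0 <= u x) -> rH1 u ->
  Iint (fun x => W x * u x ^+ 2) -> energy_space V (cplx u (cst 0)).
Proof.
by move=> u0 hu Iu; apply/energy_spaceP; split; [exact/H1_real|rewrite modulus_nonneg_real].
Qed.

Lemma real_action_real u : (forall x, 0 <= u x) -> rH1 u ->
  real_action 0 (cplx u (cst 0)) = energy u.
Proof.
move=> u0 hu; rewrite /real_action /kin /total_energy modulus_nonneg_real//.
rewrite rpart_cplx ipart_cplx (rH1_0 R d).2 mul0r subr0.
by rewrite addr0.
Qed.

Lemma normXE w : rH1 w -> Iint (fun x => W x * w x ^+ 2) ->
  normX V (cplx w (cst 0)) = (Num.sqrt (dirichlet w + pot w + ip w w))%:E.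
Proof.
move=> hw Iw; have hc : H1 (cplx w (cst 0)) by exact/H1_real.
have [mG G0 kE] := integral_grad hc; have sw := rH1_sqint hw.
have mw := sqint_meas sw.
have p0 : 0 <= pot w by exact: pot_ge0.
have i0 := ip_ge0 leb w; have d0 := dirichlet_ge0 w.
rewrite /normX -powR12_sqrt ?addr_ge0// -poweR_EFin; congr (_ `^ _)%E.
transitivity (\int[leb]_x (\sum_(j < d) Normc.normc (wpartial j (cplx w (cst 0)) x) ^+ 2 +
    (W x * w x ^+ 2 + w x ^+ 2))%:E)%E.
  have e x : Normc.normc (cplx w (cst 0) x) ^+ 2 = w x ^+ 2.
    by rewrite normc_modulus modulus_real real_normK ?num_real.
  apply: (ge0_integral_eq_off_null mN N_null).
  - apply/measurable_EFinP; apply: measurable_funD => //.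
    by apply: measurable_funD; [exact: measurable_pot|exact: measurable_funX].
  - by move=> x; rewrite lee_fin addr_ge0// mulr_ge0 ?sqr_ge0// addr_ge0.
  - by move=> x; rewrite lee_fin !addr_ge0 ?sqr_ge0// mulr_ge0 ?sqr_ge0.
  - by move=> x Nx; rewrite e VW// mulrDl mul1r [X in _ + X]addrC.
rewrite integralD_EFin_ge0//; last 2 first.
- by apply: measurable_funD; [exact: measurable_pot|exact: measurable_funX].
- by move=> x; rewrite addr_ge0 ?sqr_ge0// mulr_ge0 ?sqr_ge0.
rewrite integralD_EFin_ge0//; last 4 first.
- exact: measurable_pot.
- exact: measurable_funX.
- by move=> x; rewrite mulr_ge0 ?sqr_ge0.
- by move=> x; exact: sqr_ge0.
rewrite -(Iint_EFin Iw) -(EFin_ip sw) -/(kinetic (cplx w (cst 0))) kE.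
by rewrite rpart_cplx ipart_cplx (rH1_0 R d).2 addr0 -!EFinD addrA.
Qed.

Lemma norm_le_half_sum (y A B : R) : 0 <= A -> 0 <= B -> y ^+ 2 <= A * B ->
  `|y| <= 2^-1 * A + 2^-1 * B.
Proof.
move=> A0 B0 h; have s0 : 0 <= 2^-1 * A + 2^-1 * B by rewrite addr_ge0// mulr_ge0.
rewrite -(ger0_norm s0) -!sqrtr_sqr ler_wsqrtr//.
have := sqr_ge0 (A - B); nra.
Qed.

(** Cauchy-Schwarz twice, each time by Lagrange's identity: once for the pairing
of z with L_z, once for the rotation field (x2, - x1) with the gradient. *)
Lemma Lz_norm_bound (x1 x2 : R) (z g1 g2 : R[i]) :
  complex.Re (conjc z * (Complex 0 1 * (x2%:C%C * g1 - x1%:C%C * g2))) ^+ 2 <=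
  (x1 ^+ 2 + x2 ^+ 2) * Normc.normc z ^+ 2 *
    (Normc.normc g1 ^+ 2 + Normc.normc g2 ^+ 2).
Proof.
case: z g1 g2 => a b [c1 e1] [c2 e2] /=.
rewrite !sqr_sqrtr ?addr_ge0 ?sqr_ge0//.
pose P := x2 * c1 - x1 * c2; pose Q := x2 * e1 - x1 * e2.
rewrite [X in X ^+ 2 <= _](_ : _ = b * P - a * Q); last by rewrite /P /Q; ring.
have h1 : (b * P - a * Q) ^+ 2 <= (a ^+ 2 + b ^+ 2) * (P ^+ 2 + Q ^+ 2).
  rewrite -subr_ge0 (_ : _ - _ = (b * Q + a * P) ^+ 2); [exact: sqr_ge0|ring].
have h2 : P ^+ 2 <= (x1 ^+ 2 + x2 ^+ 2) * (c1 ^+ 2 + c2 ^+ 2).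
  by rewrite -subr_ge0 (_ : _ - _ = (x1 * c1 + x2 * c2) ^+ 2); [exact: sqr_ge0|rewrite /P; ring].
have h3 : Q ^+ 2 <= (x1 ^+ 2 + x2 ^+ 2) * (e1 ^+ 2 + e2 ^+ 2).
  by rewrite -subr_ge0 (_ : _ - _ = (x1 * e1 + x2 * e2) ^+ 2); [exact: sqr_ge0|rewrite /Q; ring].
apply: le_trans h1 _; rewrite -mulrA mulrCA ler_wpM2l ?addr_ge0 ?sqr_ge0//.
apply: le_trans (lerD h2 h3) _; rewrite -mulrDr le_eqVlt; apply/orP; left; apply/eqP.
ring.
Qed.

Lemma measurable_Lz_integrand (a b c1 e1 c2 e2 : 'rV[R]_d -> R) (i1 i2 : 'I_d) :
  measurable_fun setT a -> measurable_fun setT b ->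
  measurable_fun setT c1 -> measurable_fun setT e1 ->
  measurable_fun setT c2 -> measurable_fun setT e2 ->
  measurable_fun setT (fun x =>
    complex.Re (conjc (Complex (a x) (b x)) * (Complex 0 1 *
      ((x ord0 i2)%:C%C * Complex (c1 x) (e1 x) - (x ord0 i1)%:C%C * Complex (c2 x) (e2 x))))).
Proof.
move=> ma mb mc1 me1 mc2 me2.
have mx i : measurable_fun setT (fun x : 'rV[R]_d => x ord0 i).
  exact: measurable_mx_coord.
rewrite (_ : (fun x => _) = fun x => b x * (x ord0 i2 * c1 x - x ord0 i1 * c2 x) -
    a x * (x ord0 i2 * e1 x - x ord0 i1 * e2 x)).
  apply: measurable_funB; (apply: measurable_funM; first by []);
    by apply: measurable_funB; exact: measurable_funM.
by apply/funext => x /=; ring.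
Qed.

Lemma ax_neq : ax1 d_ge2 != ax2 d_ge2. Proof. by []. Qed.

(** Young's inequality applied to gamma |x'| |f| and |grad f|, where x' consists of
the two coordinates of the plane of rotation. *)
Lemma angular_momentum_bound (gamma C : R) f : 0 <= gamma -> 0 <= C ->
  (forall x, gamma ^+ 2 / 2 * (x ord0 (ax1 d_ge2) ^+ 2 + x ord0 (ax2 d_ge2) ^+ 2) <= W x + C) ->
  energy_space V f ->
  gamma * `|angular_momentum d_ge2 f| <=
    2^-1 * kin f + pot (modulus f) + C * ip (modulus f) (modulus f).
Proof.
move=> g0 C0 hC /energy_spaceP[hf If].
have [mG G0 kE] := integral_grad hf.
have [hm _] := H1_modulus hf; have sm := rH1_sqint hm.
pose G x := \sum_(j < d) Normc.normc (wpartial j f x) ^+ 2.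
pose l x := complex.Re (conjc (f x) * Lz d_ge2 f x).
have IG : Iint G by apply: Iint_lty => //; rewrite -/(kinetic f) kE ltry.
have eG : \int[leb]_x G x = kin f by rewrite /Rintegral -/(kinetic f) kE.
have I1 := IintZ 2^-1 IG; have I2 := IintZ C (sqint_Iint sm).
have I3 := IintD (IintD I1 If) I2.
have lb x : gamma * `|l x| <= 2^-1 * G x + W x * modulus f x ^+ 2 + C * modulus f x ^+ 2.
  set i1 := ax1 d_ge2; set i2 := ax2 d_ge2.
  have hl : l x ^+ 2 <= (x ord0 i1 ^+ 2 + x ord0 i2 ^+ 2) * modulus f x ^+ 2 *
     (Normc.normc (wpartial i1 f x) ^+ 2 + Normc.normc (wpartial i2 f x) ^+ 2).
    by rewrite -(normc_modulus f x); exact: Lz_norm_bound.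
  rewrite -{1}(ger0_norm g0) -normrM.
  set r := x ord0 i1 ^+ 2 + x ord0 i2 ^+ 2 in hl *.
  have r0 : 0 <= r by rewrite addr_ge0// sqr_ge0.
  have m0 := sqr_ge0 (modulus f x); set m := modulus f x ^+ 2 in hl m0 *.
  have hG : Normc.normc (wpartial i1 f x) ^+ 2 + Normc.normc (wpartial i2 f x) ^+ 2 <= G x.
    apply: (two_terms_le_sum (F := fun j => Normc.normc (wpartial j f x) ^+ 2) ax_neq) => j.
    exact: sqr_ge0.
  have hg : (gamma * l x) ^+ 2 <= (gamma ^+ 2 * (r * m)) * G x.
    rewrite exprMn -[leRHS]mulrA ler_wpM2l ?sqr_ge0//; apply: le_trans hl _.
    by rewrite ler_wpM2l ?hG// mulr_ge0.
  have rm0 : 0 <= gamma ^+ 2 * (r * m) by rewrite mulr_ge0 ?sqr_ge0// mulr_ge0.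
  apply: le_trans (norm_le_half_sum rm0 (G0 x) hg) _.
  rewrite [leLHS]addrC -[leRHS]addrA lerD2l -mulrDl.
  rewrite (_ : 2^-1 * _ = gamma ^+ 2 / 2 * r * m); last by ring.
  by rewrite ler_wpM2r ?hC.
have ml : measurable_fun setT l.
  have /H1P[[[mr _] _] [[mi _] _]] := hf.
  have [[_ [mc1 _] _] [_ [me1 _] _]] := wpartialP (ax1 d_ge2) hf.
  have [[_ [mc2 _] _] [_ [me2 _] _]] := wpartialP (ax2 d_ge2) hf.
  have := measurable_Lz_integrand (ax1 d_ge2) (ax2 d_ge2) mr mi mc1 me1 mc2 me2.
  congr (measurable_fun _ _); apply/funext => x; rewrite /l /Lz /rpart /ipart.
  by case: (f x) => a b; case: (wpartial _ f x) => c1 e1; case: (wpartial _ f x) => c2 e2.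
have lb' x : `|gamma * l x| <= 2^-1 * G x + W x * modulus f x ^+ 2 + C * modulus f x ^+ 2.
  by rewrite normrM ger0_norm.
have Igl : Iint (fun x => gamma * l x).
  apply: le_integrable I3 => //; first by apply/measurable_EFinP; exact: measurable_funM.
  by move=> x _ /=; rewrite lee_fin; apply: le_trans (lb' x) (ler_norm _).
have Ial : Iint (fun x => `|gamma * l x|) by exact: integrable_norm.
suff e : gamma * `|angular_momentum d_ge2 f| = `|\int[leb]_x (gamma * l x)|.
  rewrite e; apply: le_trans (le_normr_Rintegral measurableT Igl) _.
  apply: le_trans (le_Rint Ial I3 lb') _.
  by rewrite (RintD (IintD I1 If) I2) (RintD I1 If) (RintZ _ IG) (RintZ _ (sqint_Iint sm)) eG -ipE.
move: g0; rewrite le_eqVlt => /orP[/eqP <-|g0].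
  rewrite mul0r; under eq_Rintegral do rewrite mul0r.
  by rewrite Rintegral_cst// mul0r normr0.
have Il : Iint l.
  rewrite (_ : l = fun x => gamma^-1 * (gamma * l x)); first exact: IintZ.
  by apply/funext => x; rewrite mulKf// gt_eqF.
by rewrite (RintZ _ Il) normrM gtr0_norm.
Qed.

Hypothesis W_confining : forall A : R, exists n, forall x, ~ cube n x -> A <= W x.
Variables (gamma C : R).
Hypotheses (gamma_gt0 : 0 < gamma) (C_ge0 : 0 <= C).
Hypothesis W_dominates_rotation : forall x,
  gamma ^+ 2 / 2 * (x ord0 (ax1 d_ge2) ^+ 2 + x ord0 (ax2 d_ge2) ^+ 2) <= W x + C.

Let q_gt2 : 2 < q. Proof. by rewrite -[2]/(1 + 1) ltrD2r. Qed.
Let c_gt0 : 0 < c. Proof. by rewrite divr_gt0 ?p1_gt0. Qed.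

Lemma action_real (Omega : R) u : admissible u -> (forall x, 0 <= u x) ->
  energy_space V (cplx u (cst 0)) /\
  action d_ge2 p V Omega omega (cplx u (cst 0)) =
  (energy u - Omega * angular_momentum d_ge2 (cplx u (cst 0)))%:E.
Proof.
move=> [hu iu Iu] u0; have e := energy_space_real u0 hu iu; split => //.
rewrite actionE//; last by rewrite modulus_nonneg_real.
congr EFin; rewrite -(real_action_real u0 hu) /real_action; ring.
Qed.

(** Comparison of a ground state with a nonnegative real competitor, whose action
is finite. *)
Lemma ground_state_modulus (Omega : R) f u :
  action_ground_states d_ge2 p V Omega omega f -> admissible u -> (forall x, 0 <= u x) ->
  [/\ energy_space V f, admissible (modulus f), energy (modulus f) <= real_action 0 f &
    real_action Omega f <= energy u - Omega * angular_momentum d_ge2 (cplx u (cst 0))].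
Proof.
move=> [hf fmin] au u0; have [hu eu] := action_real Omega au u0.
have le_u := fmin _ hu; rewrite eu in le_u.
have Ip := action_lty hf (le_lt_trans le_u (ltry _)).
have [am em] := admissible_modulus hf Ip; split => //.
by rewrite -lee_fin -actionE.
Qed.

Lemma minimizer_ground_state u0 : admissible u0 -> (forall x, 0 <= u0 x) ->
  (forall w, admissible w -> energy u0 <= energy w) ->
  action_ground_states d_ge2 p V 0 omega (cplx u0 (cst 0)).
Proof.
move=> a0 p0 min0; have [h0 e0] := action_real 0 a0 p0; split => // g hg.
rewrite e0 mul0r subr0; case: (ltP (action d_ge2 p V 0 omega g) +oo%E) => [glt|].
  have Ig := action_lty hg glt; rewrite actionE// lee_fin.
  by have [ag eg] := admissible_modulus hg Ig; exact: le_trans (min0 _ ag) eg.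
by rewrite leye_eq => /eqP ->; exact: leey.
Qed.

(** The modulus of psi is a minimiser of the real energy, and stability with every
tolerance e puts it at distance 0 from u0. *)
Lemma nonneg_ground_state_unique u0 psi : admissible u0 -> (forall x, 0 <= u0 x) ->
  (forall w, admissible w -> energy u0 <= energy w) ->
  action_ground_states d_ge2 p V 0 omega psi -> ae_nonneg psi ->
  ae_equal psi (cplx u0 (cst 0)).
Proof.
move=> a0 p0 min0 gpsi psi0.
have [hpsi av ev] := ground_state_modulus gpsi a0 p0.
rewrite mul0r subr0 => psi_le; have {ev psi_le}ev := le_trans ev psi_le.
have [hd Wd] := admissible_sub mW W_ge0 av a0.
have d0 := dirichlet_ge0 (modulus psi \- u0).
have P0 : 0 <= pot (modulus psi \- u0) by exact: pot_ge0.
have dist0 : ip (modulus psi \- u0) (modulus psi \- u0) = 0.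
  apply/eqP; rewrite eq_le ip_ge0 andbT; apply/ler_addgt0Pl => e e0; rewrite addr0.
  have [del del0 hdel] := energy_stability q_gt2 c_gt0 mW W_ge0 W_confining min0 e0.
  have E1 : energy u0 <= energy u0 + del by rewrite lerDl ltW.
  apply: le_trans (hdel _ _ av a0 (modulus_ge0 psi) p0 (le_trans ev E1) E1).
  by rewrite lerDr addr_ge0.
have := ip_eq0_ae (rH1_sqint hd) dist0.
apply: filterS2 psi0 => x psix /eqP; rewrite /= subr_eq0 /cplx => /eqP <-.
by rewrite -normc_modulus -[LHS](ger0_norm psix).
Qed.

(** The bound on Omega has three parts: 1 to bound the angular momentum of u0,
gamma / 2 to absorb the rotation term, and the last one to make the excess
Omega (|L0| + B) at most del, where B bounds the angular momenta of all the
ground states at once. *)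
Lemma small_rotation_energy u0 del : admissible u0 -> (forall x, 0 <= u0 x) -> 0 < del ->
  exists2 r, 0 < r & forall Omega f, 0 < Omega -> Omega < r ->
    action_ground_states d_ge2 p V Omega omega f -> energy (modulus f) <= energy u0 + del.
Proof.
move=> a0 p0 del0.
pose L0 := angular_momentum d_ge2 (cplx u0 (cst 0)).
have K00 : 0 <= `|energy u0| + `|L0| by rewrite addr_ge0.
have C'0 : 0 <= `|omega| + C by rewrite addr_ge0.
have [K K0 hK] := coercive q_gt2 c_gt0 W_ge0 W_confining K00 C'0.
pose B := gamma^-1 * (2^-1 * K + K + C * K).
have B0 : 0 <= B.
  by rewrite mulr_ge0 ?invr_ge0 ?(ltW gamma_gt0)// !addr_ge0// mulr_ge0.
have S0 : 0 < `|L0| + B + 1 by rewrite ltr_wpDl// addr_ge0.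
exists (Num.min (Num.min 1 (gamma / 2)) (del / (`|L0| + B + 1))).
  by rewrite !lt_min ltr01 !divr_gt0.
move=> Omega f O0; rewrite !lt_min => /andP[/andP[lt1 ltg] ltdel] gf.
have [hf af ef] := ground_state_modulus gf a0 p0; rewrite -/L0 => lf.
have bL := angular_momentum_bound (ltW gamma_gt0) C_ge0 W_dominates_rotation hf.
have D0 : 0 <= kin f by rewrite addr_ge0// dirichlet_ge0.
have P0 : 0 <= pot (modulus f) by exact: pot_ge0.
have M0 := ip_ge0 leb (modulus f).
have e0L : real_action 0 f = real_action Omega f + Omega * angular_momentum d_ge2 f.
  by rewrite /real_action; ring.
have OL0 : - (Omega * L0) <= Omega * `|L0|.
  by rewrite -mulrN ler_pM2l// -normrN ler_norm.
have OL : Omega * angular_momentum d_ge2 f <= Omega * `|angular_momentum d_ge2 f|.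
  by rewrite ler_pM2l// ler_norm.
have [Kf Pf Mf] : [/\ kin f <= K, pot (modulus f) <= K & ip (modulus f) (modulus f) <= K].
  apply: hK => //.
  have OL1 : Omega * `|L0| <= `|L0| by rewrite ler_piMl// ltW.
  have OL2 : Omega * `|angular_momentum d_ge2 f| <=
      2^-1 * (gamma * `|angular_momentum d_ge2 f|).
    move: (normr_ge0 (angular_momentum d_ge2 f)); move: (`|angular_momentum d_ge2 f|) => A A0.
    by rewrite mulrA [2^-1 * _]mulrC ler_wpM2r// ltW.
  have oM : - (omega * ip (modulus f) (modulus f)) <= `|omega| * ip (modulus f) (modulus f).
    by rewrite -mulNr ler_wpM2r// -normrN ler_norm.
  have E0 := ler_norm (energy u0).
  have CM : 0 <= C * ip (modulus f) (modulus f) by rewrite mulr_ge0.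
  rewrite [(_ + C) * _]mulrDl; move: lf; rewrite {1}/real_action => lf.
  exact: rotation_absorbed lf bL OL0 OL OL1 OL2 oM E0 CM.
have LB : `|angular_momentum d_ge2 f| <= B.
  rewrite /B ler_pdivlMl//; apply: le_trans bL _.
  by rewrite !lerD// ler_wpM2l// invr_ge0.
apply: le_trans ef _; rewrite e0L.
have OB : Omega * `|angular_momentum d_ge2 f| <= Omega * B by rewrite ler_pM2l.
apply: le_trans (lerD lf (le_trans OL OB)) _; rewrite -addrA lerD2l.
apply: le_trans (lerD OL0 (lexx _)) _; rewrite -mulrDr.
apply: (@le_trans _ _ (Omega * (`|L0| + B + 1))); first by rewrite ler_pM2l// lerDl.
by rewrite -ler_pdivlMr// ltW.
Qed.

Lemma small_rotation_distance u0 e : admissible u0 -> (forall x, 0 <= u0 x) ->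
  (forall w, admissible w -> energy u0 <= energy w) -> 0 < e ->
  exists2 r, 0 < r & forall Omega f, 0 < Omega -> Omega < r ->
    action_ground_states d_ge2 p V Omega omega f ->
    exists2 y, 0 <= y <= e & normX V (fun x => cmodulus f x - cplx u0 (cst 0) x) = y%:E.
Proof.
move=> a0 p0 min0 e0; have e20 : 0 < e ^+ 2 by rewrite exprn_gt0.
have [del del0 hdel] := energy_stability q_gt2 c_gt0 mW W_ge0 W_confining min0 e20.
have [r r0 hr] := small_rotation_energy a0 p0 del0.
exists r => // Omega f O0 Or gf.
have [hf af _ _] := ground_state_modulus gf a0 p0.
have [hd Wd] := admissible_sub mW W_ge0 af a0.
have -> : (fun x => cmodulus f x - cplx u0 (cst 0) x) = cplx (modulus f \- u0) (cst 0).
  by apply/funext => x; rewrite cmodulusE /cplx /=; congr Complex; rewrite subr0.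
exists (Num.sqrt (dirichlet (modulus f \- u0) + pot (modulus f \- u0) +
    ip (modulus f \- u0) (modulus f \- u0))); last exact: normXE.
rewrite sqrtr_ge0 -[leRHS](ger0_norm (ltW e0)) -sqrtr_sqr ler_wsqrtr//.
apply: hdel => //; first exact: modulus_ge0.
  exact: hr Or gf.
by rewrite lerDl ltW.
Qed.

End ActionFunctional.

Theorem theorem4p4 (R : realType) (d : nat) (d_ge2 : (2 <= d)%N)
    (p : R) (p_gt1 : 1 < p)
    (p_subcritical : (3 <= d)%N -> p < (d%:R + 2) / (d%:R - 2))
    (V : 'rV[R]_d -> R) (V_measurable : lebesgue_measurable V)
    (V_ge0 : forall x, 0 <= V x) (V_infty : tends_to_infty V)
    (Omega_max_gt0 : (0 < Omega_max d_ge2 V)%E)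
    (omega : R) (omega_lt : (omega%:E < - lambda0 d_ge2 V 0)%E) :
  exists phi_omega : 'rV[R]_d -> R[i],
    [/\ action_ground_states d_ge2 p V 0 omega phi_omega,
        ae_nonneg phi_omega,
        forall psi : 'rV[R]_d -> R[i],
          action_ground_states d_ge2 p V 0 omega psi -> ae_nonneg psi ->
          ae_equal psi phi_omega &
        forall phi : R -> 'rV[R]_d -> R[i],
          (forall Omega : R, 0 < Omega -> (Omega%:E < Omega_max d_ge2 V)%E ->
             action_ground_states d_ge2 p V Omega omega (phi Omega)) ->
          (forall Omega : R, 0 < Omega -> (Omega%:E < Omega_max d_ge2 V)%E ->
             energy_space V (cmodulus (phi Omega))) /\
          normX V (fun x => cmodulus (phi Omega) x - phi_omega x)
            @[Omega --> 0^'+] --> 0%E].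
Proof.
have [_ [gamma [g0 rot] <-] gpos] := ereal_sup_gt Omega_max_gt0.
rewrite lte_fin in gpos.
have gmax : (gamma%:E <= Omega_max d_ge2 V)%E by apply: ereal_sup_ubound; exists gamma.
have [W [mW W0 Wconf [N mN [N0 VW]] [C C0 Wrot]]] :=
  exists_borel_version (ax_neq d_ge2) V_measurable V_ge0 V_infty rot.
have q_gt2 : 2 < p + 1 by rewrite -[2]/(1 + 1) ltrD2r.
have c_gt0 : 0 < 2 / (p + 1) by rewrite divr_gt0// (lt_trans _ q_gt2).
have [u0 [a0 p0 min0]] := exists_minimizer omega q_gt2 c_gt0 mW W0 Wconf.
exists (cplx u0 (cst 0)); split.
- exact: (minimizer_ground_state d_ge2 p_gt1 V_ge0 mW W0 mN N0 VW a0 p0 min0).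
- by apply: aeW => x; rewrite /cplx lecE /= eqxx p0.
- move=> psi gpsi psi0.
  exact: (nonneg_ground_state_unique p_gt1 V_ge0 mW W0 mN N0 VW Wconf a0 p0 min0 gpsi psi0).
move=> phi gphi; split.
  move=> Omega O0 Omax; have [/(energy_spaceP V_ge0 mW W0 mN N0 VW)[hf If] _] := gphi _ O0 Omax.
  rewrite cmodulusE.
  apply: (energy_space_real V_ge0 mW W0 mN N0 VW) => //; first exact: modulus_ge0.
  exact: (H1_modulus hf).1.
(* Below gamma the hypothesis on [phi] applies, as gamma <= Omega_max. *)
have small e : 0 < e -> \forall Omega \near (0 : R)^'+, exists2 y, 0 <= y <= e &
    normX V (fun x => cmodulus (phi Omega) x - cplx u0 (cst 0) x) = y%:E.
  move=> e0; have [r r0 hr] := small_rotation_distance p_gt1 V_ge0 mW W0 mN N0 VW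
    Wconf gpos C0 Wrot a0 p0 min0 e0.
  have s0 : 0 < Num.min r gamma by rewrite lt_min r0.
  near=> Omega.
  have O0 : 0 < Omega by near: Omega; exact: nbhs_right_gt.
  have : Omega < Num.min r gamma by near: Omega; exact: nbhs_right_lt.
  rewrite lt_min => /andP[ltr ltg]; apply: (hr Omega) => //; apply: gphi => //.
  by apply: lt_le_trans gmax; rewrite lte_fin.
apply/fine_cvgP; split.
  by apply: filterS (small 1 ltr01) => Omega [y _ ->].
apply/cvgr0Pnorm_le => e e0; apply: filterS (small e e0) => Omega [y /andP[y0 ye] /= ->] /=.
by rewrite ger0_norm.
Unshelve. all: by end_near.
Qed.
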